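(* There are algorithms which, given an ordered family $I_1,\dots,I_n$ of $n$ intervals on the real line, find in $O(n\log n)$ time, respectively: (1) a quasi-online $3$-proper $2$-coloring, i.e. a coloring of $I_1,\dots,I_n$ with $2$ colors such that for every $t\in\{1,\dots,n\}$, every point of $\mathbb{R}$ contained in at least $3$ of the intervals $I_1,\dots,I_t$ is contained in two intervals of different colors among $I_1,\dots,I_t$; (2) a quasi-online $2$-proper $3$-coloring, i.e. a coloring of $I_1,\dots,I_n$ with $3$ colors such that for every $t\in\{1,\dots,n\}$, every point of $\mathbb{R}$ contained in at least $2$ of the intervals $I_1,\dots,I_t$ is contained in two intervals of different colors among $I_1,\dots,I_t$.
   Context: An interval is a set $\{x\in\mathbb{R} : x_0<x<x_1\}$ for fixed $x_0,x_1$; an interval is given by its two endpoints. Running time is counted in elementary operations of a standard random access machine in which comparing two endpoints takes unit time. The entire ordered family is given as input. *)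

(* Defs.v *)
From mathcomp Require Import all_boot all_order all_algebra.
From mathcomp Require Import classical_sets reals topology normedtype landau.
From mathcomp Require Import sequences exp.

Set Implicit Arguments.
Unset Strict Implicit.
Unset Printing Implicit Defensive.

Import Order.TTheory GRing.Theory Num.Theory.
Import numFieldNormedType.Exports.

(* An ordered family of n intervals is given by its endpoints,
   I : 'I_n -> R * R, and I i stands for the open interval
   ](I i).1, (I i).2[, which is empty when (I i).2 <= (I i).1. *)

Section Colorings.
Local Open Scope ring_scope.
Variables (R : realType) (n : nat) (I : 'I_n -> R * R).

Definition covers (i : 'I_n) (x : R) : bool := x \in `](I i).1, (I i).2[.

(* Indices start at 0, so the intervals with (i < t)%N are the first t ones;
   equal intervals with different indices are counted separately. *)
Definition quasi_online_proper (m k : nat) (chi : 'I_n -> 'I_k) : Prop :=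
  forall t : nat, (1 <= t <= n)%N -> forall x : R,
    (m <= #|[set i : 'I_n | (i < t)%N && covers i x]|)%N ->
    exists i j : 'I_n,
      [/\ (i < t)%N, (j < t)%N, covers i x, covers j x & chi i != chi j].

(* The input array of length 2 n: the endpoints of interval i are at positions
   2 i (left) and 2 i + 1 (right). *)
Definition endpoints : seq R :=
  flatten [seq [:: (I i).1; (I i).2] | i <- enum 'I_n].

(* A comparison involving an invalid position answers false. *)
Definition endpoint_lt (a b : nat) : bool :=
  [&& (a < size endpoints)%N, (b < size endpoints)%N
    & endpoints`_a < endpoints`_b].

End Colorings.

(* A random access machine over the natural numbers.  Every instruction has
   unit cost; as in the model of Cook and Reckhow, the only arithmetic
   operations are addition and (truncated) subtraction.  The endpoints are in a
   read-only array that can only be accessed by comparing two of its entries,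
   whose positions are held in registers; other data refer to an endpoint
   through its position. *)

Inductive instr : Type :=
| Const (dst k : nat)
| Move (dst src : nat)
| Add (dst a b : nat)
| Sub (dst a b : nat)
| Fetch (dst addr : nat)
| Store (addr src : nat)
| Jump (l : nat)
| JumpLt (a b l : nat)
| JumpEndLt (a b l : nat).

Definition program := seq instr.

Record state : Type := State {
  pc : nat;
  reg : nat -> nat;
  memory : nat -> nat }.

(* The machine halts when the program counter leaves the program. *)
Definition halted (P : program) (s : state) : bool := size P <= pc s.

Section Semantics.
Variable cmp : nat -> nat -> bool.

Definition exec (c : instr) (s : state) : state :=
  let: State p r m := s in
  match c with
  | Const d k => State p.+1 [eta r with d |-> k] m
  | Move d a => State p.+1 [eta r with d |-> r a] m
  | Add d a b => State p.+1 [eta r with d |-> r a + r b] m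
  | Sub d a b => State p.+1 [eta r with d |-> r a - r b] m
  | Fetch d a => State p.+1 [eta r with d |-> m (r a)] m
  | Store a b => State p.+1 r [eta m with r a |-> r b]
  | Jump l => State l r m
  | JumpLt a b l => State (if r a < r b then l else p.+1) r m
  | JumpEndLt a b l => State (if cmp (r a) (r b) then l else p.+1) r m
  end.

(* Halted states are fixed, so a computation takes at most t steps iff it is
   halted after t steps. *)
Definition step (P : program) (s : state) : state :=
  if halted P s then s else exec (nth (Jump (pc s)) P (pc s)) s.

End Semantics.

(* Initially register 0 holds n, and everything else is 0. *)
Definition init (n : nat) : state :=
  State 0 [eta fun=> 0 with 0 |-> n] (fun=> 0).

Definition run (P : program) (R : realType) (n : nat) (I : 'I_n -> R * R)
    (t : nat) : state :=
  iter t (step (endpoint_lt I) P) (init n).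

(* P stops within t steps, with the color of interval i in memory cell i. *)
Definition outputs_within (P : program) (R : realType) (n : nat)
    (I : 'I_n -> R * R) (t k : nat) (chi : 'I_n -> 'I_k) : Prop :=
  halted P (run P I t) /\ forall i : 'I_n, memory (run P I t) i = chi i.

Local Open Scope classical_set_scope.

(* T bounds the running time for every n, including those where n * ln n = 0;
   the comparison of T with n * ln n is asymptotic. *)
Definition nlogn_quasi_online_algorithm (R : realType) (m k : nat) : Prop :=
  exists (P : program) (T : nat -> nat),
    ((fun n => (T n)%:R : R) =O_\oo (fun n => n%:R * ln n%:R : R))%R /\
    forall (n : nat) (I : 'I_n -> R * R),
      exists chi : 'I_n -> 'I_k,
        outputs_within P I (T n) chi /\ quasi_online_proper I m chi.

(* Main.v *)
Require Import Defs.
From mathcomp Require Import all_boot zify.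
From Stdlib Require Import FunctionalExtensionality.

Set Implicit Arguments.
Unset Strict Implicit.
Unset Printing Implicit Defensive.

(** Both colourings are found by one scheme: sort the endpoints, insert the
    intervals one by one into a search structure while delaying the choice of
    the colours, and fix the colours at the end.

    Cells.  A tournament tree sorts the endpoints; as the intervals are open,
    a right endpoint comes before the equal left ones.  A point x of the line
    is replaced by its cell, the rank of the last endpoint before it, and the
    interval i covers the cells x with lf i <= x < rt i.  One more interval,
    around all others, is added at the end of the input.

    Links.  The interval i has the label i + 1.  A link (v, a, b) asks that the
    label v get a colour different from those of a and b.  Links are pushed on
    a stack so that a and b are pushed later than v or never; giving to each
    label in turn, from the top of the stack, the least colour missing at a and
    b satisfies all links (linked_paint).  Three colours are enough, and two if
    a = b in all links.  Links are never withdrawn, so what the links of the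
    first t intervals enforce holds for the final colouring: this is where the
    colourings become quasi-online.

    Two colours.  The stage t keeps super-intervals with labels such that each
    cell of a super-interval has a cover with the colour of its label, and each
    cell that does not see two colours has at most as many covers as there are
    super-intervals around it (faithful).  No super-interval contains another
    and no three of them share a cell (chain), so that a cell with three covers
    sees two colours.  The new interval is a new super-interval, and the chain
    is restored by two operations.  If M is contained in A, then M is dropped
    and linked to A (faithful_sub).  If A, M and B share a cell, from left to
    right, then M is linked to A and B to M, so that A and B have the same
    colour: M is dropped, and A and B are merged (faithful_merge).

    Three colours.  The stage t keeps a labelling of the covered cells, with
    each label on one block of cells, such that if neighbouring labels get
    different colours (separated), then each covered cell sees two colours or
    has a single cover, with the colour of its label (tells).  The new interval
    I has to avoid the colours of all the labels q 0, ..., q J that it meets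
    from right to left, and neighbours among these have to be different.  If I
    covers a new cell, then I labels all its cells; q 0 and q J become
    neighbours of I, and links take care of the other labels (labelled_gap).
    Otherwise all q j avoid the colour of I, hence alternate between two
    colours.  If J is even, q 0 and q J have the same colour and their blocks
    are joined (labelled_even); if J is odd, their colours are different and
    the blocks of q 0 and q J are made neighbours (labelled_odd).  The last
    interval covers new cells, so that it becomes the only label, and every colouring is
    separated then.

    Time.  Each insertion does a bounded number of queries and updates of a
    tree of logarithmic height, and further ones for each key that it deletes,
    which a potential proportional to the number of keys pays for.  The
    algorithms are written in a structured language, compiled to the machine
    with a number of steps proportional to the number of iterations of loops
    (compile_ok). *)

(** * A structured language *)

Inductive expr : Type :=
| Cst of nat
| Size
| Var of nat
| Plus of expr & expr
| Minus of expr & expr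
| Get of nat & expr.

Inductive test : Type := Lt of expr & expr | EndLt of expr & expr.

Inductive com : Type :=
| Skip
| Asg of nat & expr
| Put of nat & expr & expr
| Out of expr & expr
| Seq of com & com
| If of test & com & com
| While of test & com.

(** The clock ck counts the iterations of all loops. *)
Record store : Type := MkStore {
  vr : nat -> nat;
  ar : nat -> nat -> nat;
  ou : nat -> nat;
  ck : nat }.

Definition upd (T : Type) (f : nat -> T) (x : nat) (v : T) : nat -> T :=
  fun y => if y == x then v else f y.

Definition setv s x v := MkStore (upd (vr s) x v) (ar s) (ou s) (ck s).
Definition seta s A i v :=
  MkStore (vr s) (upd (ar s) A (upd (ar s A) i v)) (ou s) (ck s).
Definition seto s i v := MkStore (vr s) (ar s) (upd (ou s) i v) (ck s).
Definition tick s := MkStore (vr s) (ar s) (ou s) (ck s).+1.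

Section Language.
Variables (n : nat) (cmp : nat -> nat -> bool).

Fixpoint eval (s : store) (e : expr) : nat :=
  match e with
  | Cst k => k
  | Size => n
  | Var x => vr s x
  | Plus a b => eval s a + eval s b
  | Minus a b => eval s a - eval s b
  | Get A a => ar s A (eval s a)
  end.

Definition teval (s : store) (b : test) : bool :=
  match b with
  | Lt a b => eval s a < eval s b
  | EndLt a b => cmp (eval s a) (eval s b)
  end.

(** Outputs are confined to the first n cells, because the arrays are stored
    behind them. *)
Inductive ev : com -> store -> store -> Prop :=
| EvSkip s : ev Skip s s
| EvAsg x e s : ev (Asg x e) s (setv s x (eval s e))
| EvPut A a e s : ev (Put A a e) s (seta s A (eval s a) (eval s e))
| EvOut a e s of eval s a < n : ev (Out a e) s (seto s (eval s a) (eval s e))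
| EvSeq c1 c2 s s1 s2 of ev c1 s s1 & ev c2 s1 s2 : ev (Seq c1 c2) s s2
| EvIf b c1 c2 s s1 of ev (if teval s b then c1 else c2) s s1 :
    ev (If b c1 c2) s s1
| EvStop b c s of ~~ teval s b : ev (While b c) s s
| EvLoop b c s s1 s2 of teval s b & ev c (tick s) s1
    & ev (While b c) s1 s2 : ev (While b c) s s2.

Lemma ev_ck c s s' : ev c s s' -> ck s <= ck s'.
Proof.
elim=> //= [c1 c2 s0 s1 s2 _ h1 _ h2|b c0 s0 s1 s2 _ _ h1 _ h2].
  exact: leq_trans h2.
exact: leq_trans (ltnW h1) h2.
Qed.

(** * Compilation to the machine *)

(** Register 0 keeps the number of intervals; the others are shared between
    the variables and the temporaries of the evaluation of expressions. *)
Definition rvar x := x.*2.+2.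
Definition rtmp d := d.*2.+1.

(** Sixteen arrays are interleaved behind the n cells of the output: the entry
    i of the array A is in the cell n + 16 i + A, and four doublings multiply
    i by 16. *)
Definition address d A :=
  nseq 4 (Add (rtmp d) (rtmp d) (rtmp d)) ++
  [:: Const (rtmp d.+1) A; Add (rtmp d) (rtmp d) (rtmp d.+1);
      Add (rtmp d) (rtmp d) 0].

Fixpoint cexpr d (e : expr) : seq instr :=
  match e with
  | Cst k => [:: Const (rtmp d) k]
  | Size => [:: Move (rtmp d) 0]
  | Var x => [:: Move (rtmp d) (rvar x)]
  | Plus a b => cexpr d a ++ cexpr d.+1 b ++
                [:: Add (rtmp d) (rtmp d) (rtmp d.+1)]
  | Minus a b => cexpr d a ++ cexpr d.+1 b ++
                [:: Defs.Sub (rtmp d) (rtmp d) (rtmp d.+1)]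
  | Get A a => cexpr d a ++ address d A ++ [:: Fetch (rtmp d) (rtmp d)]
  end.

Definition ctest (b : test) : seq instr :=
  match b with Lt x y | EndLt x y => cexpr 0 x ++ cexpr 1 y end.

Definition jump_if (b : test) l : instr :=
  match b with
  | Lt _ _ => JumpLt (rtmp 0) (rtmp 1) l
  | EndLt _ _ => JumpEndLt (rtmp 0) (rtmp 1) l
  end.

Fixpoint csize (c : com) : nat :=
  match c with
  | Skip => 0
  | Asg _ e => size (cexpr 0 e) + 1
  | Put A a e => size (cexpr 0 a ++ address 0 A ++ cexpr 1 e) + 1
  | Out a e => size (cexpr 0 a ++ cexpr 1 e) + 1
  | Seq c1 c2 => csize c1 + csize c2
  | If b c1 c2 => size (ctest b) + (csize c2 + csize c1 + 2)
  | While b c => size (ctest b) + (csize c + 3)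
  end.

Fixpoint compile p (c : com) : seq instr :=
  match c with
  | Skip => [::]
  | Asg x e => cexpr 0 e ++ [:: Move (rvar x) (rtmp 0)]
  | Put A a e => (cexpr 0 a ++ address 0 A ++ cexpr 1 e) ++
                 [:: Store (rtmp 0) (rtmp 1)]
  | Out a e => (cexpr 0 a ++ cexpr 1 e) ++ [:: Store (rtmp 0) (rtmp 1)]
  | Seq c1 c2 => compile p c1 ++ compile (p + csize c1) c2
  | If b c1 c2 =>
      let q := p + size (ctest b) in
      let r := q + csize c2 + 2 in
      ctest b ++ jump_if b r :: compile q.+1 c2 ++
      Jump (r + csize c1) :: compile r c1
  | While b c =>
      let q := p + size (ctest b) in
      ctest b ++ jump_if b (q + 2) :: Jump (q + 3 + csize c) ::
      compile (q + 2) c ++ [:: Jump p]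
  end.

Lemma size_compile c p : size (compile p c) = csize c.
Proof.
elim: c p => //= [x e|A a e|a e|c1 h1 c2 h2|b c1 h1 c2 h2|b c h] p.
- by rewrite size_cat.
- by rewrite [LHS]size_cat.
- by rewrite [LHS]size_cat.
- by rewrite size_cat h1 h2.
- by rewrite size_cat /= size_cat /= h1 h2; lia.
- by rewrite size_cat /= size_cat /= h; lia.
Qed.

Fixpoint wfe (e : expr) : bool :=
  match e with
  | Plus a b | Minus a b => wfe a && wfe b
  | Get A a => (A < 16) && wfe a
  | _ => true
  end.

Definition wft b := match b with Lt x y | EndLt x y => wfe x && wfe y end.

Fixpoint wfc (c : com) : bool :=
  match c with
  | Skip => true
  | Asg _ e => wfe e
  | Put A a e => [&& A < 16, wfe a & wfe e]
  | Out a e => wfe a && wfe e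
  | Seq c1 c2 => wfc c1 && wfc c2
  | If b c1 c2 => [&& wft b, wfc c1 & wfc c2]
  | While b c => wft b && wfc c
  end.

Definition straight (i : instr) : bool :=
  match i with
  | Jump _ | JumpLt _ _ _ | JumpEndLt _ _ _ => false
  | _ => true
  end.

Definition datum : Type := (nat -> nat) * (nat -> nat).

Definition effect (d : datum) (i : instr) : datum :=
  let s := exec cmp i (State 0 d.1 d.2) in (reg s, memory s).

Notation block := (foldl effect).

Definition code_at (P : program) p (l : seq instr) :=
  forall j z, j < size l -> p + j < size P /\ nth z P (p + j) = nth z l j.

Lemma code_at_cat P p l1 l2 : code_at P p (l1 ++ l2) ->
  code_at P p l1 /\ code_at P (p + size l1) l2.
Proof.
move=> h; split=> j z lt_j.
  have [|h1 h2] := h j z; first by rewrite size_cat; lia.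
  by rewrite nth_cat lt_j in h2.
have [|h1 h2] := h (size l1 + j) z; first by rewrite size_cat; lia.
by move: h1 h2; rewrite nth_cat addKn addnA ifF ?ltnNge ?leq_addr.
Qed.

Lemma code_at_cons P p i l : code_at P p (i :: l) ->
  code_at P p [:: i] /\ code_at P p.+1 l.
Proof. by rewrite -addn1; apply: (@code_at_cat P p [:: i] l). Qed.

Local Notation mstep := (step cmp).

Lemma step_at P p i d : code_at P p [:: i] ->
  mstep P (State p d.1 d.2) = exec cmp i (State p d.1 d.2).
Proof.
move=> /(_ 0 (Jump p) isT) [h1 h2].
by move: h1 h2; rewrite addn0 /step /halted /= => h1 ->; rewrite leqNgt h1.
Qed.

Lemma block_run P p l d : all straight l -> code_at P p l ->
  iter (size l) (mstep P) (State p d.1 d.2) =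
    State (p + size l) (block d l).1 (block d l).2.
Proof.
elim: l p d => [|i l IH] p d /=; first by rewrite addn0.
move=> /andP[si sl] /code_at_cons[hi hl].
rewrite -iterS iterSr (step_at _ hi) -addSnnS -(IH _ (effect d i)) //.
by case: i si {hi}.
Qed.

(** How the machine represents a store. *)
Definition agree (s : store) (d : datum) : Prop :=
  [/\ d.1 0 = n, forall x, d.1 (rvar x) = vr s x,
      forall A i, A < 16 -> d.2 (n + (16 * i + A)) = ar s A i
    & forall i, i < n -> d.2 i = ou s i].

(** The evaluation of an expression at level d only spoils the temporaries of
    the levels d and above. *)
Definition saves d (r r' : nat -> nat) : Prop :=
  forall x, ~~ odd x || (x < rtmp d) -> r' x = r x.

Lemma saves_trans d r1 r2 r3 : saves d r1 r2 -> saves d r2 r3 -> saves d r1 r3.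
Proof. by move=> h1 h2 x hx; rewrite h2 // h1. Qed.

Lemma savesS d r r' : saves d.+1 r r' -> saves d r r'.
Proof. by move=> h x hx; apply: h; rewrite /rtmp in hx *; lia. Qed.

Lemma saves_set d r v : saves d r [eta r with rtmp d |-> v].
Proof. by move=> x; rewrite /rtmp /=; case: eqP => // ->; lia. Qed.

Lemma agree_saves s r r' m d : agree s (r, m) -> saves d r r' ->
  agree s (r', m).
Proof.
by case=> /= h0 hv ha ho h; split=> //= [|x]; rewrite h // /rvar /=; lia.
Qed.

Lemma address_ok d A r m : r 0 = n ->
  exists r', [/\ block (r, m) (address d A) = (r', m), saves d r r'
    & r' (rtmp d) = n + (16 * r (rtmp d) + A)].
Proof.
move=> r0; eexists; split; first reflexivity.
  move=> x; rewrite /address /= /rtmp.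
  by repeat case: eqP => [->|_]; lia.
rewrite /= eqxx.
have -> : (rtmp d == rtmp d.+1) = false by rewrite /rtmp; lia.
have -> : (rtmp d.+1 == rtmp d) = false by rewrite /rtmp; lia.
by rewrite eqxx /= r0; lia.
Qed.

Lemma straight_address d A : all straight (address d A).
Proof. by []. Qed.

Opaque address.

Lemma cexpr_ok e d s r m : wfe e -> agree s (r, m) ->
  exists r', [/\ block (r, m) (cexpr d e) = (r', m), saves d r r'
    & r' (rtmp d) = eval s e].
Proof.
elim: e d r => [k||x|a ha b hb|a ha b hb|A a ha] d r wf ag.
- exists [eta r with rtmp d |-> k]; split=> //=; last by rewrite eqxx.
  exact: saves_set.
- have [/= r0 _ _ _] := ag.
  exists [eta r with rtmp d |-> r 0]; split=> //=; last by rewrite eqxx.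
  exact: saves_set.
- have [/= _ rx _ _] := ag.
  exists [eta r with rtmp d |-> r (rvar x)]; split=> //=; last by rewrite eqxx.
  exact: saves_set.
- have /andP[wa wb] := wf; have [r1 [e1 s1 v1]] := ha d r wa ag.
  have [r2 [e2 s2 v2]] := hb d.+1 r1 wb (agree_saves ag s1); rewrite /=.
  exists [eta r2 with rtmp d |-> r2 (rtmp d) + r2 (rtmp d.+1)]; split.
  + by rewrite !foldl_cat e1 e2.
  + apply: saves_trans s1 (saves_trans (savesS s2) _).
    exact: saves_set.
  + by rewrite /= eqxx s2 ?v1 ?v2 // /rtmp; lia.
- have /andP[wa wb] := wf; have [r1 [e1 s1 v1]] := ha d r wa ag.
  have [r2 [e2 s2 v2]] := hb d.+1 r1 wb (agree_saves ag s1); rewrite /=.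
  exists [eta r2 with rtmp d |-> r2 (rtmp d) - r2 (rtmp d.+1)]; split.
  + by rewrite !foldl_cat e1 e2.
  + apply: saves_trans s1 (saves_trans (savesS s2) _).
    exact: saves_set.
  + by rewrite /= eqxx s2 ?v1 ?v2 // /rtmp; lia.
- have /andP[hA wa] := wf; have [r1 [e1 s1 v1]] := ha d r wa ag.
  have ag1 := agree_saves ag s1; have [/= r0 _ rm _] := ag1.
  have [r2 [e2 s2 v2]] := @address_ok d A r1 m r0.
  exists [eta r2 with rtmp d |-> m (r2 (rtmp d))]; split.
  + by rewrite foldl_cat e1 foldl_cat e2.
  + apply: saves_trans s1 (saves_trans s2 _).
    exact: saves_set.
  + by rewrite /= eqxx v2 rm // v1.
Qed.

Lemma straight_cexpr d e : all straight (cexpr d e).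
Proof.
elim: e d => //= [a ha b hb|a ha b hb|A a ha] d;
  by rewrite !all_cat /= ?straight_address ?ha ?hb.
Qed.

Lemma ctest_ok b s r m : wft b -> agree s (r, m) ->
  exists r', [/\ block (r, m) (ctest b) = (r', m), agree s (r', m)
    & forall p l, exec cmp (jump_if b l) (State p r' m) =
        State (if teval s b then l else p.+1) r' m].
Proof.
case: b => x y /= /andP[wx wy] ag;
  have [r1 [e1 s1 v1]] := cexpr_ok 0 wx ag;
  have [r2 [e2 s2 v2]] := cexpr_ok 1 wy (agree_saves ag s1);
  (exists r2; split; first by rewrite foldl_cat e1 e2);
  by [exact: agree_saves (agree_saves ag s1) s2 | move=> p l /=;
      rewrite v2 s2 ?v1].
Qed.

Lemma straight_ctest b : all straight (ctest b).
Proof. by case: b => x y; rewrite /= all_cat !straight_cexpr. Qed.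

Lemma agree_setv s r m x v : agree s (r, m) ->
  agree (setv s x v) (upd r (rvar x) v, m).
Proof.
case=> /= h0 hv ha ho; split=> //= y; rewrite /upd.
by rewrite -[rvar y == rvar x]/(y.*2 == x.*2) -hv !eqn_leq !leq_double.
Qed.

Lemma agree_seta s r m A i v : A < 16 -> agree s (r, m) ->
  agree (seta s A i v) (r, upd m (n + (16 * i + A)) v).
Proof.
move=> hA [/= h0 hv ha ho]; split=> //= [B j hB|j hj].
  rewrite /upd /=; case: (B =P A) => [->|neq] /=.
    by case: (j =P i) => [->|neq]; rewrite ?eqxx ?ifF ?ha //; lia.
  by rewrite ifF ?ha //; lia.
by rewrite /upd ifF ?ho //; lia.
Qed.

Lemma agree_seto s r m i v : i < n -> agree s (r, m) ->
  agree (seto s i v) (r, upd m i v).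
Proof.
move=> hi [/= h0 hv ha ho]; split=> //= [B j hB|j hj].
  by rewrite /upd ifF ?ha //; lia.
by rewrite /upd ho.
Qed.

(** Only loop iterations are charged to the clock: between two of them a
    structured program runs through each of its instructions at most once, so
    that its length is a bound for the number of steps. *)
Lemma compile_ok P c p s s' d : ev c s s' -> wfc c -> code_at P p (compile p c) ->
  agree s d -> exists t d',
    [/\ iter t (mstep P) (State p d.1 d.2) = State (p + csize c) d'.1 d'.2,
        agree s' d' & t <= csize c * (ck s' - ck s).+1].
Proof.
move=> hev; elim: hev p d => {c s s'} /=
  [s|x e s|A a e s|a e s hi|c1 c2 s s1 s2 e1 h1 e2 h2|b c1 c2 s s1 e1 h1|b c s hb
  |b c s s1 s2 hb e1 h1 e2 h2] p [r m] wf cd ag.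
- by exists 0, (r, m); rewrite addn0.
- have [r1 [b1 s1 v1]] := cexpr_ok 0 wf ag.
  have [cd1 /= cd2] := code_at_cat cd.
  exists (size (cexpr 0 e) + 1), (upd r1 (rvar x) (r1 (rtmp 0)), m); split.
  + rewrite addnC iterD (@block_run _ _ _ (r, m)) ?straight_cexpr // b1 /=.
    by rewrite (step_at (r1, m) cd2) /= addnA addn1.
  + by rewrite v1; apply: agree_setv; apply: agree_saves ag s1.
  + by rewrite subnn muln1.
- have /and3P[hA wa we] := wf.
  have [r1 [b1 s1 v1]] := cexpr_ok 0 wa ag.
  have ag1 := agree_saves ag s1; have [/= r0 _ _ _] := ag1.
  have [r2 [b2 s2 v2]] := @address_ok 0 A r1 m r0.
  have ag2 := agree_saves ag1 s2.
  have [r3 [b3 s3 v3]] := cexpr_ok 1 we ag2.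
  have [cd1 cd2] := code_at_cat cd.
  set l := cexpr 0 a ++ _ in cd1 cd2 *.
  have hl : block (r, m) l = (r3, m) by rewrite foldl_cat b1 foldl_cat b2 b3.
  exists (size l + 1), (r3, upd m (r3 (rtmp 0)) (r3 (rtmp 1))); split.
  + rewrite addnC iterD (@block_run _ _ _ (r, m)) //; last first.
      by rewrite !all_cat ?straight_address !straight_cexpr.
    by rewrite hl /= (step_at (r3, m) cd2) /= addnA addn1.
  + rewrite v3 s3 // v2 v1; apply: agree_seta => //.
    exact: agree_saves ag2 s3.
  + by rewrite subnn muln1.
- have /andP[wa we] := wf.
  have [r1 [b1 s1 v1]] := cexpr_ok 0 wa ag.
  have ag1 := agree_saves ag s1.
  have [r3 [b3 s3 v3]] := cexpr_ok 1 we ag1.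
  have [cd1 cd2] := code_at_cat cd.
  set l := cexpr 0 a ++ _ in cd1 cd2 *.
  have hl : block (r, m) l = (r3, m) by rewrite !foldl_cat b1 b3.
  exists (size l + 1), (r3, upd m (r3 (rtmp 0)) (r3 (rtmp 1))); split.
  + rewrite addnC iterD (@block_run _ _ _ (r, m)) //; last first.
      by rewrite !all_cat ?straight_address !straight_cexpr.
    by rewrite hl /= (step_at (r3, m) cd2) /= addnA addn1.
  + rewrite v3 s3 // v1; apply: agree_seto => //.
    exact: agree_saves ag1 s3.
  + by rewrite subnn muln1.
- have /andP[w1 w2] := wf; have [cd1 cd2] := code_at_cat cd.
  rewrite size_compile in cd2.
  have [t1 [d1 [r1 ag1 le1]]] := h1 _ _ w1 cd1 ag.
  have [t2 [d2 [r2 ag2 le2]]] := h2 _ _ w2 cd2 ag1.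
  exists (t1 + t2), d2; split=> //.
    by rewrite addnC iterD r1 r2 addnA.
  have k1 := ev_ck e1; have k2 := ev_ck e2.
  rewrite mulnDl leq_add //.
    by rewrite (leq_trans le1) // leq_mul2l; lia.
  by rewrite (leq_trans le2) // leq_mul2l; lia.
- have /and3P[wb w1 w2] := wf; have [cd1 cd2] := code_at_cat cd.
  have [cd3 cd4] := code_at_cons cd2.
  have [cd5 cd6] := code_at_cat cd4.
  have [cd7 cd8] := code_at_cons cd6.
  rewrite size_compile in cd7 cd8.
  have [r1 [b1 ag1 jmp]] := ctest_ok wb ag.
  have run1 : iter (size (ctest b)).+1 (mstep P) (State p r m) =
      State (if teval s b then p + size (ctest b) + csize c2 + 2
             else (p + size (ctest b)).+1) r1 m.
    rewrite iterS (@block_run _ _ _ (r, m)) ?straight_ctest // b1.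
    by rewrite (step_at (r1, m) cd3) jmp.
  case: (teval s b) e1 h1 run1 => e1 h1 run1.
    have cd8' : code_at P (p + size (ctest b) + csize c2 + 2)
        (compile (p + size (ctest b) + csize c2 + 2) c1).
      by move: cd8; congr (code_at _ _ _); lia.
    have [t1 [d1 [run2 ag2 le2]]] := h1 _ _ w1 cd8' ag1.
    exists (t1 + (size (ctest b)).+1), d1; split=> //.
      by rewrite iterD run1 run2; congr State; lia.
    by nia.
  have [t1 [d1 [run2 ag2 le2]]] := h1 _ _ w2 cd5 ag1.
  exists ((t1 + (size (ctest b)).+1).+1), d1; split=> //.
    rewrite iterS iterD run1 run2.
    rewrite (@step_at _ _ (Jump (p + size (ctest b) + csize c2 + 2 + csize c1))).
      by rewrite /=; congr State; lia.
    by [].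
  by nia.
- have /andP[wb w1] := wf; have [cd1 cd2] := code_at_cat cd.
  have [cd3 cd4] := code_at_cons cd2.
  have [cd5 cd6] := code_at_cons cd4.
  have [r1 [b1 ag1 jmp]] := ctest_ok wb ag.
  exists (size (ctest b)).+2, (r1, m); split=> //.
    rewrite 2!iterS (@block_run _ _ _ (r, m)) ?straight_ctest // b1.
    rewrite (step_at (r1, m) cd3) jmp (negbTE hb).
    rewrite (step_at (r1, m) cd5) /=.
    by congr State; lia.
  by nia.
- have /andP[wb w1] := wf; have [cd1 cd2] := code_at_cat cd.
  have [cd3 cd4] := code_at_cons cd2.
  have [cd5 cd6] := code_at_cons cd4.
  have [cd7 cd8] := code_at_cat cd6.
  rewrite size_compile in cd8.
  have [r1 [b1 ag1 jmp]] := ctest_ok wb ag.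
  have run1 : iter (size (ctest b)).+1 (mstep P) (State p r m) =
      State (p + size (ctest b) + 2) r1 m.
    rewrite iterS (@block_run _ _ _ (r, m)) ?straight_ctest // b1.
    by rewrite (step_at (r1, m) cd3) jmp hb.
  have cd7' : code_at P (p + size (ctest b) + 2)
      (compile (p + size (ctest b) + 2) c).
    by move: cd7; congr (code_at _ _ _); lia.
  have [t1 [d1 [run2 ag2 le2]]] := h1 _ _ w1 cd7' ag1.
  have [t2 [d2 [run3 ag3 le3]]] := h2 _ _ wf cd ag2.
  exists (t2 + (t1 + (size (ctest b)).+1).+1), d2; split=> //.
    rewrite iterD iterS iterD run1 run2.
    rewrite (@step_at _ _ (Jump p)) /= ?run3 //.
    by move: cd8; congr (code_at _ _ _); lia.
  have := ev_ck e1; have := ev_ck e2 => /= k1 k2.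
  set X := size (ctest b) in le2 le3 *; set Y := csize c in le2 le3 *.
  have -> : (ck s2 - ck s).+1 = (ck s2 - ck s1).+1 + (ck s1 - (ck s).+1).+1 by lia.
  rewrite mulnDr.
  have : (X + (Y + 3)) * (ck s1 - (ck s).+1).+1 =
    Y * (ck s1 - (ck s).+1).+1 + (X + 3) * (ck s1 - (ck s).+1).+1 by lia.
  have : (X + 3) <= (X + 3) * (ck s1 - (ck s).+1).+1 by nia.
  lia.
Qed.

End Language.

(** * Program logic *)

Coercion Var : nat >-> expr.
Declare Scope code_scope.
Delimit Scope code_scope with code.
Bind Scope code_scope with expr test com.
Arguments Asg _%_nat_scope _%_code_scope.
Arguments Put _%_nat_scope _%_code_scope _%_code_scope.
Notation "x ::= e" := (Asg x e) (at level 75) : code_scope.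
Notation "c1 ;; c2" := (Seq c1 c2)
  (at level 80, right associativity) : code_scope.
Notation "a + b" := (Plus a b) : code_scope.
Notation "a - b" := (Minus a b) : code_scope.
Notation "a < b" := (Lt a b) : code_scope.
Notation "A .[ a ]" := (Get A a) : code_scope.

Section Logic.
Variables (n : nat) (cmp : nat -> nat -> bool).

(** The language is deterministic, so that one terminating run that ends in Q
    is total correctness. *)
Definition wp (c : com) (Q : store -> Prop) (s : store) : Prop :=
  exists2 s', ev n cmp c s s' & Q s'.

Lemma wp_skip (Q : store -> Prop) s : Q s -> wp Skip Q s.
Proof. by move=> q; exists s => //; constructor. Qed.

Lemma wp_asg (Q : store -> Prop) x e s : Q (setv s x (eval n s e)) -> wp (Asg x e) Q s.
Proof. by move=> q; eexists; first constructor. Qed.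

Lemma wp_put (Q : store -> Prop) A a e s :
  Q (seta s A (eval n s a) (eval n s e)) -> wp (Put A a e) Q s.
Proof. by move=> q; eexists; first constructor. Qed.

Lemma wp_out (Q : store -> Prop) a e s : eval n s a < n ->
  Q (seto s (eval n s a) (eval n s e)) -> wp (Out a e) Q s.
Proof. by move=> h q; eexists; first by constructor. Qed.

Lemma wp_seq Q c1 c2 s : wp c1 (wp c2 Q) s -> wp (Seq c1 c2) Q s.
Proof. by case=> s1 e1 [s2 e2 q]; exists s2 => //; apply: EvSeq e1 e2. Qed.

Lemma wp_if Q b c1 c2 s :
  (teval n cmp s b -> wp c1 Q s) -> (~~ teval n cmp s b -> wp c2 Q s) ->
  wp (If b c1 c2) Q s.
Proof.
move=> h1 h2.
have [s' e q] : wp (if teval n cmp s b then c1 else c2) Q s.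
  by case: ifP => [/h1|/negbT/h2].
by exists s' => //; constructor.
Qed.

Lemma wp_imp (Q Q' : store -> Prop) c s :
  wp c Q s -> (forall s', Q s' -> Q' s') -> wp c Q' s.
Proof. by case=> s' e q h; exists s' => //; apply: h. Qed.

(** The invariant carries its own variant k: bounds of the clock in terms of k
    are part of the invariant, and give the number of iterations. *)
Lemma wp_loop (I : nat -> store -> Prop) (Q : store -> Prop) b c k s :
  I k s ->
  (forall k s, I k s -> teval n cmp s b ->
     wp c (fun s' => exists2 k', k' < k & I k' s') (tick s)) ->
  (forall k s, I k s -> ~~ teval n cmp s b -> Q s) ->
  wp (While b c) Q s.
Proof.
move=> + hstep hstop; elim/ltn_ind: k s => k IH s hI.
case hb: (teval n cmp s b); last first.
  by exists s; [apply: EvStop; rewrite hb | apply: hstop hI _; rewrite hb].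
have [s1 e1 [k1 lt1 hI1]] := hstep k s hI hb.
have [s2 e2 q] := IH k1 lt1 s1 hI1.
by exists s2 => //; apply: EvLoop hb e1 e2.
Qed.

Lemma wp_while (I : store -> Prop) (V : store -> nat) (Q : store -> Prop) b c s :
  I s ->
  (forall s, I s -> teval n cmp s b ->
     wp c (fun s' => I s' /\ V s' < V s) (tick s)) ->
  (forall s, I s -> ~~ teval n cmp s b -> Q s) ->
  wp (While b c) Q s.
Proof.
move=> hI hstep hstop; apply: (@wp_loop (fun k s => I s /\ V s = k)) => [//|k s1|k s1].
  move=> [h1 <-] /(hstep _ h1)/wp_imp; apply=> s2 [h2 lt].
  by exists (V s2).
by case=> h1 _; apply: hstop.
Qed.

Fixpoint vwrites c :=
  match c with
  | Asg x _ => [:: x]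
  | Seq c1 c2 | If _ c1 c2 => vwrites c1 ++ vwrites c2
  | While _ c => vwrites c
  | _ => [::]
  end.

Fixpoint awrites c :=
  match c with
  | Put A _ _ => [:: A]
  | Seq c1 c2 | If _ c1 c2 => awrites c1 ++ awrites c2
  | While _ c => awrites c
  | _ => [::]
  end.

(** The lists are computed from the text of the program, so that it can be
    proved by evaluation that a step leaves some variable alone. *)
Definition frame c s s' : Prop :=
  (forall x, x \notin vwrites c -> vr s' x = vr s x) /\
  (forall A, A \notin awrites c -> ar s' A = ar s A).

Lemma ev_frame c s s' : ev n cmp c s s' -> frame c s s'.
Proof.
elim=> {c s s'} //=
  [y e s|A a e s|c1 c2 s s1 s2 _ [h1 k1] _ [h2 k2]|b c1 c2 s s1 _ [h1 k1]
  |b c s s1 s2 _ _ [h1 k1] _ [h2 k2]]; split=> //= x.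
- by rewrite inE /upd => /negbTE->.
- by rewrite inE /upd => /negbTE->.
- by rewrite mem_cat negb_or => /andP[i1 i2]; rewrite h2 ?h1.
- by rewrite mem_cat negb_or => /andP[i1 i2]; rewrite k2 ?k1.
- by rewrite mem_cat negb_or => /andP[i1 i2]; apply: h1; case: ifP.
- by rewrite mem_cat negb_or => /andP[i1 i2]; apply: k1; case: ifP.
- by move=> hx; rewrite h2 // h1.
- by move=> hx; rewrite k2 // k1.
Qed.

Lemma wp_frame (Q Q' : store -> Prop) c s :
  wp c Q s -> (forall s', frame c s s' -> Q s' -> Q' s') -> wp c Q' s.
Proof.
by case=> s' e q h; exists s' => //; apply: h => //; apply: ev_frame e.
Qed.

End Logic.

(** The variables of the programs: vN is the number of intervals including the
    added one, vM the number of leaves of the tree, vQ the key that an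
    operation acts on, and vP the answer of a query. *)
Notation vN := 0 (only parsing).
Notation vM := 1 (only parsing).
Notation vQ := 2 (only parsing).
Notation vV := 3 (only parsing).
Notation vK := 4 (only parsing).
Notation vA := 5 (only parsing).
Notation vB := 6 (only parsing).
Notation vP := 7 (only parsing).

Notation Tree := 0 (only parsing).
Notation Half := 1 (only parsing).
Notation Pos := 2 (only parsing).

(** A tournament tree: the nodes are numbered from the root 1, the children of
    k are 2k and 2k + 1, and the leaf u is vM + u. After the leaf vQ has
    received the value vV, the matches on its way to the root are replayed. As
    the machine cannot divide, halves are read in a table. *)
Definition walk (prefer : test) : com := (
  Put Tree (vM + vQ) vV;;
  vK ::= Half.[vM + vQ];;
  While (Cst 0 < vK) (
    vA ::= Tree.[vK + vK];;
    vB ::= Tree.[vK + vK + Cst 1];;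
    If (Cst 0 < vB)
      (If (Cst 0 < vA)
         (If prefer (Put Tree vK vB) (Put Tree vK vA))
         (Put Tree vK vB))
      (Put Tree vK vA);;
    vK ::= Half.[vK]))%code.

(** Climbs from a leaf to the first right child whose left sibling holds a
    key: if the tree keeps the largest key at each node, this is the
    predecessor of the leaf. *)
Definition find_pred : com := (
  vK ::= vM + vQ;;
  vP ::= Cst 0;;
  While (Cst 0 < vK) (
    If (Half.[vK] + Half.[vK] < vK)
      (If (Cst 0 < Tree.[vK - Cst 1])
         (vP ::= Tree.[vK - Cst 1] - Cst 1;; vK ::= Cst 0)
         (vK ::= Half.[vK]))
      (vK ::= Half.[vK])))%code.

Section Tree.
Variable h : nat.
Local Notation M := (2 ^ h).

(** The ancestor of the leaf u at height e. *)
Definition anc e u := (M + u) %/ 2 ^ e.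

Lemma anc0 u : anc 0 u = M + u.
Proof. by rewrite /anc expn0 divn1. Qed.

Lemma ancS e u : anc e.+1 u = (anc e u)./2.
Proof. by rewrite /anc expnSr divnMA divn2. Qed.

Lemma anc_mono e u v : u <= v -> anc e u <= anc e v.
Proof. by move=> le; rewrite leq_div2r // leq_add2l. Qed.

Lemma anc_level e u : e <= h -> u < M -> 2 ^ (h - e) <= anc e u < 2 ^ (h - e).+1.
Proof.
move=> le lt; have eM : M = 2 ^ (h - e) * 2 ^ e by rewrite -expnD subnK.
rewrite leq_divRL ?expn_gt0 // ltn_divLR ?expn_gt0 // expnS -mulnA -eM; lia.
Qed.

Lemma anc_top u : u < M -> anc h u = 1.
Proof. by move=> /(anc_level (leqnn h)); rewrite subnn expn1 expn0; lia. Qed.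

Lemma anc_neq e f u v : e <= h -> f <= h -> u < M -> v < M -> e != f ->
  anc e u != anc f v.
Proof.
move=> le lf lu lv ne; have := anc_level le lu; have := anc_level lf lv.
have [lt|lt|eq] := ltngtP e f; last by rewrite eq eqxx in ne.
  have : 2 ^ (h - f).+1 <= 2 ^ (h - e) by rewrite leq_exp2l //; lia.
  lia.
have : 2 ^ (h - e).+1 <= 2 ^ (h - f) by rewrite leq_exp2l //; lia.
lia.
Qed.

Lemma anc_children e u : e < h -> u < M ->
  (exists2 v, v < M & anc e v = (anc e.+1 u).*2) /\
  (exists2 v, v < M & anc e v = (anc e.+1 u).*2.+1).
Proof.
move=> lt lu; set k := anc e.+1 u.
have eM : M = 2 ^ (h - e.+1) * 2 ^ e.+1 by rewrite -expnD subnK.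
have /andP[k1 k2] := anc_level lt lu; rewrite -/k in k1 k2.
have E : 2 ^ e.+1 = 2 ^ e + 2 ^ e by rewrite expnS; lia.
have p : 0 < 2 ^ e by rewrite expn_gt0.
have l1 : M <= k * 2 ^ e.+1 by rewrite eM leq_mul2r k1 orbT.
have l2 : k * 2 ^ e.+1 + 2 ^ e.+1 <= M + M.
  rewrite -mulSnr (leq_trans (n := 2 ^ (h - e.+1).+1 * 2 ^ e.+1)) //.
    by rewrite leq_mul2r k2 orbT.
  by rewrite expnS -mulnA -eM mul2n addnn.
split; [exists (k * 2 ^ e.+1 - M)|exists (k * 2 ^ e.+1 + 2 ^ e - M)]; try lia.
  by rewrite /anc subnKC // expnS mulnA mulnK // muln2.
rewrite /anc subnKC; last by lia.
by rewrite expnS mulnA -mulSnr mulnK // muln2.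
Qed.

Variable le : nat -> nat -> Prop.
Hypothesis le_refl : forall u, le u u.
Hypothesis le_trans : forall u v w, le u v -> le v w -> le u w.

Implicit Types (tree : nat -> nat) (on : pred nat).

(** A node holds 0 when no key below it is present, and otherwise the
    successor of the preferred key. *)
Definition best tree on e k : Prop :=
  if tree k is v.+1
  then [/\ v < M, on v, anc e v = k
         & forall u, u < M -> on u -> anc e u = k -> le v u]
  else forall u, u < M -> on u -> anc e u <> k.

Definition tree_ok tree on : Prop :=
  tree 0 = 0 /\
  forall e u, e <= h -> u < M -> best tree on e (anc e u).

Definition half_ok (half : nat -> nat) := forall k, k < 2 ^ h.+1 -> half k = k./2.

Lemma tree_root tree on : tree_ok tree on ->
  if tree 1 is v.+1 then [/\ v < M, on v & forall u, u < M -> on u -> le v u]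
  else forall u, u < M -> ~~ on u.
Proof.
case=> _ /(_ h 0 (leqnn h)); rewrite expn_gt0 => /(_ isT).
rewrite anc_top ?expn_gt0 // /best; case: (tree 1) => [|v].
  by move=> hu u lu; apply/negP => ou; apply: (hu u) => //; apply: anc_top.
by case=> lv ov _ hv; split=> // u lu ou; apply: hv => //; apply: anc_top.
Qed.

Lemma best_ext tree tree' on on' e k : tree k = tree' k ->
  (forall u, u < M -> anc e u = k -> on u = on' u) ->
  best tree on e k -> best tree' on' e k.
Proof.
rewrite /best => ->; case: (tree' k) => [|v] h1.
  by move=> h2 u lu ou eu; apply: (h2 u) => //; rewrite h1.
by case=> lv ov ev h2; split=> //; [rewrite -h1 | move=> u lu ou eu; apply: h2; rewrite
  ?h1].
Qed.

Lemma tree_ok_ext tree on on' : (forall u, u < M -> on u = on' u) ->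
  tree_ok tree on -> tree_ok tree on'.
Proof.
move=> E [t0 ok]; split=> // e u he hu.
by apply: best_ext (ok e u he hu) => // v lv _; apply: E.
Qed.

Definition combine (t : nat -> nat -> bool) a b :=
  if 0 < b then if 0 < a then if t a b then b else a else b else a.

(** The comparison t is only required to be right about the keys that are
    present, because others have no meaning for the programs. *)
Lemma best_combine (t : nat -> nat -> bool) tree on e k :
  (forall u v, u < v < M -> on u -> on v ->
     if t u.+1 v.+1 then le v u else le u v) ->
  best tree on e k.*2 -> best tree on e k.*2.+1 ->
  tree k = combine t (tree k.*2) (tree k.*2.+1) ->
  best tree on e.+1 k.
Proof.
move=> ht; rewrite {3}/best /best /combine => ha hb ->.
have split_k u : anc e.+1 u = k -> anc e u = k.*2 \/ anc e u = k.*2.+1.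
  by rewrite ancS; lia.
case: (tree k.*2.+1) hb => [|b] hb; case: (tree k.*2) ha => [|a] ha /=.
- by move=> u lu ou /split_k[]; [apply: ha|apply: hb].
- have [la oa ea pa] := ha; split=> //; first by rewrite ancS ea; lia.
  move=> u lu ou /split_k[eu|eu]; first exact: pa.
  by have := hb u lu ou eu.
- have [lb ob eb pb] := hb; split=> //; first by rewrite ancS eb; lia.
  move=> u lu ou /split_k[eu|eu]; last exact: pb.
  by have := ha u lu ou eu.
have [la oa ea pa] := ha; have [lb ob eb pb] := hb.
have lt : a < b.
  by rewrite ltnNge; apply/negP => /(anc_mono e); rewrite ea eb; lia.
have := ht a b; rewrite lt lb => /(_ isT oa ob).
case: (t a.+1 b.+1) => lab; split=> //; try (by rewrite ancS ?ea ?eb; lia).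
  move=> u lu ou /split_k[eu|eu]; last exact: pb.
  exact: le_trans lab (pa _ lu ou eu).
move=> u lu ou /split_k[eu|eu]; first exact: pa.
exact: le_trans lab (pb _ lu ou eu).
Qed.

Section Walk.
Variables (n : nat) (cmp : nat -> nat -> bool) (prefer : test).
Variables (t : nat -> nat -> bool) (s0 : store).
Hypothesis preferE : forall s, ar s Pos = ar s0 Pos ->
  teval n cmp s prefer = t (vr s vA) (vr s vB).

(** The invariant of the climb says that a node is correct if its height is
    less than the current one or if it is not an ancestor of the leaf vQ: only
    ancestors depend on that leaf. *)
Lemma walk_ok on b :
  let q := vr s0 vQ in let on' := upd on q b in
  q < M -> vr s0 vM = M -> vr s0 vV = (if b then q.+1 else 0) ->
  half_ok (ar s0 Half) -> tree_ok (ar s0 Tree) on ->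
  (forall u v, u < v < M -> on' u -> on' v ->
     if t u.+1 v.+1 then le v u else le u v) ->
  wp n cmp (walk prefer) (fun s => [/\ tree_ok (ar s Tree) on', ck s <= ck s0 + h
     & frame (walk prefer) s0 s]) s0.
Proof.
move=> q on' lq eM eV hh [t0 tok] ht.
suff: wp n cmp (walk prefer) (fun s => tree_ok (ar s Tree) on' /\ ck s <= ck s0 + h) s0.
  by move/wp_frame; apply=> s fr []; split.
apply/wp_seq/wp_put/wp_seq/wp_asg => /=.
set s1 := setv _ _ _.
pose I s := exists2 e, [/\ 0 < e <= h.+1, vr s vK = anc e q, vr s vM = M & ck s + (h.+1
  - e) <= ck s0 + h]
  & [/\ ar s Half = ar s0 Half, ar s Pos = ar s0 Pos, ar s Tree 0 = 0 &
     forall e' u, e' <= h -> u < M -> (e' < e) || (anc e' u != anc e' q) ->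
       best (ar s Tree) on' e' (anc e' u)].
have ancSh : anc h.+1 q = 0 by rewrite ancS anc_top.
apply: (@wp_while _ _ I (fun s => vr s vK)).
- exists 1; first split=> //=.
  + rewrite /upd /= eM -/q hh; last by rewrite expnS; lia.
    by rewrite ancS anc0.
  + by rewrite subn1 /=; lia.
  split=> //=.
    have M0 : 0 < M by rewrite expn_gt0.
    by rewrite /upd /= eM; case: eqP => // E; lia.
  move=> e' u he lu /orP[/[!ltnS]|ne].
    rewrite leqn0 => /eqP->; rewrite /best /= /upd /= eM -/q eV !anc0.
    case: (u =P q) => [->|neq].
      rewrite eqxx; case: ifP => hb.
        split; rewrite ?anc0 ?/on' /upd ?eqxx ?hb //.
        by move=> v lv ov; rewrite anc0 => ev; have -> : v = q by lia.
      by move=> v lv; rewrite anc0 /on' /upd; case: eqP => [_|ne _]; rewrite ?hb //; lia.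
    have -> : (M + u == M + q) = false by lia.
    have := tok 0 u (leq0n _) lu; rewrite /best anc0.
    case: (ar s0 Tree _) => [|v] hv.
      by move=> v lv ov ev; apply: (hv v) => //; move: ov ev; rewrite /on' /upd anc0;
        case: eqP => //; lia.
    case: hv => lv ov ev hv; split=> //.
      by rewrite /on' /upd ifF //; rewrite anc0 in ev; lia.
    by move=> w lw ow ew; apply: hv => //; move: ow ew; rewrite /on' /upd anc0; case:
      eqP => //; lia.
  apply: best_ext (tok e' u he lu).
    rewrite /= /upd /= eM -/q; case: eqP => // E; case: (posnP e') => [e0|e0].
      by move: ne; rewrite E e0 anc0 eqxx.
    by have := anc_neq he (leq0n h) lu lq (lt0n_neq0 e0); rewrite anc0 E eqxx.
  move=> v lv ev; rewrite /on' /upd; case: eqP => // vq.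
  by rewrite -ev vq eqxx in ne.
- move=> s [e [/andP[e0 eh] eK eMs eck] [eH eP et0 ok]] /= Kpos.
  have {}eh : e <= h.
    by move: eh; rewrite leq_eqVlt ltnS => /orP[/eqP eh|//]; rewrite eK eh ancSh in Kpos.
  case: e e0 eh eK eck ok => // e _ eh eK eck ok.
  set k := vr s vK in eK Kpos.
  have [[u lu eu] [v lv evv]] := anc_children eh lq.
  rewrite -eK in eu evv.
  have b1 : best (ar s Tree) on' e k.*2 by rewrite -eu; apply: ok => //; [apply:
    ltnW|rewrite ltnS leqnn].
  have b2 : best (ar s Tree) on' e k.*2.+1 by rewrite -evv; apply: ok => //; [apply:
    ltnW|rewrite ltnS leqnn].
  have level := anc_level eh lq; rewrite -eK in level.
  have kk : k < k.*2 by lia.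
  apply/wp_seq/wp_asg/wp_seq/wp_asg => /=.
  set s2 := setv _ _ _.
  have hA : vr s2 vA = ar s Tree k.*2 by rewrite /= /upd /= -/k addnn.
  have hB : vr s2 vB = ar s Tree k.*2.+1 by rewrite /= /upd /= -/k addnn addn1.
  apply/wp_seq.
  apply: (@wp_imp _ _ (fun s' => s' = seta s2 Tree k (combine t (vr s2 vA) (vr s2 vB)))).
    rewrite /combine; apply: wp_if => /= c1.
      apply: wp_if => /= c2.
        apply: wp_if => /=; rewrite preferE //= => c3; apply: wp_put => /=.
          by move: c1 c2 c3; rewrite /upd /= => -> -> ->.
        by move: c1 c2 c3; rewrite /upd /= => -> -> /negbTE->.
      by apply: wp_put => /=; move: c1 c2; rewrite /upd /= => -> /negbTE->.
    by apply: wp_put => /=; move: c1; rewrite /upd /= => /negbTE->.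
  move=> _ ->; rewrite hA hB; apply: wp_asg.
  have ek : ar s Half k = anc e.+2 q.
    rewrite eH hh; first by rewrite (ancS e.+1) -eK.
    have : 2 ^ (h - e.+1).+1 <= 2 ^ h.+1 by rewrite leq_exp2l //; lia.
    by case/andP: level => _; apply: leq_trans.
  split; last first.
    by rewrite /= /upd /= -/k ek ancS -eK; lia.
  exists e.+2; first by split=> //=; lia.
  split=> //=.
    by rewrite /upd /=; case: eqP => // k0; rewrite -k0 in Kpos.
  move=> e' w he lw; rewrite orbC; case: (anc e' w =P anc e' q) => [E|ne] /=.
    rewrite ltnS leq_eqVlt orbC ltnS => /orP[lt|/eqP].
      have bw := ok e' w he lw; rewrite ltnS lt in bw.
      apply: best_ext (bw isT) => //=; rewrite /upd /=; case: eqP => // kk'.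
      have := @anc_neq e' e.+1 w q he eh lw lq; rewrite -eK -kk'; lia.
    move=> ee; subst e'; rewrite E -eK; apply: (best_combine ht).
    - apply: best_ext b1 => //=; rewrite /upd /=; case: eqP => //; lia.
    - apply: best_ext b2 => //=; rewrite /upd /=; case: eqP => //; lia.
    - by rewrite /= /upd /= eqxx !ifF //; lia.
  move=> _; have bw := ok e' w he lw; rewrite orbC (introF eqP ne) in bw.
  apply: best_ext (bw isT) => //=; rewrite /upd /=; case: eqP => // kk'.
  case: (e' =P e.+1) => [ee|/eqP ee].
    by case: ne; rewrite kk' ee.
  by have := @anc_neq e' e.+1 w q he eh lw lq ee; rewrite -eK -kk'; lia.
move=> s [e [/andP[e0 eh] eK eMs eck] [eH eP et0 ok]] /= K0.
have {}eh : e = h.+1.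
  apply/eqP; rewrite eqn_leq eh /= ltnNge; apply/negP => le1.
  have p0 : 0 < 2 ^ (h - e) by rewrite expn_gt0.
  by have := anc_level le1 lq; rewrite -eK; lia.
split; last by lia.
by split=> // e' u he lu; apply: ok => //; rewrite eh ltnS he.
Qed.

End Walk.
End Tree.

(** * Predecessor queries *)

Section Keys.
Variables (n : nat) (cmp : nat -> nat -> bool) (h : nat).
Local Notation M := (2 ^ h).

(** The tree as a set of keys: larger keys win their matches. *)
Definition keys_ok s (on : pred nat) : Prop :=
  [/\ vr s vM = M, half_ok h (ar s Half)
    & tree_ok h (fun u v => v <= u) (ar s Tree) on].

Definition is_pred (on : pred nat) q p :=
  [/\ p < q, on p & forall u, u < q -> on u -> u <= p].

(** As long as the climb has found nothing, the keys below the argument are to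
    the left of the current node; a left sibling that is not empty then holds
    the largest of them. The key 0 is always present, so that the root is
    never reached. *)
Lemma find_pred_ok on s0 : keys_ok s0 on -> on 0 -> 0 < vr s0 vQ < M ->
  wp n cmp find_pred (fun s => [/\ is_pred on (vr s0 vQ) (vr s vP),
    ck s <= ck s0 + h.+1 & frame find_pred s0 s]) s0.
Proof.
set q := vr s0 vQ.
move=> [eM hh [t0 tok]] on0 /andP[q0 lq].
suff: wp n cmp find_pred (fun s =>
    is_pred on q (vr s vP) /\ ck s <= ck s0 + h.+1) s0.
  by move/wp_frame; apply=> s fr []; split.
apply/wp_seq/wp_asg/wp_seq/wp_asg => /=.
set s1 := setv _ _ _.
pose I s := [/\ ar s Tree = ar s0 Tree, ar s Half = ar s0 Half &
  (vr s vK = 0 /\ is_pred on q (vr s vP) /\ ck s <= ck s0 + h.+1) \/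
  exists e, [/\ e <= h, vr s vK = anc h e q, ck s <= ck s0 + e &
    forall u, u < q -> on u -> anc h e u < anc h e q]].
apply: (@wp_while _ _ I (fun s => vr s vK)).
- split=> //; right; exists 0; split=> //=.
  + by rewrite /upd /= eM anc0.
  + by rewrite addn0.
  + by move=> u lu _; rewrite !anc0; lia.
- move=> s [eT eH [[/= -> _]|]] // [e [le eK eck below]] /= Kpos.
  set k := vr s vK in eK Kpos.
  have lk : k < 2 ^ h.+1.
    rewrite eK; have /andP[_ lt] := anc_level le lq.
    by apply: leq_trans lt _; rewrite leq_exp2l //; lia.
  have up : k != 1 -> (forall u, u < q -> on u -> (anc h e u)./2 < k./2) ->
      wp n cmp (Asg vK Half.[vK])%code
        (fun s' => I s' /\ vr s' vK < k) (tick s).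
    move=> k1 bb; apply: wp_asg; split; last first.
      by rewrite /= /upd /= -/k eH hh //; lia.
    split=> //; right; exists e.+1; rewrite /= /upd /= -/k eH hh // ancS -eK.
    split=> //; last 1 first.
    + by move=> u lu ou; rewrite ancS; apply: bb.
    + rewrite ltn_neqAle le andbT; apply/eqP => E; move: eK k1.
      by rewrite E anc_top // => ->.
    + lia.
  apply: wp_if => /=; rewrite -/k eH hh // => odd_k; last first.
    apply: up => [|u lu ou]; first lia.
    by have := below u lu ou; rewrite -eK; lia.
  case: (k =P 1) => [k1|/eqP k1].
    have := below 0 q0 on0; rewrite -eK k1.
    have /andP[+ _] := @anc_level h e 0 le (expn_gt0 _ _).
    have p0 : 0 < 2 ^ (h - e) by rewrite expn_gt0.
    by move=> a1 a2; exfalso; lia.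
  have {}le : e < h.
    rewrite ltn_neqAle le andbT; apply/eqP => E; move: eK k1.
    by rewrite E anc_top // => ->.
  have [[v lv ev] _] := anc_children le lq.
  have {}ev : anc h e v = k.-1 by rewrite ev ancS -eK; lia.
  have bv := tok e v (ltnW le) lv; rewrite /best ev in bv.
  apply: wp_if => /=; rewrite -/k subn1 eT; last first.
    rewrite -eqn0Ngt => /eqP E; rewrite E in bv.
    apply: up => // u lu ou; have := below u lu ou.
    have := bv u (ltn_trans lu lq) ou; rewrite -eK; lia.
  case Ek: (ar s0 Tree k.-1) bv => [|w] // [lw ow ew pw] _.
  apply/wp_seq/wp_asg/wp_asg => /=.
  split; last by rewrite /= /upd /=; lia.
  split=> //; left; rewrite /= /upd /= -/k !subn1 eT Ek; split=> //.
  split; last by lia.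
  split=> //.
  - rewrite ltnNge; apply/negP => /(anc_mono h e); rewrite -eK ew; lia.
  - move=> u lu ou; have [//|lt] := leqP u w.
    have := below u lu ou; have := anc_mono h e (ltnW lt); rewrite -eK ew => a1 a2.
    by rewrite ltnNge in lt; case/negP: lt; apply: pw => //; lia.
- move=> s [eT eH [[K0 [ip eck]]|[e [le eK _ _]]]] /=; first by split.
  have p0 : 0 < 2 ^ (h - e) by rewrite expn_gt0.
  by have := anc_level le lq; rewrite -eK => a1 a2; exfalso; lia.
Qed.

Definition rightmost : test := Lt (Cst 0) (Cst 1).

Definition insert_key : com := (vV ::= vQ + Cst 1;; walk rightmost)%code.
Definition delete_key : com := (vV ::= Cst 0;; walk rightmost)%code.

Lemma walk_keys_ok on b s0 : let q := vr s0 vQ in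
  keys_ok s0 on -> q < M -> vr s0 vV = (if b then q.+1 else 0) ->
  wp n cmp (walk rightmost) (fun s => [/\ keys_ok s (upd on q b),
     ck s <= ck s0 + h & frame (walk rightmost) s0 s]) s0.
Proof.
move=> q [eM hh tok] lq eV.
have := @walk_ok h (fun u v => v <= u) leqnn _ n cmp rightmost (fun _ _ => true) s0 _
  on b lq eM eV hh tok; move/(_ _ _ _)/wp_imp.
apply=> [u v w luv lvw|s|u v|s]; [exact: leq_trans luv|by []| by lia|].
case=> tok' eck fr; split=> //; have [fv fa] := fr.
by split=> //; rewrite ?fv ?fa.
Qed.

Lemma insert_ok on s0 : keys_ok s0 on -> vr s0 vQ < M ->
  wp n cmp insert_key (fun s => [/\ keys_ok s (upd on (vr s0 vQ) true),
     ck s <= ck s0 + h & frame insert_key s0 s]) s0.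
Proof.
move=> kok lq.
suff: wp n cmp insert_key (fun s => keys_ok s (upd on (vr s0 vQ) true) /\
     ck s <= ck s0 + h) s0.
  by move/wp_frame; apply=> s fr []; split.
apply/wp_seq/wp_asg.
apply: wp_imp (@walk_keys_ok on true _ _ _ _) _ => //=.
  by rewrite /upd /= addn1.
by move=> s [].
Qed.

Lemma delete_ok on s0 : keys_ok s0 on -> vr s0 vQ < M ->
  wp n cmp delete_key (fun s => [/\ keys_ok s (upd on (vr s0 vQ) false),
     ck s <= ck s0 + h & frame delete_key s0 s]) s0.
Proof.
move=> kok lq.
suff: wp n cmp delete_key (fun s => keys_ok s (upd on (vr s0 vQ) false) /\
     ck s <= ck s0 + h) s0.
  by move/wp_frame; apply=> s fr []; split.
apply/wp_seq/wp_asg.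
apply: wp_imp (@walk_keys_ok on false _ _ _ _) _ => //=.
by move=> s [].
Qed.

End Keys.

(** * Covers and super-intervals *)

Section Covers.
Variables lf rt : nat -> nat.

Definition cov i x := lf i <= x < rt i.

(** The label of the interval i is i + 1, and 0 is no label. *)
Definition good (col : nat -> nat) t x :=
  exists i j, [/\ i < t, j < t, cov i x, cov j x & col i.+1 != col j.+1].

Lemma goodS col t x : good col t x -> good col t.+1 x.
Proof. by case=> i [j [? ? ? ? ?]]; exists i, j; split=> //; apply: ltnW. Qed.

(** A left end, a right end and a label. A super-interval stands for a union
    of intervals. *)
Definition super : Type := (nat * nat * nat)%type.
Implicit Types (S A B M : super) (s : seq super).
Definition inside S x := S.1.1 <= x < S.1.2.

(** The label of a super-interval is a witness for a colour that is present at
    each of its cells. The second part turns a bound for the number of super-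
    intervals around a cell into one for the number of its covers. *)
Definition faithful col t s :=
  (forall S x, S \in s -> inside S x ->
     exists i, [/\ i < t, cov i x & col i.+1 = col S.2]) /\
  (forall x, good col t x \/
     count (cov^~ x) (iota 0 t) <= count (inside^~ x) s).

Lemma faithful0 col : faithful col 0 [::].
Proof. by split=> // x; right. Qed.

Lemma faithful_perm col t s s' : perm_eq s s' ->
  faithful col t s -> faithful col t s'.
Proof.
move=> p [h1 h2]; split=> [S x|x].
  by rewrite -(perm_mem p); apply: h1.
by have /permP <- := p.
Qed.

Lemma faithfulS col t s : ~~ (lf t < rt t) ->
  faithful col t s -> faithful col t.+1 s.
Proof.
move=> e [h1 h2]; split=> [S x hS hx|x].
  by have [i [? ? ?]] := h1 S x hS hx; exists i; split=> //; apply: ltnW.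
have [/goodS|h] := h2 x; [by left | right].
rewrite -addn1 iotaD count_cat /= addn0 {2}/cov.
suff -> : (lf t <= x < rt t) = false by rewrite addn0.
lia.
Qed.

Lemma faithful_add col t s :
  faithful col t s -> faithful col t.+1 ((lf t, rt t, t.+1) :: s).
Proof.
move=> [h1 h2]; split=> [S x|x].
  rewrite inE => /orP[/eqP-> /= hx|hS hx]; first by exists t.
  by have [i [? ? ?]] := h1 S x hS hx; exists i; split=> //; apply: ltnW.
have [/goodS|h] := h2 x; [by left | right].
by rewrite -addn1 iotaD count_cat /= addn0 add0n addnC leq_add2l.
Qed.

(** A cell of M is a cell of A, and the two labels have different colours
    there: it is good, and M is no longer needed to account for it. *)
Lemma faithful_sub col t A M s :
  faithful col t [:: M, A & s] -> A.1.1 <= M.1.1 -> M.1.2 <= A.1.2 ->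
  col M.2 != col A.2 -> faithful col t (A :: s).
Proof.
move=> [h1 h2] l r ne; split=> [S x hS|x].
  by apply: h1; rewrite inE hS orbT.
have [|h] := h2 x; first by left.
case hM: (inside M x); last by right; move: h; rewrite /= hM.
have [|i [? ? Ei]] := h1 M x _ hM; first by rewrite inE eqxx.
have [||j [? ? Ej]] := h1 A x; first by rewrite !inE eqxx orbT.
  by move: hM; rewrite /inside; lia.
by left; exists i, j; rewrite Ei Ej.
Qed.

(** With two colours, A and B agree since both differ from M. Each cell of M
    is a cell of A or of B, hence good. Outside M, at most one of A and B is
    around a cell, so that nothing is lost when they are merged. *)
Lemma faithful_merge col t A M B s :
  (forall v, col v < 2) ->
  faithful col t [:: A, M, B & s] ->
  A.1.1 <= M.1.1 <= B.1.1 -> B.1.1 <= A.1.2 <= M.1.2 -> M.1.2 <= B.1.2 ->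
  col M.2 != col A.2 -> col B.2 != col M.2 ->
  faithful col t ((A.1.1, B.1.2, A.2) :: s).
Proof.
move=> c2 [h1 h2] l m r nA nB; have eAB : col B.2 = col A.2.
  by have := c2 A.2; have := c2 B.2; have := c2 M.2; lia.
have hS S x : S \in [:: A; M; B] -> inside S x -> exists i, [/\ i < t, cov i x & col
  i.+1 = col S.2].
  by move=> hS; apply: h1; move: hS; rewrite !inE !orbA => ->.
have hAB x : inside (A.1.1, B.1.2, A.2) x -> inside A x \/ inside B x.
  rewrite /inside /=; have [] := ltnP x A.1.2; [left|right]; lia.
split=> [S x|x].
  rewrite inE => /orP[/eqP-> /= /hAB[]|hs hx].
  - by apply: hS; rewrite inE eqxx.
  - by rewrite -eAB; apply: hS; rewrite !inE eqxx !orbT.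
  - by apply: h1; rewrite // !inE hs !orbT.
have [|h] := h2 x; first by left.
case hM: (inside M x); last first.
  right; apply: leq_trans h _; rewrite /= hM add0n addnA leq_add2r.
  by move: hM; rewrite /inside /=; lia.
have [|i [? ? Ei]] := hS M x _ hM; first by rewrite !inE eqxx orbT.
have [j [? ? Ej]] : exists j, [/\ j < t, cov j x & col j.+1 = col A.2].
  have [a|b] : inside A x \/ inside B x by apply: hAB; move: hM; rewrite /inside /=; lia.
    by apply: hS a; rewrite inE eqxx.
  by rewrite -eAB; apply: hS b; rewrite !inE eqxx !orbT.
by left; exists i, j; rewrite Ei Ej.
Qed.

End Covers.

(** * Colours from links *)

(** The least colour that is neither a nor b. *)
Definition mex2 a b : nat :=
  if (a == 0) || (b == 0) then if (a == 1) || (b == 1) then 2 else 1 else 0.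

Lemma mex2_neq a b : mex2 a b != a /\ mex2 a b != b.
Proof. by rewrite /mex2; case: a => [|[|a]]; case: b => [|[|b]]. Qed.

Lemma mex2_lt a b : mex2 a b < 3.
Proof. by rewrite /mex2; case: ifP => // _; case: ifP. Qed.

Lemma mex2_diag a : mex2 a a < 2.
Proof. by rewrite /mex2; case: a => [|[|a]]. Qed.

Definition link : Type := (nat * nat * nat)%type.
Implicit Types (st : seq link).

Definition linked (col : nat -> nat) st :=
  all (fun k : link => (col k.1.1 != col k.1.2) && (col k.1.1 != col k.2)) st.

Definition pushed st := [seq k.1.1 | k : link <- st].

(** The top of the stack comes first. A link refers to labels that have not
    been pushed below it, so that their colours are final when it is popped.
    *)
Fixpoint acyclic st : bool :=
  if st is (v, a, b) :: st' then
    [&& v \notin pushed st', a \notin v :: pushed st', b \notin v :: pushed st'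
      & acyclic st']
  else true.

Fixpoint paint st (col : nat -> nat) :=
  if st is (v, a, b) :: st' then paint st' (upd col v (mex2 (col a) (col b)))
  else col.

Lemma paint_out st col v : v \notin pushed st -> paint st col v = col v.
Proof.
elim: st col => //= [[[w a] b] st IH] col; rewrite inE negb_or => /andP[ne hv].
by rewrite IH // /upd (negbTE ne).
Qed.

Lemma linked_paint st col : acyclic st -> linked (paint st col) st.
Proof.
elim: st col => //= [[[v a] b] st IH] col /and4P[hv ha hb ac] /=.
rewrite IH // andbT; rewrite !inE !negb_or in ha hb.
have [/andP[av ha'] /andP[bv hb']] := (ha, hb).
rewrite !paint_out // /upd eqxx (negbTE av) (negbTE bv).
by have [-> ->] := mex2_neq (col a) (col b).
Qed.

Lemma paint_lt3 st col : (forall v, col v < 3) -> forall v, paint st col v < 3.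
Proof.
elim: st col => //= [[[v a] b] st IH] col hc; apply: IH => w.
by rewrite /upd; case: eqP => // _; apply: mex2_lt.
Qed.

Lemma paint_lt2 st col : all (fun k : link => k.1.2 == k.2) st ->
  (forall v, col v < 2) -> forall v, paint st col v < 2.
Proof.
elim: st col => //= [[[v a] b] st IH] col /andP[/eqP /= <- hd] hc.
apply: IH => // w; rewrite /upd; case: eqP => // _; exact: mex2_diag.
Qed.

(** * Chains of super-intervals *)

Section ActiveKeys.
Implicit Types (on : pred nat) (en lb : nat -> nat).

Definition nkeys m on := count on (iota 0 m).
Arguments nkeys : simpl never.

Lemma count_upd_out on q b (r : seq nat) : q \notin r ->
  count (upd on q b) r = count on r.
Proof.
move=> hq; apply: eq_in_count => x hx; rewrite /upd; case: eqP => // xq.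
by rewrite -xq hx in hq.
Qed.

Lemma nkeys_split m q on : q < m ->
  nkeys m on = on q + (count on (iota 0 q) + count on (iota q.+1 (m - q.+1))).
Proof.
move=> lt; rewrite /nkeys; have E : m = q + (1 + (m - q.+1)) by lia.
by rewrite {1}E iotaD count_cat add0n /= addnCA.
Qed.

Lemma nkeys_upd m on q b : q < m -> nkeys m (upd on q b) + on q = nkeys m on + b.
Proof.
move=> lt; rewrite !(nkeys_split _ lt) !count_upd_out ?mem_iota; last 2 first.
- by lia.
- by lia.
by rewrite {1}/upd eqxx; lia.
Qed.

Lemma nkeys_del m on q : q < m -> on q -> (nkeys m (upd on q false)).+1 = nkeys m on.
Proof. by move=> lt oq; have := nkeys_upd on false lt; rewrite oq; lia. Qed.

Lemma nkeys_ins m on q : q < m -> nkeys m (upd on q true) <= (nkeys m on).+1.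
Proof. by move=> lt; have := nkeys_upd on true lt; lia. Qed.

Definition supers m on en lb : seq super :=
  [seq (a, en a, lb a) | a <- iota 1 m & on a].

Lemma supers_del m on en lb q : on q -> 0 < q <= m ->
  perm_eq (supers m on en lb) ((q, en q, lb q) :: supers m (upd on q false) en lb).
Proof.
move=> oq hq; rewrite /supers -[_ :: _]/(map _ (q :: _)); apply: perm_map.
set r := iota 1 m; have hr : q \in [seq a <- r | on a].
  by rewrite mem_filter oq mem_iota; lia.
apply: perm_trans (perm_to_rem hr) _; rewrite perm_cons.
rewrite rem_filter ?filter_uniq ?iota_uniq // -filter_predI.
rewrite (@eq_filter _ (predI (predC1 q) on) (upd on q false)) // => x /=.
by rewrite /upd; case: eqP.
Qed.

Lemma supers_ext m on on' en en' lb lb' :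
  (forall a, 0 < a <= m -> on a = on' a) ->
  (forall a, 0 < a <= m -> on a -> en a = en' a /\ lb a = lb' a) ->
  supers m on en lb = supers m on' en' lb'.
Proof.
move=> ho he; rewrite /supers.
rewrite -(@eq_in_filter _ on on'); last by move=> a; rewrite mem_iota => ha; apply: ho;
  lia.
apply/eq_in_map => a; rewrite mem_filter mem_iota => /andP[oa ha].
by have [|-> ->] := he a _ oa => //; lia.
Qed.

Lemma supers_ins m on en lb q r v : ~~ on q -> 0 < q <= m ->
  perm_eq (supers m (upd on q true) (upd en q r) (upd lb q v))
    ((q, r, v) :: supers m on en lb).
Proof.
move=> oq hq; have := @supers_del m (upd on q true) (upd en q r) (upd lb q v) q.
rewrite /upd eqxx => /(_ isT hq)/perm_trans; apply; rewrite perm_cons.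
rewrite (@supers_ext _ _ on _ en _ lb) // => a ha; case: eqP => // ->.
by rewrite (negbTE oq).
Qed.

Lemma supers_set m on en lb q r : on q -> 0 < q <= m ->
  perm_eq (supers m on (upd en q r) lb)
    ((q, r, lb q) :: supers m (upd on q false) en lb).
Proof.
move=> oq hq; have := @supers_del m on (upd en q r) lb q oq hq.
rewrite {2}/upd eqxx => /perm_trans; apply; rewrite perm_cons.
rewrite (@supers_ext _ _ (upd on q false) _ en _ lb) // /upd => a ha.
by case: eqP.
Qed.
End ActiveKeys.

Section Chain.
Variables (N : nat) (lf rt : nat -> nat).
Local Notation m := (N + N).
Hypothesis rank_range : forall i, i < N -> 0 < lf i <= m /\ 0 < rt i <= m.
Hypothesis rank_neq : forall i j, i < N -> j < N -> lf i <> rt j.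
Hypothesis lf_inj : forall i j, i < N -> j < N -> lf i = lf j -> i = j.
Hypothesis rt_inj : forall i j, i < N -> j < N -> rt i = rt j -> i = j.

Implicit Types (on : pred nat) (en lb : nat -> nat).

(** The labels of the active super-intervals are distinct and not pushed.
    Hence links to them and from them keep the stack acyclic. *)
Record live t lb st (on : pred nat) : Prop := Live {
  live_range : forall a, on a -> 0 < a -> 0 < lb a <= t;
  live_inj : forall a b, on a -> on b -> 0 < a -> 0 < b -> lb a = lb b -> a = b;
  live_notin : forall a, on a -> 0 < a -> lb a \notin pushed st;
  live_pushed : forall v, v \in pushed st -> v <= t;
  live_acyclic : acyclic st;
  live_diag : all (fun k : link => k.1.2 == k.2) st }.

(** The super-intervals are indexed by their left ends; the key 0 is a
    sentinel. Since the right ends increase with the left ends, no super-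
    interval contains another. By chain_two, at most two of them share a cell.
    *)
Record chain t on en : Prop := Chain {
  chain0 : on 0 /\ en 0 = 0;
  chain_left : forall a, on a -> 0 < a -> exists2 i, i < t & a = lf i;
  chain_right : forall a, on a -> 0 < a -> exists2 i, i < t & en a = rt i;
  chain_lt : forall a, on a -> 0 < a -> a < en a;
  chain_mono : forall a b, on a -> on b -> a < b -> en a < en b;
  chain_two : forall a b c, on a -> on b -> on c -> a < b < c -> en a <= c }.

Lemma live_del t lb st on q a : live t lb st on -> on q -> 0 < q ->
  a \notin lb q :: pushed st -> live t lb ((lb q, a, a) :: st) (upd on q false).
Proof.
move=> H oq q0 ha.
have hu x : upd on q false x -> on x /\ x <> q by rewrite /upd; case: eqP.
split=> /=.
- by move=> x /hu[ox _]; apply: (live_range H).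
- by move=> x y /hu[ox _] /hu[oy _]; apply: (live_inj H).
- move=> x /hu[ox xq] x0; rewrite inE negb_or (live_notin H) // andbT.
  by apply/eqP => /(live_inj H ox oq x0 q0).
- move=> v; rewrite inE => /orP[/eqP->|]; last exact: (live_pushed H).
  by have /andP[] := live_range H oq q0.
- by rewrite (live_notin H) // ha (live_acyclic H).
- by rewrite eqxx (live_diag H).
Qed.

Lemma live_new t lb st on a : live t lb st on ->
  a \notin t.+1 :: pushed st -> live t.+1 lb ((t.+1, a, a) :: st) on.
Proof.
move=> H ha; have tn : t.+1 \notin pushed st.
  by apply/negP => /(live_pushed H); lia.
split=> /=.
- by move=> x ox x0; have := live_range H ox x0; lia.
- exact: (live_inj H).
- move=> x ox x0; rewrite inE negb_or (live_notin H) // andbT.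
  by have := live_range H ox x0; lia.
- move=> v; rewrite inE => /orP[/eqP->//|/(live_pushed H)]; lia.
- by rewrite tn ha (live_acyclic H).
- by rewrite eqxx (live_diag H).
Qed.

Lemma live_insert t lb st on q : live t lb st on ->
  live t.+1 (upd lb q t.+1) st (upd on q true).
Proof.
move=> H; split.
- move=> x; rewrite /upd; case: eqP => [_|_ ox x0]; first by rewrite ltnS leqnn.
  by have := live_range H ox x0; lia.
- move=> x y; rewrite /upd; case: (x =P q) => [->|_]; case: (y =P q) => [->|_] // ox oy
    x0 y0.
  + by have := live_range H oy y0; lia.
  + by have := live_range H ox x0; lia.
  + exact: (live_inj H).
- move=> x; rewrite /upd; case: eqP => [_ _ _|_ ox x0].
    by apply/negP => /(live_pushed H); lia.
  exact: (live_notin H).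
- by move=> v /(live_pushed H); lia.
- exact: (live_acyclic H).
- exact: (live_diag H).
Qed.

Lemma live_fresh t lb st on : live t lb st on -> t.+1 \notin pushed st.
Proof. by move=> H; apply/negP => /(live_pushed H); lia. Qed.

Lemma chain_del t on en q : chain t on en -> 0 < q -> chain t (upd on q false) en.
Proof.
move=> H q0.
have hu x : upd on q false x -> on x by rewrite /upd; case: eqP.
split.
- by have [o0 e0] := chain0 H; rewrite /upd; case: eqP => // qq; rewrite -qq in q0.
- by move=> a /hu; apply: (chain_left H).
- by move=> a /hu; apply: (chain_right H).
- by move=> a /hu; apply: (chain_lt H).
- by move=> a b /hu oa /hu; apply: (chain_mono H).
- by move=> a b c /hu oa /hu ob /hu; apply: (chain_two H).
Qed.

Lemma chainS t on en : chain t on en -> chain t.+1 on en.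
Proof.
case=> h0 h1 h2 h3 h4 h5; split=> // a oa a0.
- by have [i ? ?] := h1 a oa a0; exists i => //; apply: ltnW.
- by have [i ? ?] := h2 a oa a0; exists i => //; apply: ltnW.
Qed.

Lemma chain_grow t on en p r : chain t on en -> on p -> 0 < p ->
  (exists2 i, i < t & r = rt i) -> en p <= r ->
  (forall b, on b -> p < b -> r < en b) ->
  (forall b c, on b -> on c -> p < b < c -> r <= c) ->
  chain t on (upd en p r).
Proof.
move=> H op p0 hr lr h1 h2; have [o0 e0] := chain0 H; split.
- by rewrite /upd; case: eqP => // pp; rewrite -pp in p0.
- exact: (chain_left H).
- by move=> a oa a0; rewrite /upd; case: eqP => // _; apply: (chain_right H).
- move=> a oa a0; rewrite /upd; case: eqP => [->|_]; last exact: (chain_lt H).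
  by have := chain_lt H op p0; lia.
- move=> a b oa ob lt; rewrite /upd; case: eqP => [ap|_]; case: eqP => [bp|_].
  + by lia.
  + by apply: h1 => //; rewrite -ap.
  + by apply: leq_trans (_ : en p <= r) => //; rewrite -bp; apply: (chain_mono H).
  + exact: (chain_mono H).
- move=> a b c oa ob oc lt; rewrite /upd; case: eqP => [ap|_].
    by apply: (h2 b c ob oc); rewrite -ap.
  exact: (chain_two H oa ob oc lt).
Qed.

Lemma chain_insert t on en r : chain t on en -> t < N ->
  lf t < r -> (exists2 i, i < t.+1 & r = rt i) ->
  (forall a, on a -> a < lf t -> en a < r) ->
  (forall b, on b -> lf t < b -> r < en b) ->
  (forall b c, on b -> on c -> lf t < b < c -> r <= c) ->
  (forall a c, on a -> on c -> a < lf t < c -> en a <= c) ->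
  (forall a b, on a -> on b -> a < b < lf t -> en a <= lf t) ->
  chain t.+1 (upd on (lf t) true) (upd en (lf t) r).
Proof.
move=> H tN lr hr h1 h2 h3 h4 h5; have [o0 e0] := chain0 H.
have [l0 _] := rank_range tN.
split.
- rewrite /upd; case: eqP => // pp; lia.
- move=> a; rewrite /upd; case: eqP => [-> _ _|_ oa a0]; first by exists t.
  by have [i ? ?] := chain_left H oa a0; exists i => //; apply: ltnW.
- move=> a; rewrite /upd; case: eqP => // _ oa a0.
  by have [i ? ?] := chain_right H oa a0; exists i => //; apply: ltnW.
- by move=> a; rewrite /upd; case: eqP => [-> //|_]; apply: (chain_lt H).
- move=> a b; rewrite /upd; case: (a =P _) => [->|_]; case: (b =P _) => [->|_] oa ob lt.
  + by lia.
  + exact: h2.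
  + exact: h1.
  + exact: (chain_mono H).
- move=> a b c; rewrite /upd; case: (a =P _) => [->|na]; case: (b =P _) => [->|nb];
    case: (c =P _) => [->|nc] oa ob oc lt; try lia.
  + exact: (h3 b c).
  + exact: (h4 a c).
  + exact: (h5 a b).
  + exact: (chain_two H oa ob oc).
Qed.

End Chain.

(** * Inserting an interval, two colours *)

(** The interval being inserted is vT, with the ends vL and vR, and vS is the
    height of the stack. *)
Notation vT := 8 (only parsing).
Notation vC := 9 (only parsing).
Notation vL := 10 (only parsing).
Notation vR := 11 (only parsing).
Notation vS := 12 (only parsing).
Notation vG := 13 (only parsing).
Notation vX := 14 (only parsing).

(** End and Lab are the right end and the label of an active key; StV, StA and
    StB hold the three fields of the links on the stack. *)
Notation Rank := 3 (only parsing).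
Notation End := 4 (only parsing).
Notation Lab := 5 (only parsing).
Notation StV := 6 (only parsing).
Notation StA := 7 (only parsing).
Notation StB := 8 (only parsing).

Definition push (v a b : expr) : com := (
  Put StV vS v;; Put StA vS a;; Put StB vS b;; vS ::= vS + Cst 1)%code.

Definition stack_of s : seq link :=
  rev (mkseq (fun j => (ar s StV j, ar s StA j, ar s StB j)) (vr s vS)).

Fixpoint areads (e : expr) : seq nat :=
  match e with
  | Plus a b | Minus a b => areads a ++ areads b
  | Get A a => A :: areads a
  | _ => [::]
  end.

Lemma eval_ext n s s' e : vr s' = vr s ->
  {in areads e, forall A, ar s' A = ar s A} -> eval n s' e = eval n s e.
Proof.
move=> ev; elim: e => //= [x|a ha b hb|a ha b hb|A a ha] h; first by rewrite ev.
- by rewrite ha ?hb // => A hA; apply: h; rewrite mem_cat hA ?orbT.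
- by rewrite ha ?hb // => A hA; apply: h; rewrite mem_cat hA ?orbT.
- by rewrite h ?inE ?eqxx // ha // => B hB; apply: h; rewrite inE hB orbT.
Qed.

(** The fields of a link are evaluated while the stack is being updated, so
    they must not read it. *)
Definition unstacked (e : expr) := all (fun A => A \notin [:: StV; StA; StB]) (areads e).

Section Push.
Variables (n : nat) (cmp : nat -> nat -> bool).

Lemma push_ok s (v a b : expr) : unstacked v -> unstacked a -> unstacked b ->
  wp n cmp (push v a b) (fun s' => [/\
    stack_of s' = (eval n s v, eval n s a, eval n s b) :: stack_of s,
    ck s' = ck s,
    forall x, x != vS -> vr s' x = vr s x &
    forall A, A \notin [:: StV; StA; StB] -> ar s' A = ar s A]) s.
Proof.
move=> uv ua ub.
do 3 apply/wp_seq/wp_put.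
apply/wp_asg; split=> //=; last 2 first.
- by move=> x; rewrite /upd => /negbTE->.
- by move=> A; rewrite !inE !negb_or /upd => /and3P[/negbTE-> /negbTE-> /negbTE->].
set s1 := seta s _ _ _; set s2 := seta s1 _ _ _; set s3 := seta s2 _ _ _.
have e1 : eval n s1 a = eval n s a.
  by apply: eval_ext => // A /(allP ua); rewrite !inE !negb_or /= /upd =>
    /and3P[/negbTE-> _ _].
have e2 : eval n s2 b = eval n s b.
  apply: eval_ext => // A /(allP ub); rewrite !inE !negb_or /= /upd.
  by move=> /and3P[/negbTE-> /negbTE-> _].
rewrite /stack_of /= /upd /= addn1 mkseqS rev_rcons /= !eqxx -e1 -e2.
congr (_ :: rev _); apply/eq_in_map => j; rewrite mem_iota => hj.
by rewrite !ifF //; lia.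
Qed.
End Push.

(** The super-interval with the key vQ is dropped, and its label is linked to
    a. *)
Definition cut (a : expr) : com := (push Lab.[vQ] a a;; delete_key)%code.

Definition add_super : com := (
  vQ ::= vL;; insert_key;;
  Put End vL vR;; Put Lab vL (vT + Cst 1))%code.

(** Deals with the super-intervals that start inside the new one: those that
    end inside it are dropped, and if two of them overlap it on the right then
    the farther one is merged with the new one. In the end at most one is
    left, with the key vC; vC = vR means that there is none. The predecessor
    of vL is in vP. *)
Definition absorb_right : com := (
  vG ::= Cst 1;;
  While (Cst 0 < vG) (
    vQ ::= vR;; find_pred;;
    If (vL < vP) (
      vC ::= vP;;
      If (End.[vC] < vR) (vQ ::= vC;; cut (vT + Cst 1)) (
        vQ ::= vC;; find_pred;;
        If (vL < vP) (
          If (End.[vP] < vR) (vQ ::= vP;; cut (vT + Cst 1)) (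
            vQ ::= vC;; cut Lab.[vP];;
            vQ ::= vP;; cut (vT + Cst 1);;
            vR ::= End.[vC]))
        (vG ::= Cst 0)))
    (vC ::= vR;; vG ::= Cst 0)))%code.

(** Deals with the super-interval vP to the left. The new one is contained in
    it, or shares a cell with it and the one on the right, or with it and the
    one further to the left; otherwise it becomes a super-interval. *)
Definition join_left : com := (
  If (vL < End.[vP]) (
    If (vR < End.[vP]) (push (vT + Cst 1) Lab.[vP] Lab.[vP]) (
      If (vC < End.[vP]) (
        vQ ::= vC;; cut (vT + Cst 1);;
        push (vT + Cst 1) Lab.[vP] Lab.[vP];;
        Put End vP End.[vC]) (
      vX ::= vP;; vQ ::= vP;; find_pred;;
      If (vL < End.[vP]) (
        push (vT + Cst 1) Lab.[vX] Lab.[vX];;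
        vQ ::= vX;; cut Lab.[vP];;
        Put End vP vR)
      add_super)))
  add_super)%code.

Definition step2 : com := (absorb_right;; join_left)%code.

Section StepTwo.
Variables (n : nat) (cmp : nat -> nat -> bool) (h N : nat) (lf rt : nat -> nat).
Local Notation m := (N + N).
Hypothesis m_lt : m < 2 ^ h.
Hypothesis rank_range : forall i, i < N -> 0 < lf i <= m /\ 0 < rt i <= m.
Hypothesis rank_neq : forall i j, i < N -> j < N -> lf i <> rt j.
Hypothesis lf_inj : forall i j, i < N -> j < N -> lf i = lf j -> i = j.
Hypothesis rt_inj : forall i j, i < N -> j < N -> rt i = rt j -> i = j.

(** What is already known of the colourings that respect the links, namely
    that they are proper for the earlier intervals. It holds for the final
    colouring because the stack only grows. *)
Variable past : (nat -> nat) -> Prop.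

Implicit Types (on : pred nat) (en lb : nat -> nat).
Local Notation wp := (wp n cmp).

(** The labels up to u may have been used; u is t or t + 1 according to
    whether the new interval has become the label of a link. *)
Record ready t u s on : Prop := Ready {
  ready_keys : keys_ok h s on;
  ready_t : vr s vT = t;
  ready_l : vr s vL = lf t;
  ready_live : live u (ar s Lab) (stack_of s) on;
  ready_chain : chain lf rt t on (ar s End) }.

(** The super-intervals ex are not in the search structure. *)
Definition faith t ex s on := forall col,
  (forall v, col v < 2) -> linked col (stack_of s) ->
  past col /\ faithful lf rt col t (ex ++ supers m on (ar s End) (ar s Lab)).

Lemma ready_ext t u s s' on :
  {in [:: vM; vT; vL; vS], forall x, vr s' x = vr s x} ->
  {in [:: Tree; Half; End; Lab; StV; StA; StB], forall A, ar s' A = ar s A} ->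
  ready t u s on -> ready t u s' on.
Proof.
move=> hv ha [[k1 k2 k3] et el li ch].
have e : stack_of s' = stack_of s.
  by rewrite /stack_of (hv vS) // (ha StV) // (ha StA) // (ha StB).
split; rewrite ?e ?(hv vT) ?(hv vL) ?(ha Lab) ?(ha End) //.
by split; rewrite ?(hv vM) ?(ha Half) ?(ha Tree).
Qed.

Lemma ready_setv t u s on x v : x \notin [:: vM; vT; vL; vS] ->
  ready t u s on -> ready t u (setv s x v) on.
Proof.
move=> hx; apply: ready_ext => // y hy; rewrite /= /upd; case: eqP => // e.
by rewrite -e hy in hx.
Qed.

Lemma key_range t on en a : chain lf rt t on en -> t <= N -> on a -> 0 < a ->
  [/\ a < en a, a <= m & en a <= m].
Proof.
move=> H tN oa a0; split; first exact: (chain_lt H).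
  have [i lt ->] := chain_left H oa a0.
  by have [/andP[]] := rank_range (leq_trans lt tN).
have [i lt ->] := chain_right H oa a0.
by have [_ /andP[]] := rank_range (leq_trans lt tN).
Qed.

Lemma pred_ok t u s on : ready t u s on -> 0 < vr s vQ <= m ->
  wp find_pred (fun s' => [/\ ready t u s' on, is_pred on (vr s vQ) (vr s' vP),
    ck s' <= ck s + h.+1, forall x, x \notin [:: vK; vP] -> vr s' x = vr s x &
    forall A, ar s' A = ar s A]) s.
Proof.
move=> H hq; have [o0 _] := chain0 (ready_chain H).
apply: wp_imp (@find_pred_ok n cmp h on s (ready_keys H) o0 _) _.
  by have /andP[-> le] := hq; apply: leq_ltn_trans le m_lt.
move=> s' [ip eck [fv fa]].
have fv' x : x \notin [:: vK; vP] -> vr s' x = vr s x.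
  by move=> hx; apply: fv; move: hx; rewrite /= !inE !negb_or => /andP[-> ->].
split=> //; last by move=> A; apply: fa.
by apply: ready_ext H => [x hx|A _]; [apply: fv'; move: hx; rewrite !inE; lia|apply: fa].
Qed.

Lemma cut_ok t u s on (e : expr) : ready t u s on -> unstacked e ->
  let q := vr s vQ in let a := eval n s e in
  on q -> 0 < q <= m -> a \notin ar s Lab q :: pushed (stack_of s) ->
  wp (cut e) (fun s' => [/\ ready t u s' (upd on q false),
    stack_of s' = (ar s Lab q, a, a) :: stack_of s,
    ck s' <= ck s + h,
    forall x, x \notin [:: vS; vV; vK; vA; vB] -> vr s' x = vr s x &
    forall A, A \notin [:: Tree; StV; StA; StB] -> ar s' A = ar s A]) s.
Proof.
move=> H ue q a oq hq ha; have [kok et el li ch] := H.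
apply/wp_seq; apply: wp_imp (@push_ok n cmp s Lab.[vQ]%code e e isT ue ue) _.
move=> s1 [e1 c1 fv1 fa1]; rewrite /= in e1.
have [k1 k2 k3] := kok.
have eq1 : vr s1 vQ = q by rewrite fv1.
apply: wp_imp (@delete_ok n cmp h on s1 _ _) _.
- by split; rewrite ?fv1 ?fa1.
- by rewrite eq1; have := m_lt; lia.
move=> s2; rewrite eq1 => [] [kok2 c2 [fv2 fa2]].
have fv x : x \notin [:: vS; vV; vK; vA; vB] -> vr s2 x = vr s x.
  rewrite !inE !negb_or => /and5P[x1 x2 x3 x4 x5].
  by rewrite fv2 ?fv1 //= !inE !negb_or x2 x3 x4 x5.
have fa A : A \notin [:: Tree; StV; StA; StB] -> ar s2 A = ar s A.
  rewrite !inE !negb_or => /and4P[x1 x2 x3 x4].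
  by rewrite fa2 ?fa1 //= !inE !negb_or ?x1 ?x2 ?x3 ?x4.
have e2 : stack_of s2 = (ar s Lab q, a, a) :: stack_of s.
  by rewrite -e1 /stack_of !fa2 // fv2.
split=> //; last by rewrite -c1.
split=> //; rewrite ?fv ?e2 ?fa //.
- by apply: live_del => //; lia.
- by apply: chain_del => //; lia.
Qed.

Lemma live_lab_notin t u s on a b : ready t u s on -> on a -> on b ->
  0 < a -> 0 < b -> a <> b -> ar s Lab b \notin ar s Lab a :: pushed (stack_of s).
Proof.
move=> H oa ob a0 b0 ab; have li := ready_live H.
rewrite inE negb_or (live_notin li) // andbT; apply/eqP => E.
by apply: ab; apply: (live_inj li).
Qed.

Lemma live_new_notin t u s on a : ready t u s on -> on a -> 0 < a ->
  u.+1 \notin ar s Lab a :: pushed (stack_of s).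
Proof.
move=> H oa a0; have li := ready_live H.
rewrite inE negb_or (live_fresh li) andbT.
by have := live_range li oa a0; lia.
Qed.

Lemma live_lab_new t u s on a : ready t u s on -> on a -> 0 < a ->
  ar s Lab a \notin u.+1 :: pushed (stack_of s).
Proof.
move=> H oa a0; have li := ready_live H.
rewrite inE negb_or (live_notin li) // andbT.
by have := live_range li oa a0; lia.
Qed.

Lemma perm_swap (T : eqType) (x y : T) r : perm_eq [:: x, y & r] [:: y, x & r].
Proof. by apply/permP => p /=; rewrite addnCA. Qed.

Lemma faith_sub t s s' on q I :
  faith t [:: I] s on -> on q -> 0 < q <= m ->
  I.1.1 <= q -> ar s End q <= I.1.2 ->
  ar s' End = ar s End -> ar s' Lab = ar s Lab ->
  stack_of s' = (ar s Lab q, I.2, I.2) :: stack_of s ->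
  faith t [:: I] s' (upd on q false).
Proof.
move=> F oq hq l r eE eL eS col c2; rewrite eS eE eL => /andP[/andP[/= ne _] lk].
have [pa fth] := F col c2 lk; split=> //.
apply: (@faithful_sub lf rt col t I (q, ar s End q, ar s Lab q)) => //.
apply: faithful_perm fth; rewrite /=.
apply: perm_trans (perm_swap _ _ _); rewrite perm_cons.
exact: supers_del.
Qed.

Variables (t : nat).
Hypothesis tN : t < N.

(** The potential of a key: it pays for the iteration in which the key is
    deleted, with up to two queries and two updates of the tree. *)
Definition weight := 4 * h + 4.

(** What is known when no super-interval inside the new one is left and at
    most one, the one with key c, overlaps it on the right. *)
Definition right_done on r en p c : Prop :=
  [/\ is_pred on (lf t) p, forall k, on k -> lf t < k < r -> k = c
    & c = r \/ [/\ on c, lf t < c < r & r < en c]].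

(** The new super-interval, whose right end may have grown by merging, stands
    outside the search structure. *)
Definition mid s on : Prop :=
  [/\ ready t t s on, faith t.+1 [:: (lf t, vr s vR, t.+1)] s on,
     lf t < vr s vR <= m,
     exists2 i, i < t.+1 & vr s vR = rt i
   & forall a, on a -> 0 < a -> ar s End a <> vr s vR].

Lemma mid_ext s s' on :
  {in [:: vM; vT; vL; vR; vS], forall x, vr s' x = vr s x} ->
  {in [:: Tree; Half; End; Lab; StV; StA; StB], forall A, ar s' A = ar s A} ->
  mid s on -> mid s' on.
Proof.
move=> hv ha [R F lr hr ne].
have R' : ready t t s' on.
  by apply: ready_ext R => // x hx; apply: hv; move: hx; rewrite !inE; lia.
have eS : stack_of s' = stack_of s.
  by rewrite /stack_of (hv vS) // (ha StV) // (ha StA) // (ha StB).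
split; rewrite ?(hv vR) ?(ha End) //.
by move=> col c2; rewrite eS (ha End) ?(ha Lab) //; apply: F.
Qed.

Lemma mid_setv s on x v : x \notin [:: vM; vT; vL; vR; vS] ->
  mid s on -> mid (setv s x v) on.
Proof.
move=> hx; apply: mid_ext => // y hy; rewrite /= /upd; case: eqP => // e.
by rewrite -e hy in hx.
Qed.

Lemma mid_tick s on : mid s on -> mid (tick s) on.
Proof. exact: mid_ext. Qed.

Lemma mid_pred s on : mid s on -> 0 < vr s vQ <= m ->
  wp find_pred (fun s' => [/\ mid s' on, is_pred on (vr s vQ) (vr s' vP),
    ck s' <= ck s + h.+1, forall x, x \notin [:: vK; vP] -> vr s' x = vr s x &
    forall A, ar s' A = ar s A]) s.
Proof.
move=> H hq; have [R _ _ _ _] := H.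
apply: wp_imp (pred_ok R hq) _ => s' [_ ip c fv fa]; split=> //.
by apply: mid_ext H => // x hx; apply: fv; move: hx; rewrite !inE; lia.
Qed.

Lemma mid_key s on a : mid s on -> on a -> 0 < a ->
  [/\ a < ar s End a, a <= m, ar s End a <= m, a <> lf t & a <> vr s vR] /\
  ar s End a <> lf t.
Proof.
move=> [R F lr [j lj ej] ne] oa a0; have ch := ready_chain R.
have [h1 h2 h3] := key_range ch (ltnW tN) oa a0.
have [i li ei] := chain_left ch oa a0; have [k lk ek] := chain_right ch oa a0.
split; [split=> //|].
- by rewrite ei => /lf_inj; lia.
- by rewrite ei ej; apply: rank_neq; lia.
- by rewrite ek => /esym; apply: rank_neq; lia.
Qed.

Lemma mid_cut s on : mid s on -> let q := vr s vQ in
  on q -> lf t < q -> ar s End q < vr s vR ->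
  wp (cut (vT + Cst 1)) (fun s' => [/\ mid s' (upd on q false),
    ck s' <= ck s + h,
    forall x, x \notin [:: vS; vV; vK; vA; vB] -> vr s' x = vr s x &
    forall A, A \notin [:: Tree; StV; StA; StB] -> ar s' A = ar s A]) s.
Proof.
move=> H q oq lq er; have [R F lr hr ne] := H; have li := ready_live R.
have q0 : 0 < q by lia.
have [[_ qm _ _ _] _] := mid_key H oq q0.
have eT : vr s vT + 1 = t.+1 by rewrite (ready_t R) addn1.
apply: wp_imp (@cut_ok t t s on (vT + Cst 1)%code R isT oq _ _) _.
- by rewrite q0.
- by rewrite /= eT; apply: live_new_notin R oq q0.
move=> s'; rewrite /= eT -/q => [] [R' eS c fv fa]; split=> //.
have eE : ar s' End = ar s End by rewrite fa.
split; rewrite ?fv ?eE //.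
- by apply: faith_sub F oq _ _ _ _ _ _; rewrite ?fa ?q0 //=; lia.
- by move=> a; rewrite /upd; case: eqP => // _; apply: ne.
Qed.

(** The new super-interval I, p and k share the cells just before the right
    end of I. Since p is linked to I and k to p, this is the case of
    faithful_merge where I absorbs k. *)
Lemma mid_merge s on k p : mid s on -> on k -> on p -> vr s vC = k -> vr s vP = p ->
  lf t < p < k -> k < vr s vR -> vr s vR < ar s End p ->
  wp (vQ ::= vC;; cut Lab.[vP];; vQ ::= vP;; cut (vT + Cst 1);; vR ::= End.[vC])%code
   (fun s' => [/\ mid s' (upd (upd on k false) p false),
    ck s' <= ck s + (h + h), vr s' vG = vr s vG & ar s' Lab = ar s Lab]) s.
Proof.
move=> H ok op eC eP lpk kR Rp; have [R F lr hr ne] := H.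
have p0 : 0 < p by lia.
have k0 : 0 < k by lia.
have ch := ready_chain R.
have [[_ km _ _ _] _] := mid_key H ok k0.
have [[_ pm _ _ _] _] := mid_key H op p0.
have mono : ar s End p < ar s End k by apply: (chain_mono ch) => //; lia.
apply/wp_seq/wp_asg => /=; set s1 := setv _ _ _.
have R1 : ready t t s1 on by apply: ready_setv R.
have eQ1 : vr s1 vQ = k by rewrite /s1 /= /upd /= eC.
apply/wp_seq; apply: wp_imp (@cut_ok t t s1 on Lab.[vP]%code R1 isT _ _ _) _.
- by rewrite eQ1.
- by rewrite eQ1; lia.
- rewrite eQ1 /= /upd /= eP; apply: (live_lab_notin R) => //; lia.
move=> s2; rewrite eQ1 /=; have -> : upd (vr s) 2 (vr s 9) 7 = p by rewrite /upd /= eP.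
rewrite -[stack_of s1]/(stack_of s) => [] [R2 eS2 c2 fv2 fa2].
apply/wp_seq/wp_asg => /=; set s3 := setv _ _ _.
have R3 : ready t t s3 (upd on k false) by apply: ready_setv R2.
have eQ3 : vr s3 vQ = p by rewrite /s3 /= /upd /= fv2.
have eT : vr s3 vT = t by rewrite (ready_t R3).
have op' : upd on k false p by rewrite /upd; case: eqP => //; lia.
apply/wp_seq; apply: wp_imp (@cut_ok t t s3 _ (vT + Cst 1)%code R3 isT _ _ _) _.
- by rewrite eQ3.
- by rewrite eQ3; lia.
- by rewrite eQ3 /= -[upd _ _ _ _]/(vr s3 vT) eT addn1; apply: (live_new_notin R3).
move=> s4; rewrite eQ3 /= -[upd _ _ _ _]/(vr s3 vT) eT addn1.
rewrite -[stack_of s3]/(stack_of s2) => [] [R4 eS4 c4 fv4 fa4].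
apply: wp_asg; rewrite /=.
have eR : ar s4 End (vr s4 vC) = ar s End k.
  by rewrite fa4 // fv4 // /s3 /= /upd /= fa2 // fv2 //= /upd /= eC.
rewrite eR.
have eE4 : ar s4 End = ar s End by rewrite fa4 //= fa2.
have eL4 : ar s4 Lab = ar s Lab by rewrite fa4 //= fa2.
have on4 a : upd (upd on k false) p false a -> [/\ on a, a <> k & a <> p].
  by rewrite /upd; case: eqP => // ap; case: eqP.
split; last 1 first.
- by rewrite /= eL4.
- split.
  + by apply: ready_setv R4.
  + move=> col cl2; rewrite -[stack_of (setv _ _ _)]/(stack_of s4) eS4 eS2.
    rewrite -[ar (setv _ _ _) End]/(ar s4 End) -[ar (setv _ _ _) Lab]/(ar s4 Lab).
    rewrite -[vr (setv _ _ _) vR]/(ar s End k) eE4 eL4 /= fa2 //=.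
    case/and3P=> /andP[n1 _] /andP[n2 _] lk.
    have [pa fth] := F col cl2 lk; split=> //.
    apply: (@faithful_merge lf rt col t.+1 (lf t, vr s vR, t.+1)
        (p, ar s End p, ar s Lab p) (k, ar s End k, ar s Lab k)) => //=; try lia.
    apply: faithful_perm fth; rewrite /= perm_cons.
    apply: perm_trans (perm_swap _ _ _).
    apply: perm_trans (supers_del _ _ ok _) _; first by rewrite k0.
    rewrite perm_cons.
    by apply: supers_del => //; rewrite p0.
  + rewrite /= /upd /=; have [[_ _ le _ _] _] := mid_key H ok k0; lia.
  + rewrite /= /upd /=; have [i li ->] := chain_right ch ok k0.
    by exists i => //; apply: ltnW.
  + move=> a /on4[oa ak ap] a0; rewrite /= /upd /= eE4.
    have [lt|lt|] := ltngtP a k; last by [].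
      by have := chain_mono ch oa ok lt; lia.
    by have := chain_mono ch ok oa lt; lia.
- by move: c4 c2; rewrite /=; lia.
- by rewrite /= /upd /= fv4 // /= /upd /= fv2 //= /upd.
Qed.

Lemma absorb_right_ok s on : mid s on ->
  wp absorb_right (fun s' => exists on', [/\ mid s' on',
     right_done on' (vr s' vR) (ar s' End) (vr s' vP) (vr s' vC),
     ck s' + weight * nkeys m.+1 on' <= ck s + weight * (nkeys m.+1 on).+1
   & ar s' Lab = ar s Lab]) s.
Proof.
move=> Hm; apply/wp_seq/wp_asg; rewrite /=.
have [/andP[l0 lm] _] := rank_range tN.
pose I k s' := exists on', [/\ mid s' on', ar s' Lab = ar s Lab &
  (vr s' vG = 1 /\ k = (nkeys m.+1 on').+1 /\
   ck s' + weight * nkeys m.+1 on' <= ck s + weight * nkeys m.+1 on) \/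
  [/\ vr s' vG = 0, k = 0, right_done on' (vr s' vR) (ar s' End) (vr s' vP) (vr s' vC)
    & ck s' + weight * nkeys m.+1 on' <= ck s + weight * (nkeys m.+1 on).+1]].
apply: (@wp_loop _ _ I _ _ _ (nkeys m.+1 on).+1); last 1 first.
- move=> k s1 [on1 [M1 eL [[G1 _]|[G0 _ rd le]]]] /= Gz; first by rewrite G1 in Gz.
  by exists on1.
- exists on; split=> //; first by apply: mid_setv Hm.
  by left.
move=> k s1 [on1 [M1 eL [[G1 [ek eck]]|[G0 _ _ _]]]] /= Gpos; last by rewrite G0 in Gpos.
have [_ _ lr _ _] := M1.
apply/wp_seq/wp_asg; rewrite /=; set s2 := setv _ _ _.
have M2 : mid s2 on1 by apply/mid_setv/mid_tick.
apply/wp_seq; apply: wp_imp (mid_pred M2 _) _; first by rewrite /s2 /= /upd /=; lia.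
move=> s3 [M3 +]; rewrite {1}/s2 /= {1}/upd /= => ip c3 fv3 fa3.
have eR3 : vr s3 vR = vr s1 vR by rewrite fv3.
have eL3 : vr s3 vL = lf t by have [R3 _ _ _ _] := M3; rewrite (ready_l R3).
have eG3 : vr s3 vG = 1 by rewrite fv3.
have eE3 : ar s3 End = ar s1 End by rewrite fa3.
have eLb3 : ar s3 Lab = ar s Lab by rewrite fa3.
set p := vr s3 vP in ip; have [ltp op maxp] := ip.
have {}c3 : ck s3 <= (ck s1).+1 + h.+1 by exact: c3.
apply: wp_if => /=; rewrite eL3 -/p => cp; last first.
  have {}cp : p < lf t.
    rewrite ltn_neqAle leqNgt cp andbT; apply/eqP => E.
    have p0 : 0 < p by lia.
    by have [[_ _ _ /(_ E)]] := mid_key M1 op p0.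
  apply/wp_seq/wp_asg/wp_asg; rewrite /=.
  exists 0; first by rewrite ek.
  exists on1; split=> //; first by do 2 apply: mid_setv => //.
  right; split=> //; last by rewrite /= mulnS; rewrite /weight in eck *; lia.
  rewrite /= /upd /= -/p; split; last by left.
    by split=> // u lu ou; apply: maxp => //; lia.
  by move=> j oj /andP[lj jr]; have := maxp j; rewrite oj -eR3 jr => /(_ isT isT); lia.
have [[p_en pm _ pL pR] enL] := mid_key M1 op (leq_trans (ltn0Sn _) cp).
apply/wp_seq/wp_asg; rewrite /=; set s4 := setv _ _ _.
have M4 : mid s4 on1 by apply: mid_setv.
apply: wp_if => /=; rewrite {1 2}/upd /= -/p eR3 eE3 => cR.
  apply/wp_seq/wp_asg; rewrite /=; set s5 := setv _ _ _.
  have M5 : mid s5 on1 by apply: mid_setv.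
  have eQ5 : vr s5 vQ = p by rewrite /s5 /= /upd.
  apply: wp_imp (mid_cut M5 _ _ _) _; rewrite ?eQ5 //.
    by rewrite -[ar s5 End]/(ar s3 End) eE3 -[vr s5 vR]/(vr s3 vR) eR3.
  move=> s6 [M6 c6 fv6 fa6]; rewrite -[ck s5]/(ck s3) in c6.
  have del := @nkeys_del m.+1 on1 p pm op.
  exists (nkeys m.+1 (upd on1 p false)).+1; first by rewrite ek -del.
  exists (upd on1 p false); split=> //; first by rewrite fa6.
  left; split; first by rewrite fv6.
  by split=> //; move: eck; rewrite -del mulnS /weight; lia.
apply/wp_seq/wp_asg; rewrite /=; set s5 := setv _ _ _.
have M5 : mid s5 on1 by apply: mid_setv.
have eQ5 : vr s5 vQ = p by rewrite /s5 /= /upd.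
apply/wp_seq; apply: wp_imp (mid_pred M5 _) _; first by rewrite eQ5; lia.
move=> s6 [M6 + c6 fv6 fa6]; rewrite eQ5 => ip2; rewrite -[ck s5]/(ck s3) in c6.
have eR6 : vr s6 vR = vr s1 vR by rewrite fv6.
have eL6 : vr s6 vL = lf t by have [R6 _ _ _ _] := M6; rewrite (ready_l R6).
have eC6 : vr s6 vC = p by rewrite fv6.
have eE6 : ar s6 End = ar s1 End by rewrite fa6.
set p2 := vr s6 vP in ip2; have [ltp2 op2 maxp2] := ip2.
have Rp : vr s1 vR < ar s1 End p.
  by have [_ _ _ _ /(_ p op (leq_trans (ltn0Sn _) cp))] := M1; lia.
apply: wp_if => /=; rewrite eL6 -/p2 => cp2; last first.
  have {}cp2 : p2 < lf t.
    rewrite ltn_neqAle leqNgt cp2 andbT; apply/eqP => E.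
    have p0 : 0 < p2 by lia.
    by have [[_ _ _ /(_ E)]] := mid_key M1 op2 p0.
  apply: wp_asg; rewrite /=.
  exists 0; first by rewrite ek.
  exists on1; split=> //; [by apply: mid_setv | by rewrite /= fa6 |].
  right; split=> //; last by rewrite /= mulnS; rewrite /weight in eck *; lia.
  rewrite /= /upd /= -/p2 eC6 eR6 eE6; split; last by right; split=> //; lia.
    by split=> // u lu ou; apply: maxp2 => //; lia.
  move=> j oj /andP[lj jr]; have := maxp j jr oj; rewrite leq_eqVlt => /orP[/eqP//|jp].
  by have := maxp2 j jp oj; lia.
have [[p2_en p2m _ _ _] _] := mid_key M1 op2 (leq_trans (ltn0Sn _) cp2).
have del := @nkeys_del m.+1 on1 p pm op.
have del2 := @nkeys_del m.+1 on1 p2 p2m op2.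
apply: wp_if => /=; rewrite -/p2 eE6 eR6 => cR2.
  apply/wp_seq/wp_asg; rewrite /=; set s7 := setv _ _ _.
  have M7 : mid s7 on1 by apply: mid_setv.
  have eQ7 : vr s7 vQ = p2 by rewrite /s7 /= /upd.
  apply: wp_imp (mid_cut M7 _ _ _) _; rewrite ?eQ7 //.
    by rewrite -[ar s7 End]/(ar s6 End) eE6 -[vr s7 vR]/(vr s6 vR) eR6.
  move=> s8 [M8 c8 fv8 fa8]; rewrite -[ck s7]/(ck s6) in c8.
  exists (nkeys m.+1 (upd on1 p2 false)).+1; first by rewrite ek -del2.
  exists (upd on1 p2 false); split=> //; first by rewrite fa8 // fa6.
  left; split; first by rewrite fv8 //= /upd /= fv6.
  by split=> //; move: eck; rewrite -del2 mulnS /weight; lia.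
have Rp2 : vr s1 vR < ar s1 End p2.
  by have [_ _ _ _ /(_ p2 op2 (leq_trans (ltn0Sn _) cp2))] := M1; lia.
apply: wp_imp (@mid_merge s6 on1 p p2 M6 op op2 eC6 _ _ _ _) _ => //.
- by rewrite cp2.
- by rewrite eR6.
- by rewrite eE6 eR6.
move=> s7 [M7 c7 G7 L7].
have op2' : upd on1 p false p2 by rewrite /upd; case: eqP => //; lia.
have del3 := @nkeys_del m.+1 _ p2 p2m op2'.
exists (nkeys m.+1 (upd (upd on1 p false) p2 false)).+1; first by rewrite ek; lia.
exists (upd (upd on1 p false) p2 false); split=> //; first by rewrite L7 fa6.
left; split; first by rewrite G7 fv6.
by split=> //; move: eck; rewrite -del -del3 !mulnS /weight; lia.
Qed.

Definition inv2 u s on : Prop :=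
  [/\ keys_ok h s on, live u (ar s Lab) (stack_of s) on,
      chain lf rt u on (ar s End) & faith u [::] s on].

Lemma mid_notin s on : mid s on -> ~~ on (lf t).
Proof.
move=> H; apply/negP => o; have [/andP[l0 _] _] := rank_range tN.
by have [[_ _ _ ]] := mid_key H o l0.
Qed.

Lemma add_super_ok s on : mid s on ->
  (forall a, on a -> a < lf t -> ar s End a < vr s vR) ->
  (forall b, on b -> lf t < b -> vr s vR < ar s End b) ->
  (forall b c, on b -> on c -> lf t < b < c -> vr s vR <= c) ->
  (forall a c, on a -> on c -> a < lf t < c -> ar s End a <= c) ->
  (forall a b, on a -> on b -> a < b < lf t -> ar s End a <= lf t) ->
  wp add_super (fun s' => exists2 on', inv2 t.+1 s' on' &
    ck s' + weight * nkeys m.+1 on' <= ck s + h + weight * (nkeys m.+1 on).+1) s.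
Proof.
move=> H h1 h2 h3 h4 h5; have [R F lr hr ne] := H.
have nl := mid_notin H; have [l0 _] := rank_range tN.
apply/wp_seq/wp_asg; rewrite /=; set s1 := setv _ _ _.
have R1 : ready t t s1 on by apply: ready_setv.
have eQ : vr s1 vQ = lf t by rewrite /s1 /= /upd /= (ready_l R).
apply/wp_seq; apply: wp_imp (@insert_ok n cmp h on s1 (ready_keys R1) _) _.
  by rewrite eQ; have := m_lt; lia.
move=> s2; rewrite eQ => [] [k2 c2 [fv2 fa2]]; rewrite -[ck s1]/(ck s) in c2.
apply/wp_seq/wp_put/wp_put; rewrite /=.
set s3 := seta _ _ _ _.
have eL2 : vr s2 vL = lf t by rewrite fv2 // -(ready_l R).
have eR2 : vr s2 vR = vr s vR by rewrite fv2.
have eT2 : vr s2 vT = t by rewrite fv2 // -(ready_t R).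
have eS : stack_of s3 = stack_of s.
  by rewrite /stack_of /= /upd /= !fa2 // fv2.
have eE : ar s3 End = upd (ar s End) (lf t) (vr s vR).
  by rewrite /s3 /= /upd /= fa2 // eL2 eR2.
have eLb : ar s3 Lab = upd (ar s Lab) (lf t) t.+1.
  by rewrite /s3 /= /upd /= fa2 // eL2 eT2 addn1.
exists (upd on (lf t) true).
  split; rewrite ?eS ?eE ?eLb.
  - by case: k2.
  - exact: live_insert (ready_live R).
  - by apply: (chain_insert rank_range (ready_chain R)) => //; lia.
  - move=> col cl2; rewrite eS eE eLb => lk.
    have [pa fth] := F col cl2 lk; split=> //.
    apply: faithful_perm fth; rewrite /= perm_sym.
    exact: supers_ins.
have le := @nkeys_ins m.+1 on (lf t) _.
have {}le : nkeys m.+1 (upd on (lf t) true) <= (nkeys m.+1 on).+1 by apply: le; lia.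
by rewrite leq_add // leq_mul2l le orbT.
Qed.

Lemma faith_end u s s' on p r : on p -> 0 < p <= m ->
  (forall col, (forall v, col v < 2) -> linked col (stack_of s) ->
     past col /\ faithful lf rt col u ((p, r, ar s Lab p) ::
       supers m (upd on p false) (ar s End) (ar s Lab))) ->
  ar s' End = upd (ar s End) p r -> ar s' Lab = ar s Lab ->
  stack_of s' = stack_of s -> faith u [::] s' on.
Proof.
move=> op hp F eE eL eS col c2; rewrite eE eL eS => lk.
have [pa fth] := F col c2 lk; split=> //.
apply: faithful_perm fth; rewrite perm_sym.
exact: supers_set.
Qed.

(** The super-interval with the key p contains the new one: this is the case
    of faithful_sub. *)
Lemma swallow_ok s on p : mid s on -> on p -> vr s vP = p -> p < lf t ->
  vr s vR < ar s End p ->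
  wp (push (vT + Cst 1) Lab.[vP] Lab.[vP])%code
    (fun s' => inv2 t.+1 s' on /\ ck s' = ck s) s.
Proof.
move=> H op eP pl Rp; have [R F lr hr ne] := H.
have p0 : 0 < p.
  case: p op eP pl Rp => // o0 _ _; have [_ ->] := chain0 (ready_chain R); lia.
apply: wp_imp (@push_ok n cmp s (vT + Cst 1)%code Lab.[vP]%code Lab.[vP]%code
  isT isT isT) _.
move=> s1 [] /=; rewrite (ready_t R) addn1 eP => eS -> fv fa; split=> //.
have [[_ pm _ _ _] _] := mid_key H op p0.
have [k1 k2 k3] := ready_keys R.
split; rewrite ?eS ?fa //.
- by split; rewrite ?fv ?fa.
- by apply: live_new (ready_live R) _; apply: (live_lab_new R).
- exact/chainS/(ready_chain R).
- move=> col cl2; rewrite eS !fa //= => /andP[/andP[n1 _] lk].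
  have [pa fth] := F col cl2 lk; split=> //.
  have : faithful lf rt col t.+1 ((p, ar s End p, ar s Lab p) ::
      supers m (upd on p false) (ar s End) (ar s Lab)).
    apply: (@faithful_sub lf rt col t.+1 (p, ar s End p, ar s Lab p)
      (lf t, vr s vR, t.+1)) => //=; try lia.
    apply: faithful_perm fth; rewrite /= perm_cons.
    by apply: supers_del; rewrite // p0.
  by apply: faithful_perm; rewrite perm_sym; apply: supers_del; rewrite // p0.
Qed.

(** Here p, the new super-interval and c share a cell: p absorbs c by
    faithful_merge. *)
Lemma bridge_ok s on p c : mid s on ->
  right_done on (vr s vR) (ar s End) p c -> vr s vP = p -> vr s vC = c ->
  lf t < ar s End p < vr s vR -> c < ar s End p ->
  wp (vQ ::= vC;; cut (vT + Cst 1);;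
      push (vT + Cst 1) Lab.[vP] Lab.[vP];; Put End vP End.[vC])%code
    (fun s' => inv2 t.+1 s' (upd on c false) /\ ck s' <= ck s + h) s.
Proof.
move=> H [[pl op maxp] uniq_c [->|[oc lcR Rc]]] eP eC lp cp; first by lia.
have [R F lr hr ne] := H; have ch := ready_chain R.
have c0 : 0 < c by lia.
have p0 : 0 < p.
  by case: p op lp {eP pl maxp cp} => // o0; have [_ ->] := chain0 ch; lia.
have [[_ cm _ cL cR] _] := mid_key H oc c0.
have [[_ pm _ pL pR] _] := mid_key H op p0.
apply/wp_seq/wp_asg; rewrite /=; set s1 := setv _ _ _.
have R1 : ready t t s1 on by apply: ready_setv.
have eQ1 : vr s1 vQ = c by rewrite /s1 /= /upd /= eC.
have eT1 : vr s1 vT + 1 = t.+1 by rewrite (ready_t R1) addn1.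
apply/wp_seq; apply: wp_imp (@cut_ok t t s1 on (vT + Cst 1)%code R1 isT _ _ _) _.
- by rewrite eQ1.
- by rewrite eQ1; lia.
- by rewrite eQ1 /= -[upd _ _ _ _]/(vr s1 vT) eT1; apply: (live_new_notin R1).
move=> s2; rewrite eQ1 /= -[upd _ _ _ _]/(vr s1 vT) eT1.
rewrite -[stack_of s1]/(stack_of s) -[ck s1]/(ck s) => [] [R2 eS2 c2 fv2 fa2].
have op2 : upd on c false p by rewrite /upd; case: eqP => //; lia.
have eP2 : vr s2 vP = p by rewrite fv2.
apply/wp_seq; apply: wp_imp (@push_ok n cmp s2 (vT + Cst 1)%code Lab.[vP]%code
  Lab.[vP]%code isT isT isT) _.
move=> s3 [] /=; rewrite (ready_t R2) addn1 eP2 => eS3 c3 fv3 fa3.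
have L3 : live t.+1 (ar s2 Lab) (stack_of s3) (upd on c false).
  by rewrite eS3; apply: live_new (ready_live R2) _; apply: (live_lab_new R2); lia.
have eE3 : ar s3 End = ar s End by rewrite fa3 // fa2.
have eL3 : ar s3 Lab = ar s Lab by rewrite fa3 // fa2.
have eP3 : vr s3 vP = p by rewrite fv3.
have eC3 : vr s3 vC = c by rewrite fv3 // fv2.
have onc a : upd on c false a -> on a /\ a <> c by rewrite /upd; case: eqP.
apply/wp_put; rewrite /= eP3 eC3 eE3; set s4 := seta _ _ _ _.
have eE4 : ar s4 End = upd (ar s End) p (ar s End c).
  by rewrite /s4 /= /upd /= eE3.
have far b : on b -> b <> c -> p < b -> vr s vR <= b.
  move=> ob bc pb; rewrite leqNgt; apply/negP => bR; apply: bc; apply: uniq_c => //.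
  have [[_ _ _ bL _] _] := mid_key H ob (leq_trans (ltn0Sn _) pb).
  by have [lt|//|] := ltngtP b (lf t); [have := maxp b lt ob; lia|rewrite bR].
have [k1 k2 k3] := ready_keys R2.
split; last by rewrite /= c3.
split.
- by split; rewrite /= /upd /= ?fv3 ?fa3.
- by rewrite [ar s4 Lab]eL3 -(fa2 Lab).
- rewrite eE4; apply: chain_grow => //.
  + by apply/chainS; have := ready_chain R2; rewrite fa2.
  + by have [i lt ->] := chain_right ch oc c0; exists i => //; apply: ltnW.
  + by apply/ltnW/(chain_mono ch) => //; lia.
  + move=> b /onc[ob bc] pb; apply: (chain_mono ch) => //.
    by have := far b ob bc pb; lia.
  + move=> b b' /onc[ob bc] /onc[ob' bc'] lt.
    apply: (chain_two ch oc ob ob'); have := far b ob bc; lia.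
- apply: (@faith_end _ s3 _ _ p (ar s End c)) => //.
  + by rewrite p0.
  + move=> col cl2; rewrite eS3 eS2 eE3 eL3 fa2 //= => /and3P[/andP[n1 _] /andP[n2 _] lk].
    have [pa fth] := F col cl2 lk; split=> //.
    apply: (@faithful_merge lf rt col t.+1 (p, ar s End p, ar s Lab p)
      (lf t, vr s vR, t.+1) (c, ar s End c, ar s Lab c)) => //=; try lia.
    apply: faithful_perm fth; rewrite /=.
    apply: perm_trans (perm_swap _ _ _); rewrite perm_cons.
    apply: perm_trans (supers_del _ _ oc _) _; first by rewrite c0.
    apply: perm_trans (perm_swap _ _ _); rewrite perm_cons.
    by apply: supers_del => //; rewrite p0.
Qed.

(** Here p2, p and the new super-interval share a cell: p2 absorbs the new one
    by faithful_merge. *)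
Lemma extend_left_ok s on p p2 c : mid s on ->
  right_done on (vr s vR) (ar s End) p c -> is_pred on p p2 ->
  vr s vX = p -> vr s vP = p2 -> lf t < ar s End p2 -> ar s End p < vr s vR ->
  wp (push (vT + Cst 1) Lab.[vX] Lab.[vX];; vQ ::= vX;; cut Lab.[vP];;
      Put End vP vR)%code
    (fun s' => inv2 t.+1 s' (upd on p false) /\ ck s' <= ck s + h) s.
Proof.
move=> H [[pl op maxp] uniq_c hc] [lt2 op2 maxp2] eX eP lp2 pR.
have [R F lr hr ne] := H; have ch := ready_chain R.
have p20 : 0 < p2.
  by case: p2 op2 lp2 {eP lt2 maxp2} => // o0; have [_ ->] := chain0 ch; lia.
have p0 : 0 < p by lia.
have [[_ pm _ _ _] _] := mid_key H op p0.
have [[_ pm2 _ _ _] _] := mid_key H op2 p20.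
have mono : ar s End p2 < ar s End p by apply: (chain_mono ch).
apply/wp_seq; apply: wp_imp (@push_ok n cmp s (vT + Cst 1)%code Lab.[vX]%code
  Lab.[vX]%code isT isT isT) _.
move=> s1 [] /=; rewrite (ready_t R) addn1 eX => eS1 c1 fv1 fa1.
have R1 : ready t t.+1 s1 on.
  have [k1 k2 k3] := ready_keys R; split; rewrite ?fv1 ?eS1 ?fa1 //; try by case: R.
  - by split; rewrite ?fv1 ?fa1.
  - by apply: live_new (ready_live R) _; apply: (live_lab_new R).
apply/wp_seq/wp_asg; rewrite /=; set s2 := setv _ _ _.
have R2 : ready t t.+1 s2 on by apply: ready_setv.
have eQ2 : vr s2 vQ = p by rewrite /s2 /= /upd /= fv1.
have eP2 : vr s2 vP = p2 by rewrite /s2 /= /upd /= fv1.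
have eLab : eval n s2 Lab.[vP]%code = ar s Lab p2 by rewrite /= /upd /= fv1 // eP fa1.
apply/wp_seq; apply: wp_imp (@cut_ok t t.+1 s2 on Lab.[vP]%code R2 isT _ _ _) _.
- by rewrite eQ2.
- by rewrite eQ2 p0.
- rewrite eLab eQ2 -(fa1 Lab) //; apply: (live_lab_notin R2) => //; lia.
move=> s3; rewrite eQ2 eLab -[stack_of s2]/(stack_of s1) -[ck s2]/(ck s1).
rewrite -[ar s2 _]/(ar s1 Lab) fa1 // => [] [R3 eS3 c3 fv3 fa3].
have eE3 : ar s3 End = ar s End by rewrite fa3 //= fa1.
have eL3 : ar s3 Lab = ar s Lab by rewrite fa3 //= fa1.
have eP3 : vr s3 vP = p2 by rewrite fv3.
have eR3 : vr s3 vR = vr s vR by rewrite fv3 //= /upd /= fv1.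
apply/wp_put; rewrite /= eP3 eR3; set s4 := seta _ _ _ _.
have onp a : upd on p false a -> on a /\ a <> p by rewrite /upd; case: eqP.
have op2' : upd on p false p2 by rewrite /upd; case: eqP => //; lia.
have eE4 : ar s4 End = upd (ar s End) p2 (vr s vR).
  by rewrite /s4 /= /upd /= eE3.
(* Beyond the joined super-interval only the neighbour c starts inside it. *)
have far b : on b -> b <> p -> p2 < b -> lf t < b /\ (b < vr s vR -> b = c).
  move=> ob bp pb; have bl : lf t < b.
    have [lt|bp2|//] := ltngtP b p; first by have := maxp2 b lt ob; lia.
    rewrite ltn_neqAle leqNgt; apply/andP; split.
      apply/eqP => E; have [[_ _ _ bL _] _] := mid_key H ob (leq_trans (ltn0Sn _) bp2).
      by rewrite -E in bL.
    by apply/negP => /maxp /(_ ob); lia.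
  by split=> // bR; apply: uniq_c => //; rewrite bl.
have nextR b : on b -> b <> p -> p2 < b -> vr s vR < ar s End b.
  move=> ob bp pb; have [bl bc] := far b ob bp pb.
  have [lt|le] := ltnP b (vr s vR).
    by have := bc lt; case: hc lt => [->|[_ _ ?]] + eb; rewrite eb ?ltnn.
  apply: leq_ltn_trans le _; apply: (chain_lt ch) => //; lia.
split; last by rewrite /= -c1.
have [k1 k2 k3] := ready_keys R3.
split.
- by split.
- by rewrite [ar s4 Lab]eL3; have := ready_live R3; rewrite eL3.
- rewrite eE4; apply: chain_grow => //.
  + by apply/chainS; have := ready_chain R3; rewrite eE3.
  + by lia.
  + by move=> b /onp[ob bp] pb; apply: nextR.
  + move=> b b' /onp[ob bp] /onp[ob' bp'] /andP[lt lt'].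
    rewrite leqNgt; apply/negP => bR.
    have [_ e'] := far b' ob' bp' (ltn_trans lt lt').
    have [_ e] := far b ob bp lt.
    by have := e' bR; have := e (ltn_trans lt' bR); lia.
- apply: (@faith_end _ s3 _ _ p2 (vr s vR)) => //.
  + by rewrite p20.
  + move=> col cl2; rewrite eS3 eS1 eE3 eL3 //= => /and3P[/andP[n1 _] /andP[n2 _] lk].
    have [pa fth] := F col cl2 lk; split=> //.
    apply: (@faithful_merge lf rt col t.+1 (p2, ar s End p2, ar s Lab p2)
      (p, ar s End p, ar s Lab p) (lf t, vr s vR, t.+1)) => //=; try lia.
    apply: faithful_perm fth; rewrite /=.
    apply: perm_trans (_ : perm_eq _ [:: (lf t, vr s vR, t.+1),
        (p, ar s End p, ar s Lab p), (p2, ar s End p2, ar s Lab p2) &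
        supers m (upd (upd on p false) p2 false) (ar s End) (ar s Lab)]) _.
      rewrite perm_cons; apply: perm_trans (supers_del _ _ op _) _; first by rewrite p0.
      by rewrite perm_cons; apply: supers_del => //; rewrite p20.
    by apply/permP => f /=; lia.
Qed.

Lemma join_left_ok s on : mid s on ->
  right_done on (vr s vR) (ar s End) (vr s vP) (vr s vC) ->
  wp join_left (fun s' => exists2 on', inv2 t.+1 s' on' &
    ck s' + weight * nkeys m.+1 on' <= ck s + weight * (nkeys m.+1 on).+2) s.
Proof.
move=> H rd; have [R F lr hr ne] := H; have ch := ready_chain R.
have [o0 e0] := chain0 ch.
have [[pl op maxp] uniq_c hc] := rd; set p := vr s vP in pl op maxp rd.
set c := vr s vC in rd uniq_c hc.
have lowc b c' : on b -> on c' -> lf t < b < c' -> vr s vR <= c'.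
  move=> ob oc' lt; rewrite leqNgt; apply/negP => cR.
  have := uniq_c c' oc'; have := uniq_c b ob; lia.
have right b : on b -> lf t < b -> vr s vR < ar s End b.
  move=> ob bl; have [bR|le] := ltnP b (vr s vR).
    have bc := uniq_c b ob; rewrite bl bR in bc.
    by have := bc isT; case: hc bR => [->|[_ _ ?]] + eb; rewrite eb ?ltnn.
  by apply: leq_ltn_trans le _; apply: (chain_lt ch) => //; lia.
have rightc b : on b -> lf t < b -> c <= b.
  move=> ob bl; have [bR|le] := ltnP b (vr s vR); first by rewrite (uniq_c b ob) // bl.
  by case: hc => [->|[_ ? _]] //; lia.
have leftE a : on a -> a < lf t -> a = p \/ ar s End a < ar s End p.
  move=> oa al; have := maxp a al oa; rewrite leq_eqVlt => /orP[/eqP|ap]; first by left.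
  by right; apply: (chain_mono ch).
have nop : ar s End p <> lf t.
  case: (posnP p) => [->|p0]; first by rewrite e0; have [] := rank_range tN; lia.
  by have [] := mid_key H op p0.
have noR : ar s End p <> vr s vR.
  by case: (posnP p) => [->|p0]; [rewrite e0; lia | apply: ne].
have wh : 2 * h + 2 <= weight by rewrite /weight; lia.
apply: wp_if => /=; rewrite -/p (ready_l R) => cl; last first.
  have {}cl : ar s End p < lf t by lia.
  apply: wp_imp (add_super_ok H _ right lowc _ _) _.
  - by move=> a oa al; have [->|] := leftE a oa al; lia.
  - by move=> a b oa ob /andP[al lb]; have [->|] := leftE a oa al; lia.
  - move=> a b oa ob /andP[ab bl].
    by have [->|] := leftE a oa (ltn_trans ab bl); lia.
  - by move=> s' [on' i le]; exists on' => //; move: le; rewrite !mulnS; lia.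
apply: wp_if => /=; rewrite -/p => cR.
  apply: wp_imp (swallow_ok H op _ pl cR) _ => // s' [i ->].
  by exists on => //; rewrite !mulnS; lia.
have {}cR : ar s End p < vr s vR by lia.
apply: wp_if => /=; rewrite -/p -/c => cC.
  apply: wp_imp (bridge_ok H rd _ _ _ cC) _ => //; first by rewrite cl.
  move=> s' [i le]; exists (upd on c false) => //.
  have oc : on c by case: hc => [hc|[]//]; move: cC cR; rewrite -/c hc; lia.
  have cm : c < m.+1 by case: hc => [->|[_ ? _]]; lia.
  by rewrite -(nkeys_del cm oc) !mulnS; lia.
have {}cC : ar s End p <= c by rewrite leqNgt.
apply/wp_seq/wp_asg/wp_seq/wp_asg; rewrite /=; set s1 := setv _ _ _.
have M1 : mid s1 on by do 2 apply: mid_setv => //.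
have p0 : 0 < p by case: p op cl {pl maxp rd leftE nop noR cR cC} => //; rewrite e0.
have eQ1 : vr s1 vQ = p by rewrite /s1 /= /upd /=.
have [[_ pm _ _ _] _] := mid_key H op p0.
apply/wp_seq; apply: wp_imp (mid_pred M1 _) _; first by rewrite eQ1 p0.
move=> s2 [M2 + c2 fv2 fa2]; rewrite eQ1 -[ck s1]/(ck s) in c2 * => ip2.
have eE2 : ar s2 End = ar s End by rewrite fa2.
have eL2 : vr s2 vL = lf t by rewrite fv2 // -(ready_l R).
have eR2 : vr s2 vR = vr s vR by rewrite fv2.
have eX2 : vr s2 vX = p by rewrite fv2.
set p2 := vr s2 vP in ip2; have [ltp2 op2 maxp2] := ip2.
apply: wp_if => /=; rewrite -/p2 eL2 eE2 => cl2.
  apply: wp_imp (@extend_left_ok s2 on p p2 c M2 _ ip2 eX2 _ _ _) _ => //.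
  - by rewrite eR2 eE2.
  - by rewrite eE2.
  - by rewrite eE2 eR2.
  move=> s' [i le]; exists (upd on p false) => //.
  by rewrite -(@nkeys_del m.+1 on p pm op) !mulnS; lia.
have {}cl2 : ar s End p2 <= lf t by lia.
apply: wp_imp (add_super_ok M2 _ _ _ _ _) _; rewrite ?eE2 ?eR2 //.
- by move=> a oa al; have [->|] := leftE a oa al; lia.
- move=> a b oa ob /andP[al lb]; have := rightc b ob lb.
  by have [->|] := leftE a oa al; lia.
- move=> a b oa ob /andP[ab bl].
  have ap : a < p by have := maxp b bl ob; lia.
  have := maxp2 a ap oa; rewrite leq_eqVlt => /orP[/eqP->|lt] //.
  by have := chain_mono ch oa op2 lt; lia.
- by move=> s' [on' i le]; exists on' => //; move: le; rewrite !mulnS; lia.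
Qed.

Lemma step2_ok s on : inv2 t s on -> vr s vT = t -> vr s vL = lf t ->
  vr s vR = rt t -> lf t < rt t ->
  wp step2 (fun s' => exists2 on', inv2 t.+1 s' on' &
    ck s' + weight * nkeys m.+1 on' <= ck s + weight * (nkeys m.+1 on).+3) s.
Proof.
move=> [k li ch F] eT eL eR lr; have [/andP[l0 lm] /andP[r0 rm]] := rank_range tN.
have M0 : mid s on.
  split; rewrite ?eR //.
  - move=> col c2 lk; have [pa fth] := F col c2 lk; split=> //.
    exact: faithful_add.
  - by rewrite lr.
  - by exists t.
  - move=> a oa a0; have [i lt ->] := chain_right ch oa a0 => /rt_inj; lia.
apply/wp_seq; apply: wp_imp (absorb_right_ok M0) _.
move=> s1 [on1 [M1 rd le1 _]].
apply: wp_imp (join_left_ok M1 rd) _ => s2 [on2 i le2]; exists on2 => //.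
by move: le1 le2; rewrite !mulnS; lia.
Qed.

Lemma skip2_ok s on : inv2 t s on -> ~~ (lf t < rt t) -> inv2 t.+1 s on.
Proof.
move=> [k li ch F] e; split=> //.
- split; try by case: li.
  + by move=> a oa a0; have := live_range li oa a0; lia.
  + by move=> v /(live_pushed li); lia.
- exact: chainS.
- move=> col c2 lk; have [pa fth] := F col c2 lk; split=> //.
  exact: faithfulS.
Qed.
End StepTwo.

(** * Labellings of the cells *)

Section Blocks.
Implicit Types (on : pred nat) (lb col q : nat -> nat).

Fixpoint last_key on x :=
  if on x then x else if x is y.+1 then last_key on y else 0.

(** A labelling is constant between two consecutive keys. *)
Definition label_at on lb x := lb (last_key on x).

Lemma last_keyP on x : on 0 ->
  [/\ on (last_key on x), last_key on x <= x
    & forall k, on k -> k <= x -> k <= last_key on x].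
Proof.
move=> o0; elim: x => [|x [h1 h2 h3]] /=; first by rewrite o0.
case: ifP => [o|no]; first by [].
split=> //; first by apply: leqW.
move=> k ok; rewrite leq_eqVlt => /orP[/eqP e|]; last exact: h3.
by rewrite -e ok in no.
Qed.

Lemma last_keyE on x k : on k -> k <= x ->
  (forall j, on j -> j <= x -> j <= k) -> last_key on x = k.
Proof.
move=> ok kx mx; have o0 : on (last_key on x) /\ last_key on x <= x /\ k <= last_key on x.
  elim: x kx mx => [|x IH] kx mx /=.
    have k0 : k = 0 by lia.
    by rewrite -k0 ok; lia.
  case: ifP => [//|no]; move: kx; rewrite leq_eqVlt => /orP[/eqP e|kx].
    by rewrite -e ok in no.
  have [|h1 [h2 h3]] := IH kx; first by move=> j oj jx; apply: mx => //; lia.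
  by split=> //; split=> //; lia.
by have [h1 [h2 h3]] := o0; apply/eqP; rewrite eqn_leq h3 andbT mx.
Qed.

Lemma is_pred_uniq on x p p' : is_pred on x p -> is_pred on x p' -> p = p'.
Proof.
move=> [l1 o1 m1] [l2 o2 m2]; apply/eqP.
by rewrite eqn_leq (m1 p' l2 o2) (m2 p l1 o1).
Qed.

Lemma is_pred_last_key on x : on 0 -> is_pred on x.+1 (last_key on x).
Proof. by move=> /(@last_keyP on x)[h1 h2 h3]; split=> // u lt ou; apply: h3. Qed.

(** The keys met when going down from R by predecessor queries. *)
Definition descent on R (ka : nat -> nat) J :=
  is_pred on R (ka 0) /\ forall j, j < J -> is_pred on (ka j) (ka j.+1).

Section Descent.
Variables (on : pred nat) (R : nat) (ka : nat -> nat) (J : nat).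
Hypothesis D : descent on R ka J.

Lemma descent_on j : j <= J -> on (ka j).
Proof. by have [[? ? ?] h] := D; case: j => // j /h[]. Qed.

Lemma descent_lt i j : i < j <= J -> ka j < ka i.
Proof.
move=> /andP[lt le]; have [_ h] := D.
have [d e] : exists d, j = i + d.+1 by exists (j - i.+1); lia.
move: le; rewrite e => {j e lt}.
elim: d => [|d IH] le'; first by rewrite addn1 in le' *; have [] := h i le'.
rewrite addnS; have [|l _ _] := h (i + d.+1); first by lia.
by apply: ltn_trans l _; apply: IH; lia.
Qed.

Lemma descent_ltR j : j <= J -> ka j < R.
Proof.
move=> le; have [[l _ _] _] := D; case: j le => // j le.
by apply: ltn_trans l; apply: descent_lt; lia.
Qed.

Lemma descent_all a : on a -> ka J <= a < R -> exists2 j, j <= J & a = ka j.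
Proof.
move=> oa; have [[l o mx] h] := D; elim: J h => [|j IH] h /andP[le lt].
  by exists 0 => //; apply/eqP; rewrite eqn_leq le mx.
have [lt'|ge] := ltnP a (ka j); last first.
  have [||i le' ->] := IH; [by move=> i li; apply: h; lia|by rewrite ge|].
  by exists i => //; lia.
exists j.+1 => //; apply/eqP; rewrite eqn_leq le andbT.
by have [_ _ ->] := h j (leqnn _).
Qed.

End Descent.
End Blocks.

Section Regions.
Variables (lf rt : nat -> nat).
Implicit Types (phi col q : nat -> nat).
Local Notation cov := (cov lf rt).
Local Notation good := (good lf rt).

(** An uncovered cell has the label 0 and imposes nothing on its neighbours.
    *)
Definition separated phi col := forall x,
  phi x != 0 -> phi x.+1 != 0 -> phi x != phi x.+1 -> col (phi x) != col (phi x.+1).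

Definition covered phi t := forall x,
  (phi x != 0) <-> exists2 i, i < t & cov i x.

Definition tells phi col t := forall x, phi x != 0 ->
  good col t x \/
  exists i, [/\ i < t, cov i x, col i.+1 = col (phi x)
    & forall j, j < t -> cov j x -> j = i].

(** The labels met from right to left over the cells of the interval t. *)
Record runs phi L R q J : Prop := Runs {
  runs_lt : 0 < L < R;
  runs_left : phi L.-1 = q J /\ phi L = q J;
  runs_right : phi R.-1 = q 0 /\ phi R = q 0;
  runs_in : forall x, L <= x < R -> exists2 j, j <= J & phi x = q j;
  runs_step : forall x, L <= x -> x.+1 < R -> phi x = phi x.+1 \/
    exists j, [/\ j < J, phi x = q j.+1 & phi x.+1 = q j] }.

Section Update.
Variables (t : nat) (phi phi' : nat -> nat) (q : nat -> nat) (J : nat) (col : nat -> nat).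
Local Notation L := (lf t).
Local Notation R := (rt t).
Hypothesis col3 : forall v, col v < 3.
Hypothesis rn : runs phi L R q J.

(** What the insertion of the interval t has to enforce, in each of its cases.
    *)
Hypothesis newC : forall j, j <= J -> q j != 0 -> col (q j) != col t.+1.
Hypothesis stepC : forall j, j < J -> q j != 0 -> q j.+1 != 0 ->
  col (q j.+1) != col (q j).

(** The old labelling is separated: where it is not changed because the new
    one is, and over the cells of the interval because of stepC. So the old
    invariant applies to the colouring. *)
Lemma separated_back :
  (forall x, x < L -> phi x != 0 -> phi' x != 0 /\ col (phi' x) = col (phi x)) ->
  (forall x, R <= x -> phi x != 0 -> phi' x != 0 /\ col (phi' x) = col (phi x)) ->
  (forall x, x.+1 < L -> phi x != phi x.+1 -> phi' x != phi' x.+1) ->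
  (forall x, R <= x -> phi x != phi x.+1 -> phi' x != phi' x.+1) ->
  separated phi' col -> separated phi col.
Proof.
move=> h1 h2 h3 h4 sep x n0 n1 ne.
have [xL|xL] := ltnP x.+1 L.
  have [n0' <-] := h1 x (ltnW xL) n0; have [n1' <-] := h1 _ xL n1.
  by apply: sep => //; apply: h3.
have [xR|xR] := leqP R x.
  have [n0' <-] := h2 x xR n0; have [n1' <-] := h2 _ (leqW xR) n1.
  by apply: sep => //; apply: h4.
have [e|Lx] := eqVneq x.+1 L.
  by case/negP: ne; have [] := runs_left rn; rewrite -e /= => -> ->.
have [e|xR1] := eqVneq x.+1 R.
  by case/negP: ne; have [] := runs_right rn; rewrite -e /= => -> ->.
have Lx' : L <= x by lia.
have xR' : x.+1 < R by lia.
have [e|[j [jJ e1 e2]]] := runs_step rn Lx' xR'.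
  by rewrite e eqxx in ne.
by rewrite e1 e2; apply: stepC => //; rewrite -?e1 -?e2.
Qed.

(** A covered cell of the new interval is good: if it was not, its only cover
    had the colour of its label, which the new interval avoids. *)
Lemma tells_step : covered phi t ->
  (forall x, ~~ (L <= x < R) -> phi' x != 0 -> phi x != 0 /\ col (phi' x) = col (phi x))
    ->
  (forall x, L <= x < R -> phi x = 0 -> phi' x = t.+1) ->
  tells phi col t -> tells phi' col t.+1.
Proof.
move=> cv h1 h2 te x n0'; case hx: (L <= x < R); last first.
  have [n0 ec] := h1 x (negbT hx) n0'.
  have [g|[i [it ci ei ui]]] := te x n0; first by left; apply: goodS.
  right; exists i; split=> //; [by apply: ltnW | by rewrite ei ec |].
  move=> j; rewrite ltnS leq_eqVlt => /orP[/eqP->|]; last exact: ui.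
  by rewrite /cov hx.
have [z|n0] := eqVneq (phi x) 0.
  right; exists t; split=> //; first by rewrite (h2 x).
  move=> j; rewrite ltnS leq_eqVlt => /orP[/eqP//|lt] cj.
  have [_ cv'] := cv x; have : phi x != 0 by apply: cv'; exists j.
  by rewrite z.
left; have [g|[i [it ci ei ui]]] := te x n0; first exact: goodS.
exists i, t; split=> //; first by apply: ltnW.
have [j jJ e] := runs_in rn hx.
by rewrite ei e; apply: newC => //; rewrite -e.
Qed.

End Update.

Lemma covered_step phi phi' t : covered phi t ->
  (forall x, lf t <= x < rt t -> phi' x != 0) ->
  (forall x, ~~ (lf t <= x < rt t) -> (phi' x != 0) = (phi x != 0)) ->
  covered phi' t.+1.
Proof.
move=> cv h1 h2 x; case hx: (lf t <= x < rt t).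
  by split=> _; [exists t | apply: h1].
rewrite h2 ?hx //; have [c1 c2] := cv x; split.
  by move=> /c1[i it ci]; exists i => //; apply: ltnW.
case=> i; rewrite ltnS leq_eqVlt => /orP[/eqP->|it ci]; last by apply: c2; exists i.
by rewrite /cov hx.
Qed.

(** When c is avoided, only two colours remain, and each step goes from one to
    the other. *)
Lemma alternate col q c J : (forall v, col v < 3) ->
  (forall j, j <= J -> col (q j) != c) -> c < 3 ->
  (forall j, j < J -> col (q j.+1) != col (q j)) ->
  (col (q J) == col (q 0)) = ~~ odd J.
Proof.
move=> c3 nc lc st; elim: J nc st => [|J IH] nc st; first by rewrite eqxx.
have {IH} := IH (fun j h => nc j (leqW h)) (fun j h => st j (leqW h)).
have := st J (leqnn _); have := nc 0 (leq0n _); have := nc J (leqnSn _); have := nc J.+1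
  (leqnn _).
have := c3 (q 0); have := c3 (q J); have := c3 (q J.+1) => /=.
by case: (odd J) => /=; lia.
Qed.

End Regions.

Lemma last_key_ext (on on' : pred nat) x :
  (forall k, k <= x -> on k = on' k) -> last_key on x = last_key on' x.
Proof.
elim: x => [|x IH] h /=; rewrite h //; case: ifP => // _.
by apply: IH => k hk; apply: h; apply: leqW.
Qed.

Lemma descent_runs (on : pred nat) lb R ka J L : on 0 -> descent on R ka J ->
  ka J < L -> (forall j, j < J -> L < ka j) -> L < R -> ~~ on L -> ~~ on R ->
  runs (label_at on lb) L R (fun j => lb (ka j)) J.
Proof.
move=> o0 D lJ gt LR nL nR; have oJ := descent_on D (leqnn J).
have low x : ka J <= x <= L -> last_key on x = ka J.
  move=> hx; apply: last_keyE => //; first lia.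
  move=> k ok kx; rewrite leqNgt; apply/negP => lt.
  have [|j jJ e] := descent_all D ok; first by lia.
  have [/gt|ge] := ltnP j J; first by lia.
  by have je : j = J by [lia]; rewrite e je ltnn in lt.
have [[l0 k0 m0] _] := D.
have high x : R.-1 <= x <= R -> last_key on x = ka 0.
  move=> hx; apply: last_keyE => //; first lia.
  move=> k ok kx; apply: m0 => //; rewrite ltn_neqAle; apply/andP; split; last lia.
  by apply: contraNneq nR => <-.
have inside x : L <= x < R -> exists2 j, j <= J & last_key on x = ka j.
  move=> hx; have [ok le mx] := last_keyP x o0.
  by have [|j jJ ->] := descent_all D ok; [have := mx _ oJ; lia | exists j].
split=> //=.
- lia.
- by rewrite /label_at !low //; lia.
- by rewrite /label_at !high //; lia.
- by move=> x /inside[j jJ e]; exists j => //; rewrite /label_at e.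
- move=> x Lx xR; rewrite /label_at /=; case: ifP => [o|_]; last by left.
  right; have [|j jJ e] := descent_all D o; first by lia.
  have [lt|ge] := ltnP j J; last first.
    by have je : j = J by [lia]; move: e; rewrite je; lia.
  exists j; rewrite e; split=> //; congr lb.
  have [_ /(_ j lt)] := D; rewrite -e; apply: is_pred_uniq.
  exact: is_pred_last_key.
Qed.

Section Labelled.
Variables (N : nat) (lf rt : nat -> nat).
Local Notation m := (N + N).
Hypothesis rank_range : forall i, i < N -> 0 < lf i <= m /\ 0 < rt i <= m.
Hypothesis rank_neq : forall i j, i < N -> j < N -> lf i <> rt j.
Hypothesis lf_inj : forall i j, i < N -> j < N -> lf i = lf j -> i = j.
Hypothesis rt_inj : forall i j, i < N -> j < N -> rt i = rt j -> i = j.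

Variable past : (nat -> nat) -> Prop.

(** A label other than 0 belongs to one key, hence to one block, and has not
    been pushed: it may be linked later. *)
Record labelled t (on : pred nat) (lb : nat -> nat) (st : seq link) : Prop :=
 Labelled {
  lab_on0 : on 0;
  lab_key : forall a, on a -> 0 < a -> exists2 i, i < t & a = lf i \/ a = rt i;
  lab_le : forall a, on a -> lb a <= t;
  lab_notin : forall a, on a -> lb a \notin pushed st;
  lab_inj : forall a b, on a -> on b -> lb a = lb b -> lb a != 0 -> a = b;
  lab_pushed : forall v, v \in pushed st -> 0 < v <= t;
  lab_acyclic : acyclic st;
  lab_covered : covered lf rt (label_at on lb) t;
  lab_tells : forall col, (forall v, col v < 3) -> linked col st ->
    separated (label_at on lb) col ->
    past col /\ tells lf rt (label_at on lb) col t }.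

Section Step.
Variables (t : nat) (on on' : pred nat) (lb lb' : nat -> nat) (st st' : seq link).
Variables (ka : nat -> nat) (J : nat).
Local Notation L := (lf t).
Local Notation R := (rt t).
Local Notation q := (fun j => lb (ka j)).
Local Notation phi := (label_at on lb).
Local Notation phi' := (label_at on' lb').
Hypothesis tN : t < N.
Hypothesis LR : L < R.
Hypothesis H : labelled t on lb st.

Lemma not_on_L : ~~ on L.
Proof.
have [/andP[L0 _] _] := rank_range tN.
apply/negP => o; have [i it [e|e]] := lab_key H o L0.
  by have := lf_inj tN (ltn_trans it tN) e; lia.
exact: (rank_neq tN (ltn_trans it tN) e).
Qed.

Lemma not_on_R : ~~ on R.
Proof.
have [_ /andP[R0 _]] := rank_range tN.
apply/negP => o; have [i it [e|e]] := lab_key H o R0.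
  by apply: (rank_neq (ltn_trans it tN) tN); rewrite e.
by have := rt_inj tN (ltn_trans it tN) e; lia.
Qed.

Hypothesis D : descent on R ka J.

Lemma q_inj i j : i <= J -> j <= J -> q i = q j -> q i != 0 -> i = j.
Proof.
move=> iJ jJ e n0; have := lab_inj H (descent_on D iJ) (descent_on D jJ) e n0.
have [lt|lt|//] := ltngtP i j.
  by have := descent_lt D (i := i) (j := j); rewrite lt jJ => /(_ isT); lia.
by have := descent_lt D (i := j) (j := i); rewrite lt iJ => /(_ isT); lia.
Qed.

Lemma kept_notin a j : on a -> ~~ (ka J < a < R) -> j < J -> q j != 0 -> lb a != q j.
Proof.
move=> oa ha jJ n0; apply/eqP => e.
have aj : a = ka j by apply: (lab_inj H oa (descent_on D (ltnW jJ)) e); rewrite e.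
have := descent_lt D (i := j) (j := J); rewrite jJ leqnn => /(_ isT).
by have := descent_ltR D (ltnW jJ); move: ha; rewrite aj; lia.
Qed.

Hypothesis kaJ : ka J < L.
Hypothesis ka_gt : forall j, j < J -> L < ka j.

Lemma step_runs : runs phi L R q J.
Proof.
exact: (descent_runs _ (lab_on0 H) D kaJ ka_gt LR not_on_L not_on_R).
Qed.

Lemma between a : on a -> ka J < a < R -> L < a.
Proof.
move=> oa ha; have [|j jJ e] := descent_all D oa; first by lia.
have [/ka_gt|ge] := ltnP j J; first by rewrite -e.
by have je : j = J by [lia]; move: ha; rewrite e je ltnn.
Qed.

Lemma phi_low x : (forall a, a < L -> on' a = (on a && ~~ (ka J < a < R))) ->
  x < L -> last_key on' x = last_key on x.
Proof.
move=> ho xL; apply: last_key_ext => k kx; rewrite ho; last by lia.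
case ok: (on k) => //=; apply/negP => hk.
have := between ok; lia.
Qed.

Lemma phi_high x : on' R -> (forall a, R < a -> on' a = on a) ->
  lb' R = q 0 -> (forall a, R < a -> lb' a = lb a) ->
  R <= x -> phi' x = phi x.
Proof.
move=> oR ho lR hl xR; rewrite /label_at.
have [ok le mx] := last_keyP x (lab_on0 H).
have [lt|ge] := ltnP R (last_key on x).
  rewrite (@last_keyE on' x (last_key on x)) ?ho // ?hl //.
  move=> j oj jx; have [Rj|] := ltnP R j; last by lia.
  by apply: mx => //; rewrite -ho.
have lt : last_key on x < R.
  rewrite ltn_neqAle ge andbT; apply/eqP => e.
  by have := not_on_R; rewrite -e ok.
have [[l0 k0 m0] _] := D.
have -> : last_key on x = ka 0.
  by apply/eqP; rewrite eqn_leq m0 // mx //; lia.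
rewrite (@last_keyE on' x R) // => j oj jx; rewrite leqNgt; apply/negP => Rj.
by have := mx j; rewrite -ho // => /(_ oj jx); lia.
Qed.

Hypothesis acy : acyclic st'.

(** The new label fills the interval, from the key L to the key R. Links
    relate each label met to its neighbour on the side away from the gap q g =
    0, so that q 0 and q J are not pushed: they stay on both sides of the new
    block, and separation gives what is required of them. *)
Lemma labelled_gap g : g <= J -> q g = 0 ->
  (forall a, on' a = [|| a == L, a == R | on a && ~~ (ka J < a < R)]) ->
  lb' = upd (upd lb L t.+1) R (q 0) ->
  (forall v, v \in pushed st' -> v \in pushed st \/
     exists j, [/\ 0 < j < J, q j != 0 & v = q j]) ->
  (forall col, linked col st' -> linked col st /\
     forall j, 0 < j < J -> q j != 0 -> [/\ col (q j) != col t.+1,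
       j < g -> col (q j) != col (q j.-1) & g < j -> col (q j) != col (q j.+1)]) ->
  labelled t.+1 on' lb' st' /\ forall x, L <= x < R -> phi' x = t.+1.
Proof.
move=> gJ qg ho hl hp hk; have rn := step_runs.
have [/andP[L0 Lm] /andP[R0 Rm]] := rank_range tN.
have lbR : lb' R = q 0 by rewrite hl /upd eqxx.
have lbL : lb' L = t.+1 by rewrite hl /upd eqxx ifF //; lia.
have lbo a : a != L -> a != R -> lb' a = lb a.
  by move=> /negbTE aL /negbTE aR; rewrite hl /upd aR aL.
have low x : x < L -> phi' x = phi x.
  move=> xL; rewrite /label_at phi_low //.
    have [_ le _] := last_keyP x (lab_on0 H); apply: lbo; lia.
  by move=> a aL; rewrite ho; case: eqP; case: eqP => //; lia.
have high x : R <= x -> phi' x = phi x.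
  apply: phi_high => //.
  - by rewrite ho eqxx orbT.
  - by move=> a aR; rewrite ho; case: eqP; case: eqP => /=; case: (on a) => //=; lia.
  - by move=> a aR; apply: lbo; lia.
have mid x : L <= x < R -> phi' x = t.+1.
  move=> hx; rewrite /label_at -lbL; congr lb'; apply: last_keyE; try lia.
    by rewrite ho eqxx.
  move=> j; rewrite ho => /or3P[/eqP->|/eqP->|/andP[oj nj]] jx; lia.
have out x : ~~ (L <= x < R) -> phi' x = phi x.
  by move=> hx; have [/low//|xL] := ltnP x L; apply: high; lia.
split=> //; split.
- by rewrite ho (lab_on0 H); apply/or3P/Or33; lia.
- move=> a; rewrite ho => /or3P[/eqP->|/eqP->|/andP[oa _]] a0.
  + by exists t => //; left.
  + by exists t => //; right.
  + by have [i it e] := lab_key H oa a0; exists i => //; apply: ltnW.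
- move=> a; rewrite ho hl /upd; case: (a =P R) => [_ _|_].
    exact: (leqW (lab_le H (descent_on D (leq0n J)))).
  by case: (a =P L) => // _ /= /andP[oa _]; exact: (leqW (lab_le H oa)).
- move=> a; rewrite ho hl /upd; case: (a =P R) => [_ _|_].
    apply/negP => /hp[|[j [hj n0 e]]].
      exact/negP/(lab_notin H (descent_on D (leq0n J))).
    by have := @q_inj 0 j (leq0n _) _ e; rewrite e n0; lia.
  case: (a =P L) => [_ _|_ /= /andP[oa na]].
    apply/negP => /hp[/(lab_pushed H)|[j [hj n0 e]]]; first by lia.
    by have := lab_le H (descent_on D (j := j) _); lia.
  apply/negP => /hp[|[j [hj n0 e]]]; first exact/negP/(lab_notin H oa).
  have lt : j < J by lia.
  by have := kept_notin oa na lt n0; rewrite e eqxx.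
- have hR a : on a -> ~~ (ka J < a < R) -> lb a = q 0 -> lb a != 0 -> J = 0.
    move=> oa na e n0; case: (posnP J) => // J0.
    by have := kept_notin oa na J0; rewrite -e n0 eqxx => /(_ isT).
  have c0 : q 0 <= t by exact: (lab_le H (descent_on D (leq0n J))).
  have Jg a : on a -> ~~ (ka J < a < R) -> lb a = q 0 -> lb a != 0 -> False.
    move=> oa na e n0; have J0 := hR a oa na e n0.
    have g0 : g = 0 by lia.
    by move: qg; rewrite g0 /= => qg; rewrite e qg in n0.
  move=> a b; rewrite !ho hl /upd.
  case: (a =P R) => [->|_]; case: (b =P R) => [->|_] //.
  + case: (b =P L) => [_|_ /= _ /andP[ob nb] e n0]; first by rewrite -/(q 0); lia.
    by case: (Jg b ob nb) => //; rewrite -e.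
  + case: (a =P L) => [_|_ /= /andP[oa na] _ e n0]; first by rewrite -/(q 0); lia.
    by case: (Jg a oa na).
  + case: (a =P L) => [->|_ /=]; case: (b =P L) => [->|_ /=] //.
    * by move=> _ /andP[ob _] e; have := lab_le H ob; lia.
    * by move=> /andP[oa _] _ e; have := lab_le H oa; lia.
    * by move=> /andP[oa _] /andP[ob _]; apply: (lab_inj H).
- move=> v /hp[/(lab_pushed H)|[j [hj n0 ->]]]; first by lia.
  by have := lab_le H (descent_on D (j := j) _); lia.
- by [].
- apply: covered_step (lab_covered H) _ _ => x hx; first by rewrite mid.
  by rewrite out.
- move=> col c3 /hk[lk lks] sep'.
  have le_q j : j <= J -> q j <= t by move=> jJ; apply: (lab_le H (descent_on D jJ)).
  have newC j : j <= J -> q j != 0 -> col (q j) != col t.+1.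
    move=> jJ n0; have ne : t.+1 != q j by have := le_q j jJ; lia.
    case: (posnP j) => [j0|j0].
      rewrite j0 in n0 ne *; rewrite eq_sym.
      have := sep' R.-1; rewrite prednK // mid; last by lia.
      by have [_ eR] := runs_right rn; rewrite high // eR; apply.
    have [lt|ge] := ltnP j J; first by have [] := lks j; rewrite ?j0.
    have jE : j = J by lia.
    have := sep' L.-1; rewrite prednK // [phi' L]mid ?leqnn // low; last by lia.
    have [eL _] := runs_left rn; rewrite eL /= -jE; apply=> //.
    by rewrite eq_sym.
  have stepC j : j < J -> q j != 0 -> q j.+1 != 0 -> col (q j.+1) != col (q j).
    move=> jJ n0 n1; have [gj|jg] := ltnP g j.
      have [||_ _ /(_ gj)] := lks j => //; first by lia.
      by rewrite eq_sym.
    have ng : j != g by apply: contra_neq n0 => ->.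
    have ng' : j.+1 != g by apply: contra_neq n1 => ->.
    have [||_ h1 _] := lks j.+1 => //; first by lia.
    by apply: h1; lia.
  have sep : separated phi col.
    apply: (separated_back rn stepC _ _ _ _ sep') => x hx.
    - by rewrite low.
    - by rewrite high.
    - by rewrite !low //; lia.
    - by rewrite !high //; lia.
  have [pa te] := lab_tells H c3 lk sep; split=> //.
  apply: (tells_step rn newC (lab_covered H) _ _ te) => x hx.
  + by rewrite out.
  + by rewrite mid.
Qed.

(** The labels alternate between two colours, and an even number of them is
    met. All are linked to their right neighbours except q J. The block of q J
    is extended up to the one of q 0 at R; by separation their colours differ,
    and then alternation implies the condition that is missing, between q J
    and its former right neighbour. *)
Lemma labelled_odd : odd J -> (forall j, j <= J -> q j != 0) ->
  (forall a, on' a = (a == R) || (on a && ~~ (ka J < a < R))) ->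
  lb' = upd lb R (q 0) ->
  (forall v, v \in pushed st' -> [\/ v \in pushed st, v = t.+1 |
     exists2 j, 0 < j < J & v = q j]) ->
  (forall col, linked col st' -> [/\ linked col st,
     col t.+1 != col (q 0), col t.+1 != col (q J) &
     forall j, 0 < j < J -> col (q j) != col t.+1 /\ col (q j) != col (q j.-1)]) ->
  labelled t.+1 on' lb' st'.
Proof.
move=> oddJ q0 ho hl hp hk; have rn := step_runs.
have [/andP[L0 Lm] /andP[R0 Rm]] := rank_range tN.
have J0 : 0 < J by case: J oddJ.
have le_q j : j <= J -> q j <= t by move=> jJ; apply: (lab_le H (descent_on D jJ)).
have lbR : lb' R = q 0 by rewrite hl /upd eqxx.
have lbo a : a != R -> lb' a = lb a by move=> /negbTE aR; rewrite hl /upd aR.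
have low x : x < L -> phi' x = phi x.
  move=> xL; rewrite /label_at phi_low //.
    have [_ le _] := last_keyP x (lab_on0 H); apply: lbo; lia.
  by move=> a aL; rewrite ho; case: eqP => //; lia.
have high x : R <= x -> phi' x = phi x.
  apply: phi_high => //.
  - by rewrite ho eqxx.
  - by move=> a aR; rewrite ho; case: eqP => /=; case: (on a) => //=; lia.
  - by move=> a aR; apply: lbo; lia.
have mid x : L <= x < R -> phi' x = q J.
  move=> hx; rewrite /label_at (@last_keyE on' x (ka J)); first by apply: lbo; lia.
  - by rewrite ho (descent_on D (leqnn J)) /= ltnn orbT.
  - by lia.
  - by move=> j; rewrite ho => /orP[/eqP->|/andP[oj nj]] jx; lia.
have out x : ~~ (L <= x < R) -> phi' x = phi x.
  by move=> hx; have [/low//|xL] := ltnP x L; apply: high; lia.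
split=> //.
- by rewrite ho (lab_on0 H) orbT.
- move=> a; rewrite ho => /orP[/eqP->|/andP[oa _]] a0.
  + by exists t => //; right.
  + by have [i it e] := lab_key H oa a0; exists i => //; apply: ltnW.
- move=> a; rewrite ho hl /upd; case: (a =P R) => [_ _|_ /= /andP[oa _]].
    exact: leqW (le_q 0 (leq0n J)).
  exact: leqW (lab_le H oa).
- move=> a; rewrite ho hl /upd; case: (a =P R) => [_ _|_ /= /andP[oa na]].
    apply/negP => /hp[|e|[j hj e]].
    + exact/negP/(lab_notin H (descent_on D (leq0n J))).
    + by have := le_q 0 (leq0n J); rewrite /= e ltnn.
    + by have := @q_inj 0 j (leq0n _) _ e (q0 0 (leq0n J)); lia.
  apply/negP => /hp[|e|[j hj e]].
  + exact/negP/(lab_notin H oa).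
  + by have := lab_le H oa; rewrite e ltnn.
  + have lt : j < J by lia.
    by have := kept_notin oa na lt (q0 j (ltnW lt)); rewrite e eqxx.
- have c0 := le_q 0 (leq0n J).
  move=> a b; rewrite !ho hl /upd.
  case: (a =P R) => [->|_]; case: (b =P R) => [->|_] //=.
  + move=> _ /andP[ob nb] e; have := kept_notin ob nb J0 (q0 0 (leq0n J)).
    by rewrite /= e eqxx.
  + move=> /andP[oa na] _ e; have := kept_notin oa na J0 (q0 0 (leq0n J)).
    by rewrite /= e eqxx.
  + by move=> /andP[oa _] /andP[ob _]; apply: (lab_inj H).
- move=> v /hp[/(lab_pushed H)|->|[j hj ->]]; [lia|by rewrite ltnSn|].
  have jJ : j <= J by lia.
  by have := le_q j jJ; have := q0 j jJ; rewrite /=; lia.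
- apply: covered_step (lab_covered H) _ _ => x hx; first by rewrite mid // q0.
  by rewrite out.
- move=> col c3 /hk[lk n0 nJ lks] sep'.
  have newC j : j <= J -> col (q j) != col t.+1.
    move=> jJ; case: (posnP j) => [->|j0]; first by rewrite eq_sym.
    have [lt|ge] := ltnP j J; first by have [] := lks j; rewrite ?j0.
    have -> : j = J by lia.
    by rewrite eq_sym.
  have stepC' j : j.+1 < J -> col (q j.+1) != col (q j).
    by move=> jJ; have [] := lks j.+1.
  have stepC j : j < J -> col (q j.+1) != col (q j).
    rewrite leq_eqVlt => /orP[/eqP jJ|]; last exact: stepC'.
    have := @alternate col q (col t.+1) j c3 _ (c3 _) _.
    have -> : ~~ odd j by move: oddJ; rewrite -jJ.
    move=> /(_ _ _)/eqP ->; last 2 first.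
    + by move=> i ij; apply: newC; lia.
    + by move=> i ij; apply: stepC'; lia.
    rewrite jJ; have := sep' R.-1; rewrite prednK // mid; last by lia.
    have [_ eR] := runs_right rn; rewrite high // eR; apply; try exact: q0.
    apply/eqP => e; have := @q_inj J 0 (leqnn J) (leq0n J) e (q0 J (leqnn J)).
    by lia.
  have sep : separated phi col.
    apply: (separated_back rn (fun j h _ _ => stepC j h) _ _ _ _ sep') => x hx.
    - by rewrite low.
    - by rewrite high.
    - by rewrite !low //; lia.
    - by rewrite !high //; lia.
  have [pa te] := lab_tells H c3 lk sep; split=> //.
  apply: (tells_step rn (fun j h _ => newC j h) (lab_covered H) _ _ te) => x hx; first
    by rewrite out.
  by have [j jJ ->] := runs_in rn hx; move/eqP; rewrite (negbTE (q0 j jJ)).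
Qed.

(** An odd number of labels is met, and all are linked to their right
    neighbours, so that the alternation gives the same colour to q 0 and q J.
    The two blocks and what is between them become one block of the label q 0,
    and q J can be pushed. *)
Lemma labelled_even : ~~ odd J -> (forall j, j <= J -> q j != 0) ->
  (forall a, on' a = on a && ~~ (ka J < a < R)) ->
  lb' = upd lb (ka J) (q 0) ->
  (forall v, v \in pushed st' -> [\/ v \in pushed st, v = t.+1 |
     exists2 j, 0 < j <= J & v = q j]) ->
  (forall col, linked col st' -> [/\ linked col st,
     col t.+1 != col (q 0) &
     forall j, 0 < j <= J -> col (q j) != col t.+1 /\ col (q j) != col (q j.-1)]) ->
  labelled t.+1 on' lb' st'.
Proof.
move=> evJ q0 ho hl hp hk; have rn := step_runs.
have [/andP[L0 Lm] /andP[R0 Rm]] := rank_range tN.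
have oJ := descent_on D (leqnn J).
have le_q j : j <= J -> q j <= t by move=> jJ; apply: (lab_le H (descent_on D jJ)).
have lbJ : lb' (ka J) = q 0 by rewrite hl /upd eqxx.
have lbo a : a != ka J -> lb' a = lb a by move=> /negbTE aR; rewrite hl /upd aR.
have oJ' : on' (ka J) by rewrite ho oJ ltnn.
have other a : on a -> ~~ (ka J < a < R) -> a != ka J -> lb a != q 0.
  move=> oa na ne; case: (posnP J) => [z|J0]; last exact: (kept_notin oa na J0 (q0 0
    (leq0n J))).
  apply: contra ne => /eqP e; apply/eqP/(lab_inj H oa oJ); rewrite e ?z //.
  exact: q0.
have low x : x < L -> phi' x = if last_key on x == ka J then q 0 else phi x.
  by move=> xL; rewrite /label_at phi_low // hl /upd.
have high x : R <= x -> phi' x = phi x.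
  move=> xR; rewrite /label_at; have [ok le mx] := last_keyP x (lab_on0 H).
  have lJR : ka J < R by lia.
  have [lt|ge] := ltnP R (last_key on x).
    rewrite (@last_keyE on' x (last_key on x)) ?ho ?ok //=; first by apply: lbo; lia.
      by lia.
    by move=> j; rewrite ho => /andP[oj _]; apply: mx.
  have lt : last_key on x < R.
    rewrite ltn_neqAle ge andbT; apply/eqP => e.
    by have := not_on_R; rewrite -e ok.
  have [[l0 k0 m0] _] := D.
  have -> : last_key on x = ka 0 by apply/eqP; rewrite eqn_leq m0 // mx //; lia.
  rewrite (@last_keyE on' x (ka J)) //; first by lia.
  move=> j; rewrite ho => /andP[oj nj] jx; rewrite leqNgt; apply/negP => gt.
  by have := mx j oj jx; lia.
have mid x : L <= x < R -> phi' x = q 0.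
  move=> hx; rewrite /label_at (@last_keyE on' x (ka J)) //; first by lia.
  by move=> j; rewrite ho => /andP[oj nj] jx; lia.
have nz x : ~~ (L <= x < R) -> (phi' x != 0) = (phi x != 0).
  move=> hx; have [xL|xL] := ltnP x L; last by rewrite high //; lia.
  rewrite low //; case: (last_key on x =P ka J) => // e.
  by rewrite (q0 0 (leq0n J)) /label_at e (q0 J (leqnn J)).
split=> //.
- by rewrite ho (lab_on0 H).
- move=> a; rewrite ho => /andP[oa _] a0.
  by have [i it e] := lab_key H oa a0; exists i => //; apply: ltnW.
- move=> a; rewrite ho hl /upd => /andP[oa _]; case: (a =P ka J) => _.
    exact: leqW (le_q 0 (leq0n J)).
  exact: leqW (lab_le H oa).
- move=> a; rewrite ho => /andP[oa na]; have [e|ne] := eqVneq a (ka J).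
    rewrite e lbJ; apply/negP => /hp[|e'|[j hj e']].
    + exact/negP/(lab_notin H (descent_on D (leq0n J))).
    + by have := le_q 0 (leq0n J); rewrite /= e' ltnn.
    + by have := @q_inj 0 j (leq0n _) _ e' (q0 0 (leq0n J)); lia.
  rewrite lbo //; apply/negP => /hp[|e'|[j hj e']].
  + exact/negP/(lab_notin H oa).
  + by have := lab_le H oa; rewrite e' ltnn.
  + have [lt|ge] := ltnP j J.
      by have := kept_notin oa na lt (q0 j (ltnW lt)); rewrite e' eqxx.
    have jE : j = J by lia.
    case/eqP: ne; apply: (lab_inj H oa oJ); rewrite e' jE //.
    exact: q0.
- move=> a b; rewrite !ho => /andP[oa na] /andP[ob nb].
  have [->|nea] := eqVneq a (ka J); have [->|neb] := eqVneq b (ka J) => //.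
  + by rewrite lbJ lbo // => e; have := other b ob nb neb; rewrite /= e eqxx.
  + by rewrite lbJ lbo // => e; have := other a oa na nea; rewrite /= e eqxx.
  + by rewrite !lbo //; apply: (lab_inj H).
- move=> v /hp[/(lab_pushed H)|->|[j hj ->]]; [lia|by rewrite ltnSn|].
  have jJ : j <= J by lia.
  by have := le_q j jJ; have := q0 j jJ; rewrite /=; lia.
- apply: covered_step (lab_covered H) _ _ => x hx; first by rewrite mid // q0.
  exact: nz.
- move=> col c3 /hk[lk n0 lks] sep'.
  have newC j : j <= J -> col (q j) != col t.+1.
    move=> jJ; case: (posnP j) => [->|j0]; first by rewrite eq_sym.
    by have [] := lks j; rewrite ?j0.
  have stepC j : j < J -> col (q j.+1) != col (q j).
    by move=> jJ; have [] := lks j.+1.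
  have ends : col (q J) = col (q 0).
    by have := @alternate col q (col t.+1) J c3 newC (c3 _) stepC; rewrite evJ => /eqP.
  have same x : ~~ (L <= x < R) -> col (phi' x) = col (phi x).
    move=> hx; have [xL|xL] := ltnP x L; last by rewrite high //; lia.
    by rewrite low //; case: (last_key on x =P ka J) => // e; rewrite /label_at e ends.
  have sep : separated phi col.
    apply: (separated_back rn (fun j h _ _ => stepC j h) _ _ _ _ sep') => x hx.
    - by rewrite nz ?same //; lia.
    - by rewrite nz ?same //; lia.
    - have keep y : y < L -> last_key on y != ka J -> phi y != q 0.
        have [ok le _] := last_keyP y (lab_on0 H).
        by move=> yL ne; apply: other => //; apply/negP => /(between ok); lia.
      rewrite !low //; last by lia.
      have [e|ne] := eqVneq (last_key on x) (ka J);
        have [e'|ne'] := eqVneq (last_key on x.+1) (ka J) => //.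
      + by rewrite /label_at e e' eqxx.
      + by move=> _; rewrite eq_sym; apply: keep.
      + by move=> _; apply: keep => //; lia.
    - by rewrite !high //; lia.
  have [pa te] := lab_tells H c3 lk sep; split=> //.
  apply: (tells_step rn (fun j h _ => newC j h) (lab_covered H) _ _ te) => x hx; first
    by rewrite nz // same.
  by have [j jJ ->] := runs_in rn hx; move/eqP; rewrite (negbTE (q0 j jJ)).
Qed.

End Step.
End Labelled.

(** * Inserting an interval, three colours *)

Notation vJ := 15 (only parsing).
Notation vE := 16 (only parsing).
Notation vY := 17 (only parsing).
Notation Que := 9 (only parsing).

(** Reads the labels met from right to left into the array Que and deletes
    their keys. In the end vJ is the index of the last label and vE its
    parity; vG - 1 is the index of the leftmost 0, and vG = 0 if there is
    none. *)
Definition collect : com := (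
  vQ ::= vR;; find_pred;;
  vJ ::= Cst 0;; vE ::= Cst 0;; Put Que vJ Lab.[vP];;
  If (Lab.[vP] < Cst 1) (vG ::= Cst 1) (vG ::= Cst 0);;
  While (vL < vP) (
    vQ ::= vP;; delete_key;; find_pred;;
    vJ ::= vJ + Cst 1;; vE ::= Cst 1 - vE;; Put Que vJ Lab.[vP];;
    If (Lab.[vP] < Cst 1) (vG ::= vJ + Cst 1) Skip))%code.

(** Both loops link each label to a neighbour that they treat later or never,
    which keeps the stack acyclic. *)
Definition link_up : com := (
  vX ::= vG;;
  While (vX < vJ) (
    push Que.[vX] Que.[vX + Cst 1] (vT + Cst 1);;
    vX ::= vX + Cst 1))%code.

Definition link_down : com := (
  vX ::= vY;;
  While (Cst 1 < vX) (
    vX ::= vX - Cst 1;;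
    If (Cst 0 < Que.[vX])
      (push Que.[vX] Que.[vX - Cst 1] (vT + Cst 1)) Skip))%code.

Definition add_block (key lab : expr) : com :=
  (vQ ::= key;; insert_key;; Put Lab vQ lab)%code.

Definition step3 : com := (
  collect;;
  If (Cst 0 < vG) (
    link_up;; vY ::= vG - Cst 1;; link_down;;
    add_block vL (vT + Cst 1);; add_block vR Que.[Cst 0])
  (If (Cst 0 < vE) (
    vY ::= vJ;; link_down;;
    push (vT + Cst 1) Que.[Cst 0] Que.[vJ];;
    add_block vR Que.[Cst 0])
  (vY ::= vJ + Cst 1;; link_down;;
    push (vT + Cst 1) Que.[Cst 0] Que.[Cst 0];;
    Put Lab vP Que.[Cst 0])))%code.

Lemma setv_same s x : setv s x (vr s x) = s.
Proof.
case: s => v a o c; congr MkStore; apply: functional_extensionality => y.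
by rewrite /= /upd; case: eqP => [->|].
Qed.

Lemma keys_ok_ext h s (on on' : pred nat) : on =1 on' -> keys_ok h s on -> keys_ok h s
  on'.
Proof. by move=> e [h1 h2 h3]; split=> //; apply: tree_ok_ext h3 => u _; apply: e. Qed.

Section StepThree.
Variables (n : nat) (cmp : nat -> nat -> bool) (h N : nat) (lf rt : nat -> nat).
Local Notation m := (N + N).
Hypothesis m_lt : m < 2 ^ h.
Local Notation wp := (wp n cmp).

(** The keys that are left after the labels between p and R have been read. *)
Definition cleared (on : pred nat) p R : pred nat :=
  fun a => on a && ~~ (p < a < R).

(** The value g of vG, for the labels q 0, ..., q J. *)
Definition marks (q : nat -> nat) J g :=
  if g is g'.+1 then [/\ g' <= J, q g' = 0 & forall j, g' < j <= J -> q j != 0]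
  else forall j, j <= J -> q j != 0.

Lemma marks_ext q q' J g : (forall j, j <= J -> q j = q' j) ->
  marks q J g -> marks q' J g.
Proof.
move=> e; case: g => [|g] /=; first by move=> h1 j hj; rewrite -e // h1.
by move=> [h1 h2 h3]; split=> // [|j hj]; rewrite -e ?h2 //; [apply: h3|lia].
Qed.

Lemma marksS q J g : marks q J g ->
  marks q J.+1 (if q J.+1 == 0 then J.+2 else g).
Proof.
case: eqP => [e _|/eqP ne] /=; first by split=> // j; lia.
case: g => [|g] /=.
  by move=> h1 j; rewrite leq_eqVlt => /orP[/eqP->|/h1].
move=> [h1 h2 h3]; split=> // [|j]; first by apply: leqW.
by move=> /andP[gj]; rewrite leq_eqVlt => /orP[/eqP->//|jJ]; apply: h3; rewrite gj.
Qed.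

Definition collected s0 s (on : pred nat) L R ka J : Prop :=
  [/\ descent on R ka J /\ (forall j, j < J -> L < ka j),
     vr s vP = ka J /\ vr s vJ = J /\ vr s vE = odd J,
     (forall j, j <= J -> ar s Que j = ar s0 Lab (ka j)) /\ marks (ar s Que) J (vr s vG),
     keys_ok h s (cleared on (ka J) R) &
     ck s <= ck s0 + h.+1 + (2 * h + 2) * J /\
     nkeys m.+1 (cleared on (ka J) R) + J = nkeys m.+1 on].

Lemma nkeys_eq k (on on' : pred nat) : on =1 on' -> nkeys k on = nkeys k on'.
Proof. by move=> e; apply: eq_count. Qed.

Lemma collect_ok s0 (on : pred nat) : let L := vr s0 vL in let R := vr s0 vR in
  keys_ok h s0 on -> on 0 -> ~~ on L -> (forall a, on a -> a <= m) -> 0 < L < R -> R <=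
    m ->
  wp collect (fun s => [/\ exists ka J, collected s0 s on L R ka J /\ ka J < L
    & frame collect s0 s]) s0.
Proof.
move=> L R kok o0 nL om /andP[L0 LR] Rm.
suff: wp collect (fun s => exists ka J, collected s0 s on L R ka J /\ ka J < L) s0.
  by move/wp_frame; apply=> s fr ?; split.
apply/wp_seq/wp_asg; rewrite /=; set s1 := setv _ _ _.
have eQ1 : vr s1 vQ = R by rewrite /s1 /= /upd.
have hR : 0 < vr s1 vQ < 2 ^ h.
  by rewrite eQ1 (leq_ltn_trans Rm m_lt); lia.
have k1 : keys_ok h s1 on by case: kok.
apply/wp_seq; apply: wp_imp (find_pred_ok n cmp k1 o0 hR) _.
move=> s2 [+ c2 [fv2 fa2]]; rewrite eQ1 => ip2; rewrite -[ck s1]/(ck s0) in c2.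
have k2 : keys_ok h s2 on.
  by have [a1 a2 a3] := k1; split; rewrite ?fv2 ?fa2.
have eL2 : vr s2 vL = L by rewrite fv2.
have eLab2 : ar s2 Lab = ar s0 Lab by rewrite fa2.
do 2 apply/wp_seq/wp_asg; apply/wp_seq/wp_put; rewrite /=.
set s3 := seta _ _ _ _; set p := vr s2 vP in ip2.
apply/wp_seq.
apply: (@wp_imp _ _ (fun s => s = setv s3 vG (if ar s0 Lab p == 0 then 1 else 0))).
  have eLp : eval n s3 Lab.[vP]%code = ar s0 Lab p.
    by rewrite /= /upd /= eLab2.
  by apply: wp_if; rewrite [teval _ _ _ _]/(eval n s3 Lab.[vP]%code < 1) eLp => hz;
    apply: wp_asg; congr setv => /=; case: (ar s0 Lab p) hz.
move=> s4 ->; set s5 := setv _ _ _.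
pose I k s := exists ka J, [/\ collected s0 s on L R ka J, k = ka J,
  vr s vL = L & ar s Lab = ar s0 Lab].
have clr0 a : on a -> ~~ (p < a < R).
  by move=> oa; have [_ _ mx] := ip2; have := mx a; rewrite oa; lia.
apply: (@wp_loop _ _ I _ _ _ p).
- exists (fun=> p), 0; split=> //.
  have same : on =1 cleared on p R.
    by move=> a; rewrite /cleared; case oa: (on a) => //=; rewrite clr0.
  split=> //.
  + rewrite /s5 /= /upd /= eLab2; split; first by case.
    by case: eqP => /= [e|e]; [split=> //; case | case=> // _; apply/eqP].
  + apply: keys_ok_ext same _; by case: k2.
  + rewrite muln0 !addn0 -(nkeys_eq _ same); split=> //.
- move=> k s [ka [J [[[D gt] [eP [eJ eE]] [eq mk] kc [le cnt]] -> eL eLb]]] /=.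
  rewrite eL eP => Lp; have oJ := descent_on D (leqnn J).
  apply/wp_seq/wp_asg; rewrite /=; set s6 := setv _ _ _.
  have kc6 : keys_ok h s6 (cleared on (ka J) R) by case: kc.
  have eQ6 : vr s6 vQ = ka J by rewrite /s6 /= /upd.
  have kM : ka J < 2 ^ h by apply: leq_ltn_trans m_lt; apply: om.
  apply/wp_seq; apply: wp_imp (@delete_ok n cmp h _ s6 kc6 _) _; first by rewrite eQ6.
  move=> s7 [+ c7 [fv7 fa7]]; rewrite eQ6 => k7; have {}c7 : ck s7 <= (ck s).+1 + h by
    exact: c7.
  have o7 : upd (cleared on (ka J) R) (ka J) false 0.
    by rewrite /upd /cleared o0 ifF //=; lia.
  apply/wp_seq; have eQ7 : vr s7 vQ = ka J by rewrite fv7.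
  apply: wp_imp (find_pred_ok n cmp k7 o7 _) _; first by rewrite eQ7 kM; lia.
  move=> s8 [+ c8 [fv8 fa8]]; rewrite eQ7 => ip8; set p' := vr s8 vP in ip8.
  have ip : is_pred on (ka J) p'.
    have [l1 o1 m1] := ip8; split=> //.
      by move: o1; rewrite /upd /cleared; case: eqP => // _ /andP[].
    move=> u lu ou; apply: m1 => //; rewrite /upd /cleared ou ifF /=; lia.
  have [ltp op mx] := ip.
  have ltR : ka J < R := descent_ltR D (leqnn J).
  have same : upd (cleared on (ka J) R) (ka J) false =1 cleared on p' R.
    move=> a; rewrite /upd /cleared; case: eqP => [->|na]; first by rewrite ltp ltR andbF.
    case oa: (on a) => //=; have [lt|ge] := ltnP a (ka J); last by congr (~~ _); lia.
    by have := mx a lt oa; lia.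
  do 2 apply/wp_seq/wp_asg; apply/wp_seq/wp_put; rewrite /=.
  set s9 := seta _ _ _ _.
  have eJ9 : vr s9 vJ = J.+1 by rewrite /s9 /= /upd /= fv8 // fv7 //= /upd /= eJ addn1.
  have eG9 : vr s9 vG = vr s vG by rewrite /s9 /= /upd /= fv8 // fv7.
  have eLb9 : ar s9 Lab = ar s0 Lab by rewrite /s9 /= /upd /= fa8 // fa7 //= -eLb.
  have eP9 : vr s9 vP = p' by [].
  have eQue9 j : ar s9 Que j = if j == J.+1 then ar s0 Lab p' else ar s Que j.
    rewrite /s9 /= /upd /= fa8 // fa7 // fa8 // fa7 //= eLb fv8 // fv7 //= /upd /= eJ
      addn1.
    by case: eqP.
  apply: (@wp_imp _ _ (fun s' => s' = setv s9 vG (if ar s0 Lab p' == 0 then J.+2 else vr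
    s vG))).
    have eLp : eval n s9 Lab.[vP]%code = ar s0 Lab p'.
      by transitivity (ar s9 Lab (vr s9 vP)); rewrite // eLb9.
    apply: wp_if; rewrite [teval _ _ _ _]/(eval n s9 Lab.[vP]%code < 1) eLp => hz.
      apply: wp_asg.
      have -> : eval n s9 (vJ + Cst 1)%code = J.+2.
        by transitivity (vr s9 vJ + 1); rewrite // eJ9 addn1.
      by congr setv; case: (ar s0 Lab p') hz.
    apply: wp_skip; rewrite ifF; last by case: (ar s0 Lab p') hz.
    by rewrite -eG9 setv_same.
  move=> s10 ->; exists p' => //.
  exists (upd ka J.+1 p'), J.+1.
  have updE j : j <= J -> upd ka J.+1 p' j = ka j by rewrite /upd => jJ; rewrite ifF //;
    lia.
  have updJ : upd ka J.+1 p' J.+1 = p' by rewrite /upd eqxx.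
  split; rewrite ?updJ //; last by rewrite /= /upd /= fv8 // fv7.
  split; rewrite ?updJ.
  + have [D0 D1] := D; split; first split; first by rewrite updE.
      move=> j; rewrite ltnS => jJ; rewrite updE //.
      case: (ltnP j J) => [lt|ge]; first by rewrite updE //; apply: D1.
      have -> : j = J by lia.
      by rewrite updJ.
    move=> j; rewrite ltnS => jJ; rewrite updE //.
    case: (ltnP j J) => [/gt//|ge]; have -> : j = J by lia.
    by [].
  + split=> //; split; first by rewrite [LHS]eJ9.
    by rewrite /= /upd /= fv8 // fv7 //= /upd /= eE; case: (odd J).
  + split.
      move=> j jJ; rewrite [LHS]eQue9; case: eqP => [->|ne]; first by rewrite updJ.
      by rewrite updE ?eq //; lia.
    have eqJ : ar s9 Que J.+1 = ar s0 Lab p' by rewrite eQue9 eqxx.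
    suff : marks (ar s9 Que) J.+1 (if ar s9 Que J.+1 == 0 then J.+2 else vr s vG).
      by rewrite eqJ.
    apply: marksS; apply: marks_ext mk => j jJ; rewrite eQue9 ifF //; lia.
  + by apply: (keys_ok_ext same); have [a1 a2 a3] := k7; split; rewrite /= /upd /= ?fv8
      ?fa8.
  + have {}c8 : ck s8 <= ck s7 + h.+1 by [].
    split; first by rewrite -[ck _]/(ck s8) mulnS; lia.
    rewrite -(nkeys_eq _ same) -cnt addnS -addSn nkeys_del //; first by rewrite ltnS om.
    by rewrite /cleared oJ ltnn.
- move=> k s [ka [J [co _ eL eLb]]] /= nlt; exists ka, J; split=> //; move: nlt.
  have [[D gt] [eP _] _ [k3 _ _] _] := co; rewrite eL eP.
  have oJ := descent_on D (leqnn J).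
  rewrite -leqNgt leq_eqVlt => /orP[/eqP e|//].
  by rewrite -e oJ in nL.
Qed.
(** What a loop of pushes achieves: P tells the indices already treated, and f
    the neighbour that a label is linked to, besides the new one. *)
Definition chained t (q f : nat -> nat) (P : nat -> Prop) st st' : Prop :=
  [/\ acyclic st',
    forall v, v \in pushed st' -> v \in pushed st \/
      exists j, [/\ P j, q j != 0 & v = q j]
  & forall col, linked col st' -> linked col st /\
      forall j, P j -> q j != 0 -> col (q j) != col t.+1 /\ col (q j) != col (q (f j))].

Lemma chained_push t q f (P P' : nat -> Prop) st st' j : chained t q f P st st' ->
  q j != 0 -> t.+1 \notin pushed st -> q j <= t ->
  q j \notin pushed st -> q (f j) \notin pushed st ->
  (forall i, P i -> q i <= t /\ q i != q j /\ (q i = q (f j) -> q i = 0)) ->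
  q j != q (f j) ->
  (forall i, P' i <-> P i \/ i = j) ->
  chained t q f P' st ((q j, q (f j), t.+1) :: st').
Proof.
move=> [ac pu lk] n0 tn jt nj nf sep ne hP.
have fresh v : v \notin pushed st -> (forall i, P i -> q i != 0 -> v != q i) -> v \notin
  pushed st'.
  move=> h1 h2; apply/negP => /pu[|[i [Pi ni e]]]; first exact/negP.
  by have := h2 i Pi ni; rewrite e eqxx.
split=> /=.
- rewrite !inE !negb_or ac andbT eq_sym ne /= !fresh //=; first by rewrite andbT; lia.
  + by move=> i Pi _; have [le _] := sep i Pi; lia.
  + move=> i Pi ni; have [_ [_ z]] := sep i Pi; apply/eqP => e.
    by rewrite z ?eqxx // in ni.
  + by move=> i Pi _; have [_ [nij _]] := sep i Pi; rewrite eq_sym.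
- move=> v; rewrite inE => /orP[/eqP->|/pu[|[i [Pi ni ->]]]].
  + by right; exists j; split=> //; apply/hP; right.
  + by left.
  + by right; exists i; split=> //; apply/hP; left.
- move=> col /andP[/andP[c1 c2] /lk[l1 l2]]; split=> // i /hP[|->] // ; exact: l2.
Qed.

Lemma chained0 t q f (P : nat -> Prop) st : acyclic st -> (forall j, ~ P j) ->
  chained t q f P st st.
Proof.
move=> ac nP; split=> // [v|col lk]; first by left.
by split=> // j /nP.
Qed.

Lemma chained_skip t q f (P P' : nat -> Prop) st st' j : chained t q f P st st' ->
  q j = 0 -> (forall i, P' i <-> P i \/ i = j) -> chained t q f P' st st'.
Proof.
move=> [ac pu lk] z hP; split=> // [v /pu[|[i [Pi ni e]]]|col /lk[l1 l2]].
- by left.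
- by right; exists i; split=> //; apply/hP; left.
- by split=> // i /hP[|->]; [exact: l2|rewrite z].
Qed.

Lemma chained_iff t q f (P P' : nat -> Prop) st st' : chained t q f P st st' ->
  (forall i, P' i <-> P i) -> chained t q f P' st st'.
Proof.
move=> [ac pu lk] hP; split=> // [v /pu[|[i [Pi ni e]]]|col /lk[l1 l2]].
- by left.
- by right; exists i; split=> //; apply/hP.
- by split=> // i /hP; exact: l2.
Qed.

Section Links.
Variables (t J : nat) (q : nat -> nat) (st : seq link).
Hypothesis q_le : forall j, j <= J -> q j <= t.
Hypothesis q_inj : forall i j, i <= J -> j <= J -> q i = q j -> q i != 0 -> i = j.
Hypothesis q_notin : forall j, j <= J -> q j \notin pushed st.
Hypothesis st_le : forall v, v \in pushed st -> 0 < v <= t.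
Hypothesis st_ac : acyclic st.

Lemma t_notin : t.+1 \notin pushed st.
Proof. by apply/negP => /st_le; lia. Qed.

Lemma link_down_ok s : stack_of s = st -> ar s Que = q -> vr s vT = t ->
  vr s vY <= J.+1 ->
  wp link_down (fun s' => [/\ chained t q predn (fun j => 0 < j < vr s vY) st (stack_of
    s'),
     ck s' <= ck s + vr s vY & frame link_down s s']) s.
Proof.
move=> eS eq eT; set Y := vr s vY => hY.
suff: wp link_down (fun s' => chained t q predn (fun j => 0 < j < Y) st (stack_of s') /\
     ck s' <= ck s + Y) s.
  by move/wp_frame; apply=> s' fr []; split.
apply/wp_seq/wp_asg; rewrite /=.
pose I k s' := [/\ chained t q predn (fun j => k <= j < Y) st (stack_of s'),
  ar s' Que = q, vr s' vT = t, vr s' vX = k & [/\ k <= Y, 0 < k \/ Y = 0 & ck s' + k <=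
    ck s + Y]].
apply: (@wp_loop _ _ I _ _ _ Y).
- split=> //; last by split=> //; lia.
  by rewrite -[stack_of _]/(stack_of s) eS; apply: chained0 => // j; lia.
- move=> k s1 [ch e1 e2 eX [kY k0 eck]] /=; rewrite eX => k1.
  apply/wp_seq/wp_asg; rewrite /= eX subn1; set s2 := setv _ _ _.
  have hP i : (k.-1 <= i < Y) <-> (k <= i < Y) \/ i = k.-1 by lia.
  apply: wp_if => /=; rewrite /upd /= e1 => c.
    apply: wp_imp (@push_ok n cmp s2 Que.[vX]%code Que.[vX - Cst 1]%code (vT + Cst
      1)%code isT isT isT) _.
    move=> s3 [+ c3 fv fa]; rewrite /= /upd /= e1 e2 subn1 addn1 -[stack_of
      s2]/(stack_of s1).
    move=> eS3; exists k.-1; first lia.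
    split; rewrite ?fv ?fa //; last by split; [lia|lia|rewrite c3; move: eck; rewrite
      /=; lia].
    rewrite eS3; apply: (chained_push (P := fun j => k <= j < Y) (j := k.-1) (f :=
      predn)) => //.
    + by rewrite -lt0n.
    + exact: t_notin.
    + by apply: q_le; lia.
    + by apply: q_notin; lia.
    + by apply: q_notin; lia.
    + move=> i hi; split; first by apply: q_le; lia.
      split; first by apply/eqP => e; have := q_inj (i := i) (j := k.-1); rewrite e; lia.
      by move=> e; apply/eqP/negPn/negP => ni; have := q_inj (i := i) (j := k.-2); lia.
    + by apply/eqP => e; have := q_inj (i := k.-1) (j := k.-2); lia.
  apply: wp_skip; exists k.-1; first by lia.
  split=> //; last by split; [lia|lia|move: eck; rewrite /=; lia].
  by apply: chained_skip ch _ hP; lia.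
move=> k s1 [ch e1 e2 eX [kY k0 eck]] /=; rewrite eX => k1; split; last by lia.
by apply: chained_iff ch _ => i; lia.
Qed.

Lemma link_up_ok s : stack_of s = st -> ar s Que = q -> vr s vT = t ->
  vr s vJ = J -> let G := vr s vG in (forall j, G <= j <= J -> q j != 0) ->
  wp link_up (fun s' => [/\ chained t q succn (fun j => G <= j < J) st (stack_of s'),
     ck s' <= ck s + J & frame link_up s s']) s.
Proof.
move=> eS eq eT eJ G nz.
suff: wp link_up (fun s' => chained t q succn (fun j => G <= j < J) st (stack_of s') /\
     ck s' <= ck s + J) s.
  by move/wp_frame; apply=> s' fr []; split.
apply/wp_seq/wp_asg; rewrite /=.
pose I d s' := exists k, [/\ chained t q succn (fun j => G <= j < k) st (stack_of s'),
  ar s' Que = q, vr s' vT = t, vr s' vX = k & [/\ G <= k, d = J - k, vr s' vJ = J & ck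
    s' + d <= ck s + J /\ (k <= J \/ k = G)]].
apply: (@wp_loop _ _ I _ _ _ (J - G)).
- exists G; split=> //; last by split=> //=; split; [lia|right].
  by rewrite -[stack_of _]/(stack_of s) eS; apply: chained0 => // j; lia.
- move=> d s1 [k [ch e1 e2 eX [kG dk e3 [eck kJ]]]] /=; rewrite eX e3 => k1.
  have hP i : (G <= i < k.+1) <-> (G <= i < k) \/ i = k by lia.
  apply/wp_seq; apply: wp_imp (@push_ok n cmp (tick s1) Que.[vX]%code Que.[vX + Cst
    1]%code (vT + Cst 1)%code isT isT isT) _.
  move=> s3 [+ c3 fv fa]; rewrite /= e1 e2 eX !addn1 -[stack_of (tick s1)]/(stack_of s1).
  move=> eS3; apply: wp_asg; rewrite /= fv // eX addn1.
  exists (J - k.+1); first lia.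
  exists k.+1; split; rewrite /= /upd /= ?fv ?fa //; last first.
    by split=> //; [lia|split; [rewrite c3; move: eck; rewrite /=; lia|lia]].
  rewrite -[stack_of (setv _ _ _)]/(stack_of s3) eS3.
  apply: (chained_push (P := fun j => G <= j < k) (j := k) (f := succn)) => //.
  + by apply: nz; lia.
  + exact: t_notin.
  + by apply: q_le; lia.
  + by apply: q_notin; lia.
  + by apply: q_notin; lia.
  + move=> i hi; split; first by apply: q_le; lia.
    split; first by apply/eqP => e; have := q_inj (i := i) (j := k); have := nz i; lia.
    by move=> e; have := q_inj (i := i) (j := k.+1); have := nz i; lia.
  + by apply/eqP => e; have := q_inj (i := k) (j := k.+1); have := nz k; lia.
move=> d s1 [k [ch e1 e2 eX [kG dk e3 [eck kJ]]]] /=; rewrite eX e3 => k1; split; last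
  by lia.
by apply: chained_iff ch _ => i; lia.
Qed.
End Links.
Hypothesis rank_range : forall i, i < N -> 0 < lf i <= m /\ 0 < rt i <= m.
Hypothesis rank_neq : forall i j, i < N -> j < N -> lf i <> rt j.
Hypothesis lf_inj : forall i j, i < N -> j < N -> lf i = lf j -> i = j.
Hypothesis rt_inj : forall i j, i < N -> j < N -> rt i = rt j -> i = j.

Variable past : (nat -> nat) -> Prop.

Definition inv3 t s on : Prop :=
  keys_ok h s on /\ labelled lf rt past t on (ar s Lab) (stack_of s).

Lemma add_block_ok s (on : pred nat) (key lab : expr) : keys_ok h s on ->
  eval n s key <= m ->
  (forall s', vr s' vT = vr s vT -> ar s' Que = ar s Que -> eval n s' lab = eval n s
    lab) ->
  wp (add_block key lab) (fun s' => [/\ keys_ok h s' (upd on (eval n s key) true),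
    ar s' Lab = upd (ar s Lab) (eval n s key) (eval n s lab),
    stack_of s' = stack_of s /\ ck s' <= ck s + h,
    forall x, x \notin [:: vQ; vV; vK; vA; vB] -> vr s' x = vr s x &
    forall A, A \notin [:: Tree; Lab] -> ar s' A = ar s A]) s.
Proof.
move=> kok km stable; set k := eval n s key.
apply/wp_seq/wp_asg; rewrite /= -/k; set s1 := setv _ _ _.
have k1 : keys_ok h s1 on by case: kok.
have eQ1 : vr s1 vQ = k by rewrite /s1 /= /upd.
apply/wp_seq; apply: wp_imp (@insert_ok n cmp h on s1 k1 _) _.
  by rewrite eQ1 (leq_ltn_trans km m_lt).
move=> s2 [+ c2 [fv2 fa2]]; rewrite eQ1 => k2; have {}c2 : ck s2 <= ck s + h by exact: c2.
apply: wp_put; rewrite /= fv2 // eQ1 stable ?fv2 ?fa2 //; set s3 := seta _ _ _ _.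
have [a1 a2 a3] := k2; split=> //.
- split=> //; rewrite /stack_of /s3 /= /upd /= fv2 //= /upd /=.
  by congr rev; apply: eq_map => j; rewrite !fa2.
- move=> x; rewrite !inE !negb_or => /and5P[x1 x2 x3 x4 x5].
  by rewrite /s3 /= fv2 /= ?inE ?negb_or ?x2 ?x3 ?x4 ?x5 //= /upd (negbTE x1).
- move=> A; rewrite !inE !negb_or => /andP[A1 A2].
  by rewrite /s3 /= /upd /= (negbTE A2) fa2 //= !inE (negbTE A1).
Qed.

Variable t : nat.
Hypothesis tN : t < N.

Lemma step3_ok s on : inv3 t s on -> vr s vT = t -> vr s vL = lf t ->
  vr s vR = rt t -> lf t < rt t ->
  wp step3 (fun s' => exists2 on', inv3 t.+1 s' on' &
    ck s' + weight h * nkeys m.+1 on' <= ck s + weight h * (nkeys m.+1 on + 4) /\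
    ((exists2 x, lf t <= x < rt t & label_at on (ar s Lab) x = 0) ->
     forall x, lf t <= x < rt t -> label_at on' (ar s' Lab) x = t.+1)) s.
Proof.
move=> [kok lab] eT eL eR LR; have [/andP[L0 Lm] /andP[R0 Rm]] := rank_range tN.
have o0 := lab_on0 lab.
have nL : ~~ on (lf t) by apply: (not_on_L rank_range rank_neq lf_inj tN LR lab).
have onm a : on a -> a <= m.
  move=> oa; case: (posnP a) => [->//|a0]; have [i it [->|->]] := lab_key lab oa a0.
    by have [/andP[]] := rank_range (ltn_trans it tN).
  by have [_ /andP[]] := rank_range (ltn_trans it tN).
set lb := ar s Lab in lab *; set st := stack_of s in lab.
apply/wp_seq; apply: wp_imp (@collect_ok s on kok o0 _ onm _ _) _; rewrite ?eL ?eR ?L0 //.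
move=> s1 [[ka [J [[[D gt] [eP1 [eJ1 eE1]] [eq1 mk] k1 [c1 cnt]] kaL]]] [fv1 fa1]].
set q := fun j => lb (ka j) in eq1 *; set on1 := cleared on (ka J) (rt t) in k1 cnt.
have eL1 : vr s1 vL = lf t by rewrite fv1.
have eR1 : vr s1 vR = rt t by rewrite fv1.
have eT1 : vr s1 vT = t by rewrite fv1.
have eS1 : stack_of s1 = st by rewrite /stack_of !fa1 // fv1.
have eLb1 : ar s1 Lab = lb by rewrite fa1.
have qE j : j <= J -> ar s1 Que j = q j by exact: eq1.
have q_le j : j <= J -> ar s1 Que j <= t.
  by move=> jJ; rewrite qE //; apply: (lab_le lab (descent_on D jJ)).
have q_inj' i j : i <= J -> j <= J -> ar s1 Que i = ar s1 Que j -> ar s1 Que i != 0 -> i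
  = j.
  by move=> iJ jJ; rewrite !qE //; apply: (q_inj tN LR lab D).
have q_notin j : j <= J -> ar s1 Que j \notin pushed st.
  by move=> jJ; rewrite qE //; apply: (lab_notin lab (descent_on D jJ)).
have st_le := lab_pushed lab; have st_ac := lab_acyclic lab.
have mk' : marks q J (vr s1 vG) by apply: marks_ext mk.
have wJ : (2 * h + 4) * J <= weight h * J by rewrite leq_mul2r /weight; lia.
have n1 : nkeys m.+1 (upd on1 (rt t) true) <= (nkeys m.+1 on1).+1 by apply: nkeys_ins.
have runs1 := step_runs rank_range rank_neq lf_inj rt_inj tN LR lab D kaL gt.
apply: wp_if => /= cG.
- (* some cell of the interval is not covered yet *)
  case eG: (vr s1 vG) cG mk' => [//|g] _ [gJ qg nzg].
  apply/wp_seq; apply: wp_imp (@link_up_ok t J (ar s1 Que) st q_le q_inj' q_notin st_le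
    st_ac s1 eS1 erefl eT1 eJ1 _) _.
    by move=> j; rewrite eG => hj; rewrite qE ?nzg //; lia.
  move=> s2 [ch2 c2 [fv2 fa2]]; rewrite eG in ch2.
  have eQ2 : ar s2 Que = ar s1 Que by rewrite fa2.
  apply/wp_seq/wp_asg; rewrite /= fv2 // eG subn1 /=; set s3 := setv _ _ _.
  have [ac2 pu2 lk2] := ch2.
  have g1 : g.-1 <= J by lia.
  have notin2 j : j <= g.-1 -> ar s1 Que j \notin pushed (stack_of s2).
    move=> jg; apply/negP => /pu2[|[i [hi ni e]]].
      by apply/negP/q_notin; lia.
    by have := q_inj' j i; rewrite e ni; lia.
  have le2 v : v \in pushed (stack_of s2) -> 0 < v <= t.
    by move=> /pu2[/st_le//|[i [hi ni ->]]]; have := q_le i; lia.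
  apply/wp_seq; apply: wp_imp (@link_down_ok t g.-1 (ar s1 Que) (stack_of s2)
    (fun j h => q_le j (leq_trans h g1))
    (fun i j hi hj => q_inj' i j (leq_trans hi g1) (leq_trans hj g1)) notin2 le2 ac2
    s3 erefl eQ2 _ _) _.
  + by rewrite /s3 /= /upd /= fv2.
  + by rewrite /s3 /= /upd /=; lia.
  move=> s4 []; have -> : vr s3 vY = g by [].
  move=> [ac4 pu4 lk4] c4 [fv4 fa4].
  have {}c4 : ck s4 <= ck s2 + g by exact: c4.
  have k4 : keys_ok h s4 on1.
    have [a1 a2 a3] := k1; split; rewrite ?fv4 ?fa4 //= ?fa2 //.
    by rewrite /upd /= fv2.
  have eT4 : vr s4 vT = t by rewrite fv4 //= /upd /= fv2.
  have eL4 : vr s4 vL = lf t by rewrite fv4 //= /upd /= fv2.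
  have eR4 : vr s4 vR = rt t by rewrite fv4 //= /upd /= fv2.
  have eQ4 : ar s4 Que = ar s1 Que by rewrite fa4 //= fa2.
  have eLb4 : ar s4 Lab = lb by rewrite fa4 //= fa2.
  apply/wp_seq; apply: wp_imp (@add_block_ok s4 on1 vL (vT + Cst 1)%code k4 _ _) _.
  + by rewrite /= eL4.
  + by move=> s' e _; rewrite /= e.
  move=> s5; rewrite /= eL4 eT4 addn1 => [] [k5 eLb5 [eS5 c5] fv5 fa5].
  apply: wp_imp (@add_block_ok s5 _ vR Que.[Cst 0]%code k5 _ _) _.
  + by rewrite /= fv5 // eR4.
  + by move=> s' _ e; rewrite /= e.
  move=> s6; rewrite /= fv5 // eR4 (fa5 Que) // eQ4 eLb5 eLb4 qE //.
  move=> [k6 eLb6 [eS6 c6] fv6 fa6].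
  have [||||lab' gap] := @labelled_gap N lf rt rank_range rank_neq lf_inj rt_inj past t on
    (upd (upd on1 (lf t) true) (rt t) true) lb (ar s6 Lab) st (stack_of s6) ka J
    tN LR lab D kaL gt _ g gJ qg _ eLb6; rewrite ?eS6 ?eS5 //.
  + move=> a; rewrite /upd; case: (a =P rt t) => [_|_]; first by rewrite orbT.
    by case: (a =P lf t).
  + move=> v /pu4[/pu2[|[j [hj nj ->]]]|[j [hj nj ->]]]; first by left.
      by right; exists j; rewrite -/(q j) -qE //; [split=> //; lia|lia].
    by right; exists j; rewrite -/(q j) -qE //; [split=> //; lia|lia].
  + move=> col /lk4[/lk2[l0 lu] ld]; split=> // j hj nj; rewrite -/(q j) in nj *.
    rewrite -(qE j) in nj *; last by lia.
    have [lt|lt|e] := ltngtP j g.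
    * have [||d1 d2] := ld j => //; first by lia.
      by split=> // _; rewrite -/(q j.-1) -qE //; lia.
    * have [||d1 d2] := lu j => //; first by lia.
      by split=> // _; rewrite -/(q j.+1) -qE //; lia.
    * by move: nj; rewrite e qE // qg.
  exists (upd (upd on1 (lf t) true) (rt t) true); first by split.
  split; last by move=> _.
  have n2 : nkeys m.+1 (upd (upd on1 (lf t) true) (rt t) true) <= nkeys m.+1 on1 + 2.
    apply: leq_trans (nkeys_ins _ _) _; first by lia.
    by rewrite addn2 ltnS; apply: nkeys_ins; lia.
  have : weight h * nkeys m.+1 (upd (upd on1 (lf t) true) (rt t) true) <=
    weight h * (nkeys m.+1 on1 + 2) by rewrite leq_mul2l n2 orbT.
  rewrite -cnt !mulnDr; move: wJ; rewrite /weight; lia.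
- (* the labels of the whole interval are linked *)
  have {}mk' : forall j, j <= J -> q j != 0 by move: mk'; case: (vr s1 vG) cG.
  have nz j : j <= J -> ar s1 Que j != 0 by move=> jJ; rewrite qE ?mk'.
  have nogap : (exists2 x, lf t <= x < rt t & label_at on lb x = 0) -> False.
    case=> x hx e; have [j jJ] := runs_in runs1 hx; rewrite e => e'.
    by have := mk' j jJ; rewrite /q -e'.
  have top Y st' a : chained t (ar s1 Que) predn (fun j => 0 < j < Y) st st' ->
      Y <= J.+1 -> a <= J -> ~~ (0 < a < Y) -> ar s1 Que a \notin t.+1 :: pushed st'.
    move=> [_ pu _] YJ aJ aY; rewrite inE negb_or; apply/andP; split.
      by have := q_le a aJ; lia.
    apply/negP => /pu[|[i [hi ni e]]]; first exact/negP/q_notin.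
    by have := q_inj' a i; rewrite e ni; lia.
  have topt Y st' : chained t (ar s1 Que) predn (fun j => 0 < j < Y) st st' ->
      Y <= J.+1 -> t.+1 \notin pushed st'.
    move=> [_ pu _] YJ; apply/negP => /pu[/st_le|[i [hi ni e]]]; first by lia.
    by have := q_le i; lia.
  apply: wp_if => /=; rewrite eE1 => cE.
    have oJ : odd J by case: (odd J) cE.
    apply/wp_seq/wp_asg; rewrite /= eJ1; set s2 := setv _ _ _.
    apply/wp_seq; apply: wp_imp (@link_down_ok t J (ar s1 Que) st q_le q_inj' q_notin
      st_le st_ac
      s2 eS1 erefl eT1 (leqnSn J)) _.
    move=> s3 []; have -> : vr s2 vY = J by [].
    move=> ch3 c3 [fv3 fa3]; have {}c3 : ck s3 <= ck s1 + J by exact: c3.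
    have [ac3 pu3 lk3] := ch3.
    have eQ3 : ar s3 Que = ar s1 Que by rewrite fa3.
    have eT3 : vr s3 vT = t by rewrite fv3 //= /upd.
    have eJ3 : vr s3 vJ = J by rewrite fv3 //= /upd.
    apply/wp_seq; apply: wp_imp (@push_ok n cmp s3 (vT + Cst 1)%code Que.[Cst 0]%code
      Que.[vJ]%code isT isT isT) _.
    move=> s4; rewrite /= eQ3 eT3 eJ3 addn1 => [] [eS4 c4 fv4 fa4].
    have k4 : keys_ok h s4 on1.
      by have [a1 a2 a3] := k1; split; rewrite ?fv4 ?fa4 // ?fv3 ?fa3.
    have eR4 : vr s4 vR = rt t by rewrite fv4 // fv3 //= /upd.
    apply: wp_imp (@add_block_ok s4 on1 vR Que.[Cst 0]%code k4 _ _) _.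
    + by rewrite /= eR4.
    + by move=> s' _ e; rewrite /= e.
    move=> s5; rewrite /= eR4 !fa4 // eQ3 qE // fa3 //= eLb1.
    move=> [k5 eLb5 [eS5 c5] fv5 fa5].
    exists (upd on1 (rt t) true); last first.
      split; last by move/nogap.
      have : weight h * nkeys m.+1 (upd on1 (rt t) true) <= weight h * (nkeys m.+1 on1 +
        1).
        by rewrite leq_mul2l addn1 n1 orbT.
      rewrite -cnt !mulnDr; move: wJ; rewrite /weight; lia.
    split=> //; rewrite eS5 eS4.
    apply: (@labelled_odd N lf rt rank_range rank_neq lf_inj rt_inj past t on
      (upd on1 (rt t) true) lb _ st _ ka J tN LR lab D kaL gt _ oJ mk' _ eLb5) => /=.
    + rewrite (topt J) // (top J) // (top J) ?ltnn ?andbF //.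
    + by move=> a; rewrite /upd; case: (a =P rt t).
    + move=> v; rewrite inE => /orP[/eqP->|/pu3[|[j [hj nj ->]]]].
      * exact: Or32.
      * exact: Or31.
      * by apply: Or33; exists j => //; rewrite qE //; lia.
    + move=> col /andP[/andP[d0 dJ] /lk3[l0 ld]]; rewrite !qE // in d0 dJ.
      split=> // j hj; have [||d1 d2] := ld j => //; first by apply: nz; lia.
      by rewrite -/(q j) -/(q j.-1) -!qE //; lia.
  have oJ : ~~ odd J by case: (odd J) cE.
  apply/wp_seq/wp_asg; rewrite /= eJ1 addn1; set s2 := setv _ _ _.
  apply/wp_seq; apply: wp_imp (@link_down_ok t J (ar s1 Que) st q_le q_inj' q_notin
    st_le st_ac
    s2 eS1 erefl eT1 (leqnn J.+1)) _.
  move=> s3 []; have -> : vr s2 vY = J.+1 by [].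
  move=> ch3 c3 [fv3 fa3]; have {}c3 : ck s3 <= ck s1 + J.+1 by exact: c3.
  have [ac3 pu3 lk3] := ch3.
  have eQ3 : ar s3 Que = ar s1 Que by rewrite fa3.
  have eT3 : vr s3 vT = t by rewrite fv3 //= /upd.
  apply/wp_seq; apply: wp_imp (@push_ok n cmp s3 (vT + Cst 1)%code Que.[Cst 0]%code
    Que.[Cst 0]%code isT isT isT) _.
  move=> s4; rewrite /= eQ3 eT3 addn1 => [] [eS4 c4 fv4 fa4].
  have k4 : keys_ok h s4 on1.
    by have [a1 a2 a3] := k1; split; rewrite ?fv4 ?fa4 // ?fv3 ?fa3.
  have eP4 : vr s4 vP = ka J by rewrite fv4 // fv3 //= /upd.
  apply: wp_put; rewrite /= eP4 !fa4 // eQ3 qE //; set s5 := seta _ _ _ _.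
  exists on1; last first.
    split; last by move/nogap.
    have {}c3 : ck s4 <= ck s1 + J.+1 by rewrite c4.
    rewrite -cnt !mulnDr; move: wJ c3; rewrite /weight; lia.
  split; first by case: k4.
  have eLb5 : ar s5 Lab = upd lb (ka J) (q 0).
    by rewrite /s5 /= /upd /= fa4 // fa3 //= eLb1.
  rewrite -[stack_of s5]/(stack_of s4) eS4.
  apply: (@labelled_even N lf rt rank_range rank_neq lf_inj rt_inj past t on
      on1 lb _ st _ ka J tN LR lab D kaL gt _ oJ mk' _ eLb5) => //=.
  + by rewrite (topt J.+1) // (top J.+1).
  + move=> v; rewrite inE => /orP[/eqP->|/pu3[|[j [hj nj ->]]]].
    * exact: Or32.
    * exact: Or31.
    * by apply: Or33; exists j => //; rewrite qE //; lia.
  + move=> col /andP[/andP[d0 _] /lk3[l0 ld]]; rewrite !qE // in d0.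
    split=> // j hj; have [||d1 d2] := ld j => //; first by apply: nz; lia.
    by rewrite -/(q j) -/(q j.-1) -!qE //; lia.
Qed.

Lemma skip3_ok s on : inv3 t s on -> ~~ (lf t < rt t) -> inv3 t.+1 s on.
Proof.
move=> [k lab] e; split=> //; case: lab => o0 key le ni inj pu ac cv te; split=> //.
- by move=> a oa a0; have [i it hi] := key a oa a0; exists i => //; apply: ltnW.
- by move=> a oa; apply/leqW/le.
- by move=> v /pu; lia.
- move=> x; have [c1 c2] := cv x; split.
    by move=> /c1[i it ci]; exists i => //; apply: ltnW.
  case=> i; rewrite ltnS leq_eqVlt => /orP[/eqP->|it ci]; last by apply: c2; exists i.
  by rewrite /cov; lia.
- move=> col c3 lk sep; have [pa tl] := te col c3 lk sep; split=> // x n0.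
  have [/goodS|[i [it ci ei ui]]] := tl x n0; first by left.
  right; exists i; split=> //; first exact: ltnW.
  by move=> j; rewrite ltnS leq_eqVlt => /orP[/eqP->|/ui//]; rewrite /cov; lia.
Qed.

End StepThree.

(** * Sorting the endpoints *)

Definition prepare : com := (
  vN ::= Size + Cst 1;;
  vM ::= Cst 1;;
  While (vM < vN + vN + Cst 1) (vM ::= vM + vM);;
  vX ::= Cst 1;;
  While (vX < vM) (
    Put Half (vX + vX) vX;;
    Put Half (vX + vX + Cst 1) vX;;
    vX ::= vX + Cst 1))%code.

(** The value of a leaf is its number plus 1, and 0 means that it is empty. *)
Definition earlier : test := EndLt Pos.[vB - Cst 1]%code Pos.[vA - Cst 1]%code.

Definition enter : com := (
  vT ::= Cst 0;;
  While (vT < Size) (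
    Put Pos vT (vT + vT + Cst 1);;
    Put Pos (vN + vT) (vT + vT);;
    vQ ::= vT;; vV ::= vQ + Cst 1;; walk earlier;;
    vQ ::= vN + vT;; vV ::= vQ + Cst 1;; walk earlier;;
    vT ::= vT + Cst 1))%code.

(** A tournament sort: the winner at the root gets the next rank and is
    removed. The ranks 0 and 1 are kept for the sentinel key and for the left
    end of the added interval. *)
Definition extract : com := (
  vC ::= Cst 2;;
  While (Cst 0 < Tree.[Cst 1]) (
    vQ ::= Tree.[Cst 1] - Cst 1;;
    Put Rank vQ vC;; vC ::= vC + Cst 1;;
    vV ::= Cst 0;; walk earlier))%code.

(** The added interval begins before and ends after all others. After the sort
    the tree is empty, and serves again for the keys 0, ..., 2N in the order
    of numbers. *)
Definition rank_all : com := (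
  prepare;; enter;; extract;;
  Put Rank Size (vN + vN);; Put Rank (vN + Size) (Cst 1);;
  vQ ::= Cst 0;; insert_key)%code.

(** A tree with 2 ^ height N leaves has room for the keys 0, ..., 2N. *)
Definition height N := up_log 2 (N + N).+1.

Lemma height_ge N : N + N < 2 ^ height N.
Proof. exact: up_logP. Qed.

Lemma height_lt N : 0 < N -> 2 ^ height N <= 4 * (N + N).
Proof.
move=> N0; rewrite /height; set k := up_log _ _.
have k0 : 0 < k by rewrite up_log_gt0; lia.
have : 2 ^ k.-1 < (N + N).+1.
  rewrite ltnNge; apply/negP => /(up_log_min (isT : 1 < 2)); rewrite -/k; lia.
by rewrite -{2}(prednK k0) expnS; lia.
Qed.

Section Sort.
Variables (n : nat) (cmp : nat -> nat -> bool).
Local Notation N := n.+1.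
Local Notation h := (height N).
Local Notation M := (2 ^ h).
Local Notation wp := (wp n cmp).

(** Leaf i stands for the right endpoint of the interval i, leaf N + i for its
    left endpoint: among equal endpoints the right ones come first. *)
Definition real u := (u < n) || (N <= u < N + n).
(** The positions of other leaves are given a value only to make the relations
    below total orders on all numbers. *)
Definition pos u :=
  if u < n then u + u + 1 else if u < N + n then (u - N) + (u - N) else 0.
Definition ltl u v := cmp (pos u) (pos v).
Definition lel u v := ltl u v || ~~ ltl v u && (u <= v).

Hypothesis ltl_irr : forall u, ltl u u = false.
Hypothesis ltl_trans : forall u v w, ltl u v -> ltl v w -> ltl u w.
Hypothesis ltl_neg : forall u v w, ltl u w -> ltl u v || ltl v w.

Lemma lel_refl u : lel u u.
Proof. by rewrite /lel ltl_irr leqnn. Qed.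

Lemma lel_trans u v w : lel u v -> lel v w -> lel u w.
Proof.
rewrite /lel => /orP[uv|/andP[vu uv]] /orP[vw|/andP[wv vw]].
- by rewrite (ltl_trans uv vw).
- by have := ltl_neg w uv; rewrite (negbTE wv) orbF => ->.
- by have := ltl_neg u vw; rewrite (negbTE vu) => /= ->.
- apply/orP; right; rewrite (leq_trans uv vw) andbT; apply/negP => wu.
  by have := ltl_neg v wu; rewrite (negbTE wv) (negbTE vu).
Qed.

Lemma lel_anti u v : lel u v -> lel v u -> u = v.
Proof.
have asym x y : ltl x y -> ltl y x -> False.
  by move=> xy yx; have := ltl_trans xy yx; rewrite ltl_irr.
rewrite /lel => /orP[uv|/andP[vu uv]] /orP[vw|/andP[wv vw]].
- by case: (asym u v).
- by rewrite uv in wv.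
- by rewrite vw in vu.
- by apply/eqP; rewrite eqn_leq uv vw.
Qed.

Lemma lel_total u v : lel u v || lel v u.
Proof. by rewrite /lel; case: (ltl u v); case: (ltl v u) => //=; exact: leq_total. Qed.

Lemma prepare_ok s : (forall k, ar s Half k = 0) ->
  wp prepare (fun s' => [/\ vr s' vN = N, vr s' vM = M, half_ok h (ar s' Half),
    ck s' <= ck s + (h + M) & frame prepare s s']) s.
Proof.
move=> Half0.
suff: wp prepare (fun s' => [/\ vr s' vN = N, vr s' vM = M, half_ok h (ar s' Half) &
    ck s' <= ck s + (h + M)]) s.
  by move/wp_frame; apply=> s' fr []; split.
do 2 apply/wp_seq/wp_asg; rewrite /= addn1.
apply/wp_seq.
pose I k s' := exists e, [/\ vr s' vN = N, vr s' vM = 2 ^ e, k = h - e,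
   e <= h & ar s' = ar s /\ ck s' + (h - e) <= ck s + h].
apply: (@wp_loop _ _ I _ _ _ h).
- by exists 0; split=> //=; rewrite subn0.
- move=> k s1 [e [eN eM -> le [ea ec]]] /=; rewrite eN eM => lt.
  have lt' : e < h.
    by rewrite -(ltn_exp2l _ _ (isT : 1 < 2)); have := height_ge N; lia.
  apply: wp_asg; rewrite /= eM; exists (h - e.+1); first by lia.
  exists e.+1; split=> //; first by rewrite /= /upd /= expnS mul2n addnn.
  by split=> //=; lia.
move=> k s1 [e [eN eM _ le [ea ec]]] /=; rewrite eN eM => ge.
have eh : e = h.
  apply/eqP; rewrite eqn_leq le; apply: up_log_min => //.
  by move: ge; rewrite -leqNgt addn1.
rewrite eh subnn addn0 in eM ec.
apply/wp_seq/wp_asg; rewrite /=.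
pose I' k s' := [/\ vr s' vN = N, vr s' vM = M, k = M - vr s' vX,
   0 < vr s' vX <= M & (forall k, k < (vr s' vX).*2 -> ar s' Half k = k./2) /\
   ck s' + (M - vr s' vX) <= ck s1 + M].
have M0 : 0 < M by rewrite expn_gt0.
apply: (@wp_loop _ _ I' _ _ _ (M - 1)).
- split=> //; split; last by rewrite /= /upd /=; lia.
  by rewrite /= /upd /= ea => -[|[|j]].
- move=> j s2 [fN fM -> /andP[x0 xM] [hh ec']] /=; rewrite fM => lt.
  apply/wp_seq/wp_put/wp_seq/wp_put/wp_asg; rewrite /=.
  exists (M - (vr s2 vX).+1); first by lia.
  split; rewrite /= /upd /= ?addn1 //.
  split; last by lia.
  move=> i; case: eqP => [->|ne1] hi; first lia.
  case: eqP => [->|ne2]; first lia.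
  by apply: hh; lia.
move=> j s2 [fN fM _ /andP[x0 xM] [hh ec']] /=; rewrite fM => gx.
split=> //; last by lia.
by move=> i hi; apply: hh; rewrite expnS in hi; lia.
Qed.

(** Both endpoints of an interval are entered at the same time. *)
Definition entered T u := (u < T) || (N <= u < N + T).

Lemma leaf_lt u : u < N + n -> u < M.
Proof. by have := height_ge N; lia. Qed.

(** A left child stays the winner unless the right one is strictly earlier:
    ties are won by the smaller leaf. *)
Lemma earlier_walk_ok s (on : pred nat) b : let q := vr s vQ in
  q < N + n -> vr s vM = M -> vr s vV = (if b then q.+1 else 0) ->
  half_ok h (ar s Half) -> tree_ok h lel (ar s Tree) on ->
  (forall u, upd on q b u -> ar s Pos u = pos u) ->
  wp (walk earlier) (fun s' => [/\ tree_ok h lel (ar s' Tree) (upd on q b),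
    ck s' <= ck s + h & frame (walk earlier) s s']) s.
Proof.
move=> q lq eM eV hh tok hp.
apply: (@walk_ok h lel lel_refl lel_trans n cmp earlier
  (fun x y => cmp (ar s Pos (y - 1)) (ar s Pos (x - 1))) s) => //.
- by move=> s' e; rewrite /= e.
- exact: leaf_lt.
- move=> u v /andP[uv _] ou ov; rewrite !subn1 /= !hp // -/(ltl v u) /lel.
  by case: ifP => [->//|->]; rewrite (ltnW uv) orbT.
Qed.

Lemma enter_ok s : vr s vN = N -> vr s vM = M -> half_ok h (ar s Half) ->
  (forall k, ar s Tree k = 0) ->
  wp enter (fun s' => [/\ tree_ok h lel (ar s' Tree) real,
    nkeys M real = n + n, forall u, real u -> ar s' Pos u = pos u,
    ck s' <= ck s + n * (1 + 2 * h) & frame enter s s']) s.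
Proof.
move=> eN eM hh T0.
suff: wp enter (fun s' => [/\ tree_ok h lel (ar s' Tree) real,
    nkeys M real = n + n, forall u, real u -> ar s' Pos u = pos u &
    ck s' <= ck s + n * (1 + 2 * h)]) s.
  by move/wp_frame; apply=> s' fr []; split.
apply/wp_seq/wp_asg; rewrite /=.
pose I k s' := exists T, [/\ vr s' vN = N, vr s' vM = M, ar s' Half = ar s Half,
  [/\ vr s' vT = T, T <= n & k = n - T] &
  [/\ tree_ok h lel (ar s' Tree) (entered T), nkeys M (entered T) = T + T,
    forall u, entered T u -> ar s' Pos u = pos u &
    ck s' <= ck s + T * (1 + 2 * h)]].
have e0 : entered 0 =1 pred0 by move=> u; rewrite /entered /=; lia.
apply: (@wp_loop _ _ I _ _ _ n).
- exists 0; split=> //; first by rewrite subn0.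
  split; rewrite /= ?mul0n ?addn0 //.
  + by split=> // e u _ _; rewrite /best T0 => v _; rewrite e0.
  + by rewrite (nkeys_eq _ e0) /nkeys count_pred0.
  + by move=> u; rewrite e0.
- move=> k s1 [T [fN fM fH [fT Tn ->] [tok cnt hp ec]]] /=; rewrite fT => lt.
  apply/wp_seq/wp_put/wp_seq/wp_put/wp_seq/wp_asg/wp_seq/wp_asg; rewrite /=.
  set s2 := setv _ _ _.
  have pos2 u : entered T.+1 u -> ar s2 Pos u = pos u.
    rewrite /s2 /= /upd /= fN fT /entered /pos => hu.
    case: eqP => [->|ne1]; first by rewrite ifF ?ifT; lia.
    case: eqP => [->|ne2]; first by rewrite lt.
    by apply: hp; rewrite /entered; lia.
  have ent1 u : upd (entered T) T true u -> entered T.+1 u.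
    by rewrite /upd /entered; case: eqP => [->|_]; lia.
  have ent2 : upd (upd (entered T) T true) (N + T) true =1 entered T.+1.
    move=> u; rewrite /upd /entered; case: eqP => [->|ne1]; first by lia.
    by case: eqP => [->|ne2]; lia.
  have eQ2 : vr s2 vQ = T by rewrite /s2 /= /upd /= fT.
  apply/wp_seq; apply: wp_imp (@earlier_walk_ok s2 (entered T) true _ _ _ _ _ _) _.
  + by rewrite eQ2; lia.
  + by rewrite /s2 /= /upd.
  + by rewrite eQ2 /s2 /= /upd /= fT addn1.
  + by rewrite /s2 /= /upd /= fH.
  + by [].
  + by rewrite eQ2 => u /ent1/pos2.
  move=> s3; rewrite eQ2 => [] [tok3 c3 [fv3 fa3]].
  have {}c3 : ck s3 <= (ck s1).+1 + h by exact: c3.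
  apply/wp_seq/wp_asg/wp_seq/wp_asg; rewrite /=; set s4 := setv _ _ _.
  have eQ4 : vr s4 vQ = N + T by rewrite /s4 /= /upd /= !fv3 //= /upd /= fN fT.
  have eV4 : vr s4 vV = (N + T).+1.
    by rewrite /s4 /= /upd /= !fv3 //= /upd /= fN fT addn1.
  apply/wp_seq; apply: wp_imp (@earlier_walk_ok s4 (upd (entered T) T true) true _ _ _ _
    _ _) _.
  + by rewrite eQ4; lia.
  + by rewrite /s4 /= /upd /= fv3.
  + by rewrite eQ4.
  + by rewrite /s4 /= fa3 // /s2 /= /upd /= fH.
  + by [].
  + move=> u; rewrite eQ4 ent2 => /pos2 <-.
    by rewrite /s4 /= fa3.
  move=> s5; rewrite eQ4 => [] [tok5 c5 [fv5 fa5]].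
  have {}c5 : ck s5 <= ck s3 + h by exact: c5.
  have eT5 : vr s5 vT = T by rewrite fv5 //= /upd /= fv3 //= /upd.
  apply: wp_asg; rewrite /= eT5 addn1.
  exists (n - T.+1); first by lia.
  exists T.+1; split=> //; rewrite /= ?/upd /=.
  + by rewrite fv5 //= /upd /= fv3 //= /upd.
  + by rewrite fv5 //= /upd /= fv3 //= /upd.
  + by rewrite fa5 //= fa3.
  split.
  + by apply: tree_ok_ext tok5 => u _; apply: ent2.
  + rewrite -(nkeys_eq _ ent2).
    have T1 : entered T T = false by rewrite /entered; lia.
    have T2 : upd (entered T) T true (N + T) = false.
      by rewrite /upd ifF /entered; lia.
    have := @nkeys_upd M (upd (entered T) T true) (N + T) true (leaf_lt _).
    have := @nkeys_upd M (entered T) T true (leaf_lt _).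
    rewrite T1 T2 cnt => h1 h2; have := h1 _; have := h2 _; lia.
  + by move=> u /pos2 <-; rewrite fa5 //= fa3.
  + by rewrite mulSn; lia.
- move=> k s1 [T [fN fM fH [fT Tn _] [tok cnt hp ec]]] /=; rewrite fT => ge.
  have eT : T = n by lia.
  by rewrite eT in tok cnt hp ec.
Qed.

Lemma tree_ok_empty le le' tree (on : pred nat) : (forall u, u < M -> ~~ on u) ->
  tree_ok h le tree on -> tree_ok h le' tree pred0.
Proof.
move=> e [t0 ok]; split=> // f u hf hu; have := ok f u hf hu.
rewrite /best; case: (tree _) => [|v] //.
by case=> lv ov _ _; have := e v lv; rewrite ov.
Qed.

Lemma extract_ok s : vr s vM = M -> half_ok h (ar s Half) ->
  tree_ok h lel (ar s Tree) real -> nkeys M real = n + n ->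
  (forall u, real u -> ar s Pos u = pos u) ->
  wp extract (fun s' => [/\ tree_ok h (fun u v => v <= u) (ar s' Tree) pred0,
    forall u, real u -> 1 < ar s' Rank u < N + N,
    forall u v, real u -> real v -> (ar s' Rank u < ar s' Rank v) = lel u v && (u != v),
    ck s' <= ck s + (n + n) * h.+1 & frame extract s s']) s.
Proof.
move=> eM hh tok cnt hp.
suff: wp extract (fun s' => [/\ tree_ok h (fun u v => v <= u) (ar s' Tree) pred0,
    forall u, real u -> 1 < ar s' Rank u < N + N,
    forall u v, real u -> real v -> (ar s' Rank u < ar s' Rank v) = lel u v && (u != v) &
    ck s' <= ck s + (n + n) * h.+1]) s.
  by move/wp_frame; apply=> s' fr []; split.
apply/wp_seq/wp_asg; rewrite /=.
pose I k s' := exists on : pred nat, [/\ vr s' vM = M, half_ok h (ar s' Half),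
   (forall u, real u -> ar s' Pos u = pos u),
   [/\ tree_ok h lel (ar s' Tree) on, forall u, on u -> real u, k = nkeys M on,
     vr s' vC + k = n + n + 2 & ck s' + k * h.+1 <= ck s + (n + n) * h.+1] &
   1 < vr s' vC /\
   [/\ forall u, real u -> ~~ on u -> 1 < ar s' Rank u < vr s' vC,
     forall u v, real u -> real v -> ~~ on u -> ~~ on v ->
       (ar s' Rank u < ar s' Rank v) = lel u v && (u != v) &
     forall u v, real u -> ~~ on u -> on v -> lel u v]].
have realM u : real u -> u < M by move=> hu; apply: leaf_lt; move: hu; rewrite /real; lia.
apply: (@wp_loop _ _ I _ _ _ (n + n)).
- exists real; split=> //; first by split=> //=; rewrite /upd /=; lia.
  by split=> //; split=> [u ru|u v ru _|u v ru]; rewrite ?ru.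
- move=> k s1 [on [fM fH fP [tk onr -> eC eck] [C1 [rk1 rk2 rk3]]]] /= tpos.
  have root := tree_root tk; case Et: (ar s1 Tree 1) tpos root => [//|w] _ [lw ow mw].
  apply/wp_seq/wp_asg/wp_seq/wp_put/wp_seq/wp_asg/wp_seq/wp_asg; rewrite /=.
  set s2 := setv _ _ _.
  have eQ2 : vr s2 vQ = w by rewrite /s2 /= /upd /= Et subn1.
  have rw := onr w ow.
  have onw u : upd on w false u -> on u /\ u <> w by rewrite /upd; case: eqP.
  apply: wp_imp (@earlier_walk_ok s2 on false _ _ _ _ _ _) _.
  + by rewrite eQ2; move: rw; rewrite /real; lia.
  + by rewrite /s2 /= /upd.
  + by [].
  + by rewrite /s2 /= /upd /=.
  + by [].
  + by rewrite eQ2 => u /onw[/onr/fP <- _].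
  move=> s3; rewrite eQ2 => [] [tk3 c3 [fv3 fa3]].
  have {}c3 : ck s3 <= (ck s1).+1 + h by exact: c3.
  have cnt3 := @nkeys_del M on w lw ow.
  have eR3 u : ar s3 Rank u = if u == w then vr s1 vC else ar s1 Rank u.
    by rewrite fa3 //= /upd /= Et subn1.
  have eC3 : vr s3 vC = (vr s1 vC).+1 by rewrite fv3 //= /upd /= addn1.
  exists (nkeys M (upd on w false)); first by rewrite -cnt3.
  exists (upd on w false); split.
  + by rewrite fv3 //= /upd.
  + by rewrite fa3.
  + by move=> u ru; rewrite fa3 //= /upd /= fP.
  + split=> //; [by move=> u /onw[/onr]|by rewrite eC3; lia|].
    by move: eck; rewrite -cnt3 mulSn; lia.
  + have offw u : ~~ upd on w false u -> u = w \/ (u <> w /\ ~~ on u).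
      by rewrite /upd; case: eqP => [|ne nu]; [left|right].
    split; first by rewrite eC3 ltnW.
    split.
    * move=> u ru /offw[->|[ne nu]]; rewrite eR3 eC3; first by rewrite eqxx ltnSn C1.
      by rewrite (introF eqP ne); have := rk1 u ru nu; lia.
    * move=> u v ru rv /offw[->|[ne nu]] /offw[->|[ne' nv]]; rewrite !eR3 ?eqxx ?andbF
        ?ltnn //.
      - rewrite (introF eqP ne'); have := rk1 v rv nv => hv.
        have -> : vr s1 vC < ar s1 Rank v = false by lia.
        symmetry; apply/negbTE/negP => /andP[wv _]; apply: ne'.
        by apply: lel_anti wv; apply: rk3.
      - rewrite (introF eqP ne) andbT; have := rk1 u ru nu => hu.
        by rewrite rk3 //; lia.
      - by rewrite (introF eqP ne) (introF eqP ne') rk2.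
    * move=> u v ru /offw[->|[ne nu]] /onw[ov nev]; last exact: rk3.
      by apply: mw => //; apply/realM/onr.
- move=> k s1 [on [fM fH fP [tk onr kE eC eck] [C1 [rk1 rk2 rk3]]]] /= t0.
  have root := tree_root tk; case Et: (ar s1 Tree 1) t0 root => [|//] _ none.
  have non u : real u -> ~~ on u by move=> ru; apply/none/realM.
  have k0 : k = 0.
    rewrite kE; apply/eqP; rewrite -leqn0 leqNgt -has_count; apply/hasPn => u.
    by rewrite mem_iota => hu; apply: none.
  split.
  + exact: tree_ok_empty tk.
  + move=> u ru; have := rk1 u ru (non u ru); lia.
  + by move=> u v ru rv; apply: rk2 => //; apply: non.
  + by move: eck; lia.
Qed.

Definition ranked (rk : nat -> nat) : Prop :=
  [/\ rk n = N + N, rk (N + n) = 1, forall u, real u -> 1 < rk u < N + N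
    & forall u v, real u -> real v -> (rk u < rk v) = lel u v && (u != v)].

Section Ranked.
Variable rk : nat -> nat.
Hypothesis rkP : ranked rk.
Local Notation lf := (fun i => rk (N + i)).
Local Notation rt := rk.

Lemma leaf_cases u : u < N + N -> [\/ real u, u = n | u = N + n].
Proof.
rewrite /real => hu.
have [->|n1] := eqVneq u n; first exact: Or32.
have [->|n2] := eqVneq u (N + n); first exact: Or33.
by apply: Or31; lia.
Qed.

Lemma ranked_range u : u < N + N -> 0 < rk u <= N + N.
Proof.
have [h1 h2 h3 _] := rkP.
by move=> /leaf_cases[/h3|->|->]; rewrite ?h1 ?h2; lia.
Qed.

Lemma ranked_inj u v : u < N + N -> v < N + N -> rk u = rk v -> u = v.
Proof.
have [h1 h2 h3 h4] := rkP.
move=> /leaf_cases hu /leaf_cases hv e.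
case: hu e => [ru|->|->]; case: hv => [rv|->|->]; rewrite ?h1 ?h2 //; try (have := h3 u
  ru);
  try (have := h3 v rv); try lia.
move=> _ _ e; apply/eqP/negPn/negP => ne.
have := h4 u v ru rv; have := h4 v u rv ru; rewrite e ltnn eq_sym ne !andbT.
by have := lel_total u v; case: (lel u v); case: (lel v u).
Qed.

Lemma ends_range i : i < N -> 0 < lf i <= N + N /\ 0 < rt i <= N + N.
Proof. by move=> lt; split; apply: ranked_range; lia. Qed.

Lemma ends_neq i j : i < N -> j < N -> lf i <> rt j.
Proof. by move=> li lj /ranked_inj; lia. Qed.

Lemma lf_inj i j : i < N -> j < N -> lf i = lf j -> i = j.
Proof. by move=> li lj /ranked_inj; lia. Qed.

Lemma rt_inj i j : i < N -> j < N -> rt i = rt j -> i = j.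
Proof. by move=> li lj /ranked_inj; lia. Qed.

End Ranked.

Definition empty_store := MkStore (fun=> 0) (fun=> fun=> 0) (fun=> 0) 0.

Lemma rank_all_ok : wp rank_all (fun s => [/\ vr s vN = N,
   keys_ok h s (upd pred0 0 true), ranked (ar s Rank),
   ck s <= h + M + n * (1 + 2 * h) + (n + n) * h.+1 + h &
   frame rank_all empty_store s]) empty_store.
Proof.
suff: wp rank_all (fun s => [/\ vr s vN = N,
   keys_ok h s (upd pred0 0 true), ranked (ar s Rank) &
   ck s <= h + M + n * (1 + 2 * h) + (n + n) * h.+1 + h]) empty_store.
  by move/wp_frame; apply=> s' fr []; split.
apply/wp_seq; apply: wp_imp (prepare_ok _) _ => // s1 [eN1 eM1 hh1 c1 [fv1 fa1]].
have {}c1 : ck s1 <= h + M by exact: c1.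
apply/wp_seq; apply: wp_imp (enter_ok eN1 eM1 hh1 _) _; first by move=> k; rewrite fa1.
move=> s2 [tk2 cnt2 hp2 c2 [fv2 fa2]].
have eM2 : vr s2 vM = M by rewrite fv2.
have hh2 : half_ok h (ar s2 Half) by rewrite fa2.
apply/wp_seq; apply: wp_imp (extract_ok eM2 hh2 tk2 cnt2 hp2) _.
move=> s3 [tk3 rk1 rk2 c3 [fv3 fa3]].
have eN3 : vr s3 vN = N by rewrite fv3 // fv2.
apply/wp_seq/wp_put/wp_seq/wp_put/wp_seq/wp_asg; rewrite /= eN3; set s4 := setv _ _ _.
have k4 : keys_ok h s4 pred0.
  split=> //; first by rewrite /s4 /= /upd /= fv3.
  by rewrite /s4 /= /upd /= fa3.
apply: wp_imp (@insert_ok n cmp h pred0 s4 k4 _) _; first by rewrite /s4 /= /upd /=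
  expn_gt0.
move=> s5 [k5 c5 [fv5 fa5]]; split.
- by rewrite fv5.
- exact: k5.
- have rE u : ar s5 Rank u = if u == N + n then 1 else if u == n then N + N else ar s3
    Rank u.
    by rewrite fa5 //= /upd.
  have rR u : real u -> ar s5 Rank u = ar s3 Rank u.
    by rewrite rE /real => hu; do 2 (rewrite ifF; last by lia).
  split.
  + by rewrite rE eqxx ifF //; lia.
  + by rewrite rE eqxx.
  + by move=> u ru; rewrite rR // rk1.
  + by move=> u v ru rv; rewrite !rR // rk2.
- have {}c5 : ck s5 <= ck s3 + h by exact: c5.
  lia.
Qed.

End Sort.

(** * The complete algorithms *)

Notation Col := 10 (only parsing).

Definition sweep (step : com) : com := (
  vT ::= Cst 0;;
  While (vT < vN) (
    vL ::= Rank.[vN + vT];;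
    vR ::= Rank.[vT];;
    If (vL < vR) step Skip;;
    vT ::= vT + Cst 1))%code.

(** Pops the links; vX is the least colour different from those of the other
    two labels. *)
Definition colour : com :=
  While (Cst 0 < vS)%code (
    vS ::= vS - Cst 1;;
    vA ::= Col.[StA.[vS]];;
    vB ::= Col.[StB.[vS]];;
    vX ::= Cst 1;;
    If (vA + vB < Cst 2) (If (Cst 0 < vA + vB) (vX ::= Cst 2) Skip) Skip;;
    If (Cst 0 < vA) (If (Cst 0 < vB) (vX ::= Cst 0) Skip) Skip;;
    Put Col StV.[vS] vX)%code.

Definition output : com := (
  vT ::= Cst 0;;
  While (vT < Size) (Out vT Col.[vT + Cst 1];; vT ::= vT + Cst 1))%code.

Definition algorithm (step : com) : com :=
  (rank_all;; sweep step;; colour;; output)%code.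

Lemma acyclic_uniq st : acyclic st -> uniq (pushed st).
Proof. by elim: st => //= [[[v a] b] st IH] /and4P[-> _ _ /IH]. Qed.

Lemma acyclic_size st N : acyclic st -> (forall v, v \in pushed st -> v <= N) ->
  size st <= N.+1.
Proof.
move=> /acyclic_uniq u h; rewrite -(size_map (fun k : link => k.1.1)) -(size_iota 0 N.+1).
by apply: uniq_leq_size => // v /h; rewrite mem_iota.
Qed.

Lemma mex2_pos a b : 0 < a -> 0 < b -> mex2 a b = 0.
Proof. by case: a; case: b. Qed.

Lemma mex2_zero a b : (a == 0) || (b == 0) -> mex2 a b = if a + b == 1 then 2 else 1.
Proof. by case: a => [|[|a]]; case: b => [|[|b]]. Qed.

Section Programs.
Variables (n : nat) (cmp : nat -> nat -> bool).
Local Notation wp := (wp n cmp).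

Lemma colour_ok s : wp colour (fun s' =>
  ar s' Col =1 paint (stack_of s) (ar s Col) /\ ck s' <= ck s + size (stack_of s)) s.
Proof.
have szS s1 : size (stack_of s1) = vr s1 vS by rewrite size_rev size_mkseq.
rewrite szS.
pose I k s' := [/\ k = vr s' vS, ck s' + k <= ck s + vr s vS &
  paint (stack_of s') (ar s' Col) =1 paint (stack_of s) (ar s Col)].
apply: (@wp_loop _ _ I _ _ _ (vr s vS)) => //; last first.
  move=> k s1 [-> ec p] /=; rewrite -eqn0Ngt => /eqP S0; split; last by lia.
  by move=> v; rewrite -p /stack_of S0.
move=> k s1 [-> ec p] /= Spos.
set S := (vr s1 vS).-1; set v := ar s1 StV S.
set a := ar s1 Col (ar s1 StA S); set b := ar s1 Col (ar s1 StB S).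
do 4 apply/wp_seq/wp_asg; rewrite /=.
set s2 := setv _ _ _.
have eA : vr s2 vA = a by rewrite /s2 /= /upd /= subn1.
have eB : vr s2 vB = b by rewrite /s2 /= /upd /= subn1.
apply/wp_seq; apply: (@wp_imp _ _ (fun s' => s' = setv s2 vX (if a + b == 1 then 2 else
  1))).
  apply: wp_if => c1.
    apply: wp_if => c2.
      apply: wp_asg; move: c1 c2; rewrite /teval /eval eA eB => c1 c2.
      by congr setv; case: eqP => //; lia.
    apply: wp_skip; move: c1 c2; rewrite /teval /eval eA eB => c1 c2.
    rewrite ifF; last by lia.
    by rewrite -[in RHS](_ : vr s2 vX = 1) ?setv_same.
  apply: wp_skip; move: c1; rewrite /teval /eval eA eB => c1.
  rewrite ifF; last by lia.
  by rewrite -[in RHS](_ : vr s2 vX = 1) ?setv_same.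
move=> _ ->; set s3 := setv _ _ _.
have eA3 : vr s3 vA = a by [].
have eB3 : vr s3 vB = b by [].
apply/wp_seq; apply: (@wp_imp _ _ (fun s' => s' = setv s3 vX (mex2 a b))).
  have e3 : vr s3 vX = if a + b == 1 then 2 else 1 by [].
  have skip : (a == 0) || (b == 0) -> s3 = setv s3 vX (mex2 a b).
    by move=> ab; rewrite mex2_zero // -e3 setv_same.
  apply: wp_if => c1.
    apply: wp_if => c2.
      apply: wp_asg; move: c1 c2; rewrite /teval /eval eA3 eB3 => c1 c2.
      by congr setv; rewrite mex2_pos.
    apply: wp_skip; move: c1 c2; rewrite /teval /eval eA3 eB3 => c1 c2.
    by apply: skip; lia.
  apply: wp_skip; move: c1; rewrite /teval /eval eA3 => c1.
  by apply: skip; lia.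
move=> _ ->; apply: wp_put; rewrite /=.
exists S; first by rewrite /S; lia.
split.
- by rewrite /= /upd /= subn1.
- by move: ec; rewrite /= /S; lia.
- move=> w; rewrite -p; set s4 := seta _ _ _ _.
  have eS : stack_of s1 = (v, ar s1 StA S, ar s1 StB S) :: stack_of s4.
    rewrite /stack_of -{1}(prednK Spos) mkseqS rev_rcons -/S.
    by congr (_ :: rev _); rewrite /s4 /= /upd /= subn1.
  by rewrite eS /= /upd /= subn1.
Qed.

Lemma output_ok s : wp output (fun s' =>
  (forall i, i < n -> ou s' i = ar s Col i.+1) /\ ck s' <= ck s + n) s.
Proof.
apply/wp_seq/wp_asg; rewrite /=.
pose I k s' := [/\ k = n - vr s' vT, vr s' vT <= n, ar s' Col = ar s Col,
  (forall i, i < vr s' vT -> ou s' i = ar s Col i.+1) & ck s' + k <= ck s + n].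
apply: (@wp_loop _ _ I _ _ _ n).
- by split=> //; rewrite /= /upd /= ?subn0.
- move=> k s1 [-> Tn eC eo ec] /= lt.
  apply/wp_seq/wp_out => //; apply: wp_asg; rewrite /= addn1.
  exists (n - (vr s1 vT).+1); first by lia.
  split; rewrite /= /upd /= ?addn1 //; last by lia.
  move=> i; case: eqP => [->|ne] hi; first by rewrite eC.
  by apply: eo; lia.
- move=> k s1 [_ Tn eC eo ec] /= ge; split; last by lia.
  by move=> i hi; apply: eo; lia.
Qed.

Section Sweep.
Variables (N : nat) (rk : nat -> nat) (step : com) (W : nat).
Variable inv : nat -> store -> pred nat -> Prop.
Local Notation K := (nkeys (N + N).+1).
Hypothesis inv_setv : forall t s on x v, x \in [:: vT; vL; vR] ->
  inv t s on -> inv t (setv s x v) on.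
Hypothesis inv_tick : forall t s on, inv t s on -> inv t (tick s) on.
Hypothesis step_vars : (vN \notin vwrites step) && (vT \notin vwrites step).
Hypothesis step_rank : Rank \notin awrites step.
Hypothesis step_ok : forall t s on, t < N -> inv t s on -> vr s vT = t ->
  vr s vL = rk (N + t) -> vr s vR = rk t -> rk (N + t) < rk t ->
  wp step (fun s' => exists2 on', inv t.+1 s' on' &
    ck s' + W * K on' <= ck s + W * (K on + 4)) s.
Hypothesis inv_skip : forall t s on, t < N -> ~~ (rk (N + t) < rk t) ->
  inv t s on -> inv t.+1 s on.

(** Here nkeys is the potential, and a step may create four keys at most, or
    spend as much. *)
Lemma sweep_ok s on : vr s vN = N -> ar s Rank = rk -> inv 0 s on ->
  wp (sweep step) (fun s' => exists2 on', inv N s' on' &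
    ck s' <= ck s + W * K on + N * (W * 4 + 1)) s.
Proof.
move=> eN eR i0; apply/wp_seq/wp_asg; rewrite /=.
pose I k s' := exists on', [/\ k = N - vr s' vT, vr s' vT <= N, vr s' vN = N,
  ar s' Rank = rk & inv (vr s' vT) s' on' /\
  ck s' + W * K on' <= ck s + W * K on + vr s' vT * (W * 4 + 1)].
apply: (@wp_loop _ _ I _ _ _ N).
- exists on; split=> //; first by rewrite /= /upd /= subn0.
  by split; [apply: inv_setv | rewrite /= addn0].
- move=> k s1 [on1 [-> TN fN fR [i1 c1]]] /=; rewrite fN => lt.
  set t := vr s1 vT in lt i1 c1 *.
  do 2 apply/wp_seq/wp_asg; rewrite /=; set s2 := setv _ _ _.
  have i2 : inv t s2 on1 by do 2 apply: inv_setv => //; apply: inv_tick.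
  have eT2 : vr s2 vT = t by [].
  have eL2 : vr s2 vL = rk (N + t) by rewrite /s2 /= /upd /= fN fR.
  have eR2 : vr s2 vR = rk t by rewrite /s2 /= /upd /= fR.
  have body : wp (If (vL < vR)%code step Skip) (fun s' => exists2 on', inv t.+1 s' on' &
      ck s' + W * K on' <= (ck s1).+1 + W * (K on1 + 4)) s2.
    apply: wp_if; rewrite /teval /eval eL2 eR2 => c.
      exact: step_ok.
    by apply: wp_skip; exists on1; [apply: inv_skip|rewrite /= mulnDr; lia].
  apply/wp_seq; apply: wp_frame body _ => s3 [fv3 fa3] [on3 i3 c3].
  have [v1 v2] := andP step_vars.
  have eT3 : vr s3 vT = t by rewrite fv3 //= cats0.
  apply: wp_asg; rewrite /= eT3 addn1.
  exists (N - t.+1); first by lia.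
  exists on3; split; rewrite /= ?/upd //=.
  + by rewrite fv3 //= cats0.
  + by rewrite fa3 //= cats0.
  + split; first by apply: inv_setv.
    by move: c3; rewrite mulnDr mulSn; lia.
- move=> k s1 [on1 [_ TN fN fR [i1 c1]]] /=; rewrite fN => ge.
  have eT : vr s1 vT = N by lia.
  by exists on1; [rewrite -{1}eT|rewrite eT in c1; lia].
Qed.
End Sweep.
End Programs.

(** * Correctness of the algorithms *)

Definition properly lf rt k col t := forall t' x, t' <= t ->
  k <= count (cov lf rt ^~ x) (iota 0 t') -> good lf rt col t' x.

Lemma properlyS lf rt k col t : properly lf rt k col t ->
  (forall x, k <= count (cov lf rt ^~ x) (iota 0 t.+1) -> good lf rt col t.+1 x) ->
  properly lf rt k col t.+1.
Proof.
move=> h1 h2 t' x; rewrite leq_eqVlt => /orP[/eqP->|lt]; [exact: h2|exact: h1].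
Qed.

Lemma properly0 lf rt k col : 0 < k -> properly lf rt k col 0.
Proof. by move=> k0 t' x; rewrite leqn0 => /eqP-> /=; rewrite leqNgt k0. Qed.

Section Runs.
Variables (n : nat) (cmp : nat -> nat -> bool).
Local Notation N := n.+1.
Local Notation h := (height N).
Local Notation wp := (wp n cmp).
Local Notation W := (weight h).
Hypothesis ltl_irr : forall u, ltl n cmp u u = false.
Hypothesis ltl_trans : forall u v w, ltl n cmp u v -> ltl n cmp v w -> ltl n cmp u w.
Hypothesis ltl_neg : forall u v w, ltl n cmp u w -> ltl n cmp u v || ltl n cmp v w.

(** The terms come from the sort, the sweep, the colouring and the output, in
    this order. *)
Definition clock_bound := h + 2 ^ h + n * (1 + 2 * h) + (n + n) * h.+1 + h +
  (W * (N + N).+1 + N * (W * 4 + 1)) + N.+1 + n.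

Section Ranks.
Variable rk : nat -> nat.
Hypothesis rkP : ranked n cmp rk.
Local Notation lf := (fun i => rk (N + i)).
Local Notation rt := rk.
Local Notation R1 := (ends_range rkP).
Local Notation R2 := (ends_neq rkP).
Local Notation R3 := (lf_inj rkP).
Local Notation R4 := (rt_inj rkP).

(** This is where three covers are needed: by the chain, only two super-
    intervals can account for a cell. *)
Lemma supers_two t (on : pred nat) en lb x : chain lf rt t on en ->
  count (inside^~ x) (supers (N + N) on en lb) <= 2.
Proof.
move=> ch; rewrite count_map count_filter -size_filter leqNgt; apply/negP.
set s := filter _ _; have st : sorted ltn s by
  apply/sorted_filter/iota_ltn_sorted/ltn_trans.
have all_s a : a \in s -> [/\ on a, 0 < a & a <= x < en a].
  by rewrite mem_filter mem_iota /= /inside /= => /andP[/andP[h1 h2] /andP[h3 _]].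
case: s st all_s => [|a [|b [|c s]]] //= /and3P[ab bc _] all_s _.
have [|oa a0 ax] := all_s a; first by rewrite inE eqxx.
have [|ob b0 bx] := all_s b; first by rewrite !inE eqxx orbT.
have [|oc c0 cx] := all_s c; first by rewrite !inE eqxx !orbT.
by have := chain_two ch oa ob oc; rewrite ab bc => /(_ isT); lia.
Qed.

Definition stage2 t s on :=
  inv2 h N lf rt (fun col => properly lf rt 3 col t) t s on.

Lemma stage2_up t s on : inv2 h N lf rt (fun col => properly lf rt 3 col t) t.+1 s on ->
  stage2 t.+1 s on.
Proof.
case=> k li ch F; split=> // col c2 lk; have [pa fth] := F col c2 lk.
split=> //; apply: properlyS pa _ => x; have [//|le] := fth.2 x; move=> cnt.
by have := leq_trans (leq_trans cnt le) (supers_two (ar s Lab) x ch).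
Qed.

(** In the end only one label is left, which makes every colouring separated.
    *)
Definition stage3 t s on :=
  inv3 h lf rt (fun col => properly lf rt 2 col t) t s on /\
  (t = N -> forall x, label_at on (ar s Lab) x != 0 -> label_at on (ar s Lab) x = N).

(** A cell with two covers has no single cover. *)
Lemma tells_two phi col t x : covered lf rt phi t -> tells lf rt phi col t ->
  2 <= count (cov lf rt ^~ x) (iota 0 t) -> good lf rt col t x.
Proof.
move=> cv te cnt; have n0 : phi x != 0.
  apply/cv; have : has (cov lf rt ^~ x) (iota 0 t) by rewrite has_count; lia.
  by case/hasP => i; rewrite mem_iota => hi ci; exists i.
have [//|[i [it ci _ ui]]] := te x n0.
suff : count (cov lf rt ^~ x) (iota 0 t) <= count (pred1 i) (iota 0 t).
  by rewrite count_uniq_mem ?iota_uniq //; case: (i \in _); lia.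
rewrite -!size_filter; apply: uniq_leq_size; first by rewrite filter_uniq ?iota_uniq.
move=> j; rewrite !mem_filter mem_iota /= => /andP[cj hj].
by rewrite hj (ui j) // eqxx.
Qed.

Lemma inv3_up t s on : inv3 h lf rt (fun col => properly lf rt 2 col t) t.+1 s on ->
  inv3 h lf rt (fun col => properly lf rt 2 col t.+1) t.+1 s on.
Proof.
case=> k lab; split=> //; case: lab => o0 key le ni inj pu ac cv te; split=> //.
move=> col c3 lk sep; have [pa tl] := te col c3 lk sep; split=> //.
by apply: properlyS pa _ => x; apply: tells_two tl.
Qed.

Lemma stage2_setv t s on x v : x \in [:: vT; vL; vR] -> stage2 t s on ->
  stage2 t (setv s x v) on.
Proof.
move=> hx [[k1 k2 k3] li ch F]; rewrite !inE in hx.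
have hM : x != vM by case/or3P: hx => /eqP->.
have hS : x != vS by case/or3P: hx => /eqP->.
have eS : stack_of (setv s x v) = stack_of s.
  by rewrite /stack_of /= /upd eq_sym (negbTE hS).
split; rewrite ?eS //; first by split; rewrite //= /upd eq_sym (negbTE hM).
by move=> col c2; rewrite eS; apply: F.
Qed.

Lemma stage3_setv t s on x v : x \in [:: vT; vL; vR] -> stage3 t s on ->
  stage3 t (setv s x v) on.
Proof.
move=> hx [[[k1 k2 k3] lab] last]; rewrite !inE in hx.
have hM : x != vM by case/or3P: hx => /eqP->.
have hS : x != vS by case/or3P: hx => /eqP->.
have eS : stack_of (setv s x v) = stack_of s.
  by rewrite /stack_of /= /upd eq_sym (negbTE hS).
split=> //; split; rewrite ?eS //.
by split; rewrite //= /upd eq_sym (negbTE hM).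
Qed.

Lemma stage2_step t s on : t < N -> stage2 t s on -> vr s vT = t ->
  vr s vL = lf t -> vr s vR = rt t -> lf t < rt t ->
  wp step2 (fun s' => exists2 on', stage2 t.+1 s' on' &
    ck s' + W * nkeys (N + N).+1 on' <= ck s + W * (nkeys (N + N).+1 on + 4)) s.
Proof.
move=> tN i eT eL eR lr.
apply: wp_imp (@step2_ok n cmp h N lf rt (height_ge N) R1 R2 R3 R4 _ t tN s on i eT eL
  eR lr) _.
move=> s' [on' i' le]; exists on'; first exact: stage2_up.
by apply: leq_trans le _; rewrite leq_add2l leq_mul2l; lia.
Qed.

Lemma stage2_skip t s on : t < N -> ~~ (lf t < rt t) -> stage2 t s on -> stage2 t.+1 s on.
Proof. move=> tN lr i; apply: stage2_up.
exact: (@skip2_ok h N lf rt (height_ge N) _ t tN s on i lr).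
 Qed.

Lemma virtual_last i x : i < N -> cov lf rt i x -> 0 < x < N + N.
Proof.
by move=> iN; rewrite /cov; have [/andP[? _] /andP[_ ?]] := ends_range rkP iN; lia.
Qed.

Lemma virtual_ends : lf n = 1 /\ rt n = N + N.
Proof. by have [h1 h2 _ _] := rkP. Qed.

Lemma stage3_step t s on : t < N -> stage3 t s on -> vr s vT = t ->
  vr s vL = lf t -> vr s vR = rt t -> lf t < rt t ->
  wp step3 (fun s' => exists2 on', stage3 t.+1 s' on' &
    ck s' + W * nkeys (N + N).+1 on' <= ck s + W * (nkeys (N + N).+1 on + 4)) s.
Proof.
move=> tN [i _] eT eL eR lr.
apply: wp_imp (@step3_ok n cmp h N lf rt (height_ge N) R1 R2 R3 R4 _ t tN s on i eT eL
  eR lr) _.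
move=> s' [on' i' [le full]]; exists on' => //; split; first exact: inv3_up.
case=> tn x n0; have [lfn rtn] := virtual_ends.
have cv' := lab_covered i'.2; have cv := lab_covered i.2.
have [c1 _] := cv' x; have [j jt cj] := c1 n0.
have xr := virtual_last (leq_trans jt tN) cj.
rewrite -tn; apply: full; last by rewrite tn lfn rtn.
exists 1; first by rewrite tn lfn rtn; lia.
apply/eqP/negPn/negP => /cv[k kt ck].
have [_ _ h3 _] := rkP; have := h3 (N + k).
by move: ck; rewrite /cov /real; lia.
Qed.

Lemma stage3_skip t s on : t < N -> ~~ (lf t < rt t) -> stage3 t s on -> stage3 t.+1 s on.
Proof.
move=> tN lr [i _]; split; first exact/inv3_up/(@skip3_ok h N lf rt (height_ge N) _ t tN
  s on i lr).
by case=> tn; have [lfn rtn] := virtual_ends; move: lr; rewrite tn lfn rtn; lia.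
Qed.

Lemma stage2_colour s on : stage2 N s on -> (forall v, ar s Col v = 0) ->
  let col := paint (stack_of s) (ar s Col) in
  size (stack_of s) <= N.+1 /\ (forall v, col v < 2) /\ properly lf rt 3 col N.
Proof.
move=> [k li ch F] c0 col; split.
  by apply: acyclic_size (live_acyclic li) _; apply: (live_pushed li).
have col2 v : col v < 2 by apply: paint_lt2 => [|w]; rewrite ?c0 //; apply: (live_diag
  li).
split=> //.
by have [] := F col col2 (linked_paint _ (live_acyclic li)).
Qed.

Lemma stage3_colour s on : stage3 N s on -> (forall v, ar s Col v = 0) ->
  let col := paint (stack_of s) (ar s Col) in
  size (stack_of s) <= N.+1 /\ (forall v, col v < 3) /\ properly lf rt 2 col N.
Proof.
move=> [[k lab] last] c0 col; split.
  by apply: acyclic_size (lab_acyclic lab) _ => v /(lab_pushed lab)/andP[].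
have col3 v : col v < 3 by apply: paint_lt3 => w; rewrite c0.
split=> //.
have sep : separated (label_at on (ar s Lab)) col.
  by move=> x n0 n1; rewrite (last erefl x n0) (last erefl _ n1) eqxx.
by have [] := lab_tells lab col3 (linked_paint _ (lab_acyclic lab)) sep.
Qed.

Lemma empty_chain s : (forall k, ar s End k = 0) -> chain lf rt 0 (upd pred0 0 true) (ar
  s End).
Proof.
move=> e0; have z a : upd pred0 0 true a -> a = 0 by rewrite /upd; case: eqP.
split=> //; try by move=> a /z->.
- by move=> a b /z-> /z->.
- by move=> a b c /z-> /z-> /z->.
Qed.

Lemma stage2_start s : keys_ok h s (upd pred0 0 true) -> vr s vS = 0 ->
  (forall k, ar s End k = 0) -> stage2 0 s (upd pred0 0 true).
Proof.
move=> k S0 e0; have eS : stack_of s = [::] by rewrite /stack_of S0.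
have z a : upd pred0 0 true a -> a = 0 by rewrite /upd; case: eqP.
split=> //.
- by rewrite eS; split=> //; [move=> a /z->|move=> a b /z-> /z->].
- exact: empty_chain.
- move=> col c2 _; split; first exact: properly0.
  rewrite (_ : supers _ _ _ _ = [::]); first exact: faithful0.
  rewrite /supers (@eq_in_filter _ _ pred0) ?filter_pred0 // => a.
  by rewrite mem_iota /upd; case: eqP => [->|].
Qed.

Lemma stage3_start s : keys_ok h s (upd pred0 0 true) -> vr s vS = 0 ->
  (forall k, ar s Lab k = 0) -> stage3 0 s (upd pred0 0 true).
Proof.
move=> k S0 l0; have eS : stack_of s = [::] by rewrite /stack_of S0.
have z a : upd pred0 0 true a -> a = 0 by rewrite /upd; case: eqP.
split=> //; split=> //; rewrite eS; split=> //.
- by move=> a /z->.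
- by move=> a _; rewrite l0.
- by move=> a b /z-> /z->.
- by move=> x; rewrite /label_at l0; split=> // -[].
- move=> col c3 _ _; split; first exact: properly0.
  by move=> x; rewrite /label_at l0.
Qed.

End Ranks.

Definition solves k m (c : com) := wp c (fun s => exists rk col, [/\ ranked n cmp rk,
  forall i, i < n -> ou s i = col i.+1, forall v, col v < k,
  properly (fun i => rk (N + i)) rk m col N & ck s <= clock_bound]) empty_store.

Lemma nkeys_le k (on : pred nat) : nkeys k on <= k.
Proof. by rewrite /nkeys -{2}(size_iota 0 k) count_size. Qed.

Lemma algorithm2_ok : solves 2 3 (algorithm step2).
Proof.
apply/wp_seq; apply: wp_imp (rank_all_ok ltl_irr ltl_trans ltl_neg) _.
move=> s1 [eN1 k1 rkP c1 [fv1 fa1]]; set rk := ar s1 Rank in rkP.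
have i1 : stage2 rk 0 s1 (upd pred0 0 true).
  by apply: stage2_start k1 _ _ => [|k]; rewrite ?fv1 ?fa1.
apply/wp_seq.
apply: wp_frame (@sweep_ok n cmp N rk step2 W (stage2 rk) _ _ isT isT _ _ s1 _ eN1 erefl
  i1) _.
- by move=> t s on x v; apply: stage2_setv.
- by move=> t s on [k li ch F]; split.
- by move=> t s on tN; apply: stage2_step.
- by move=> t s on tN lr; apply: stage2_skip.
move=> s2 [fv2 fa2] [on2 i2 c2].
have col0 v : ar s2 Col v = 0 by rewrite fa2 // fa1.
have [sz [c2' pr]] := stage2_colour i2 col0.
apply/wp_seq; apply: wp_imp (colour_ok n cmp s2) _ => s3 [eC c3].
apply: wp_imp (output_ok n cmp s3) _ => s4 [eo c4].
exists rk, (paint (stack_of s2) (ar s2 Col)); split=> //.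
  by move=> i hi; rewrite eo.
have := nkeys_le (N + N).+1 (upd pred0 0 true).
move=> kb; have : W * nkeys (N + N).+1 (upd pred0 0 true) <= W * (N + N).+1.
  by rewrite leq_mul2l kb orbT.
rewrite /clock_bound; lia.
Qed.

Lemma algorithm3_ok : solves 3 2 (algorithm step3).
Proof.
apply/wp_seq; apply: wp_imp (rank_all_ok ltl_irr ltl_trans ltl_neg) _.
move=> s1 [eN1 k1 rkP c1 [fv1 fa1]]; set rk := ar s1 Rank in rkP.
have i1 : stage3 rk 0 s1 (upd pred0 0 true).
  by apply: stage3_start k1 _ _ => [|k]; rewrite ?fv1 ?fa1.
apply/wp_seq.
apply: wp_frame (@sweep_ok n cmp N rk step3 W (stage3 rk) _ _ isT isT _ _ s1 _ eN1 erefl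
  i1) _.
- by move=> t s on x v; apply: stage3_setv.
- by move=> t s on [[k lab] last]; split=> //; split.
- by move=> t s on tN; apply: stage3_step.
- by move=> t s on tN lr; apply: stage3_skip.
move=> s2 [fv2 fa2] [on2 i2 c2].
have col0 v : ar s2 Col v = 0 by rewrite fa2 // fa1.
have [sz [c2' pr]] := stage3_colour i2 col0.
apply/wp_seq; apply: wp_imp (colour_ok n cmp s2) _ => s3 [eC c3].
apply: wp_imp (output_ok n cmp s3) _ => s4 [eo c4].
exists rk, (paint (stack_of s2) (ar s2 Col)); split=> //.
  by move=> i hi; rewrite eo.
have := nkeys_le (N + N).+1 (upd pred0 0 true).
move=> kb; have : W * nkeys (N + N).+1 (upd pred0 0 true) <= W * (N + N).+1.
  by rewrite leq_mul2l kb orbT.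
rewrite /clock_bound; lia.
Qed.

End Runs.

(** * Points of the line and cells *)

From mathcomp Require Import all_order all_algebra ring.
From mathcomp Require Import classical_sets reals topology normedtype landau.
From mathcomp Require Import sequences exp.
Import Order.TTheory GRing.Theory Num.Theory.
Import numFieldNormedType.Exports.

Section Endpoints.
Variables (R : realType) (n : nat) (I : 'I_n -> R * R).
Local Notation N := n.+1.
Local Notation cmp := (endpoint_lt I).
Local Open Scope ring_scope.

Lemma size_endpoints : size (endpoints I) = (n + n)%N.
Proof.
rewrite /endpoints size_flatten /shape -map_comp sumnE big_map big_enum /=.
by rewrite sum_nat_const card_ord muln2 addnn.
Qed.

Lemma nth_endpoints (i : 'I_n) :
  (endpoints I)`_(i + i) = (I i).1 /\ (endpoints I)`_(i + i + 1) = (I i).2.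
Proof.
have gen (s : seq 'I_n) (k : nat) (i0 : 'I_n) : (k < size s)%N ->
    (flatten [seq [:: (I j).1; (I j).2] | j <- s])`_(k + k) = (I (nth i0 s k)).1 /\
    (flatten [seq [:: (I j).1; (I j).2] | j <- s])`_(k + k + 1) = (I (nth i0 s k)).2.
  elim: s k => // j s IH [|k] //= lt.
  by rewrite -(IH k lt).1 -(IH k lt).2 !addnS.
by have := gen (enum 'I_n) i i; rewrite size_enum_ord nth_ord_enum; apply.
Qed.

Definition value u := (endpoints I)`_(pos n u).

Lemma pos_lt u : (0 < n)%N -> (pos n u < size (endpoints I))%N.
Proof. by rewrite size_endpoints /pos; do ?case: ifP; lia. Qed.

Lemma ltl_value u v : (0 < n)%N -> ltl n cmp u v = (value u < value v).
Proof. by move=> n0; rewrite /ltl /endpoint_lt !pos_lt. Qed.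

Lemma ltl0 u v : n = 0 -> ltl n cmp u v = false.
Proof. by rewrite /ltl /endpoint_lt size_endpoints => n0; rewrite ltnNge; case: leqP =>
  //; lia. Qed.

Lemma ltl_irr u : ltl n cmp u u = false.
Proof. by case: (posnP n) => [/ltl0->//|n0]; rewrite ltl_value // ltxx. Qed.

Lemma ltl_trans u v w : ltl n cmp u v -> ltl n cmp v w -> ltl n cmp u w.
Proof.
by case: (posnP n) => [/ltl0->//|n0]; rewrite !ltl_value //; apply: lt_trans.
Qed.

Lemma ltl_neg u v w : ltl n cmp u w -> ltl n cmp u v || ltl n cmp v w.
Proof.
case: (posnP n) => [/ltl0->//|n0]; rewrite !ltl_value // => uw.
by have [//|vu] := ltP (value u) (value v); rewrite /= (le_lt_trans vu uw).
Qed.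

Variable rk : nat -> nat.
Hypothesis rkP : ranked n cmp rk.

(** An open interval covers x iff its left endpoint is before x and its right
    endpoint is not, where a right endpoint equal to x counts as before x and
    a left endpoint does not. This agrees with the order of equal endpoints in
    the sort. *)
Definition before (x : R) u : bool :=
  if (u < n)%N then value u <= x else value u < x.

Definition cell (x : R) : nat :=
  \max_(u < N + n | real n u && before x u) rk u.

Lemma before_down x u v : real n u -> real n v -> lel n cmp u v ->
  before x v -> before x u.
Proof.
move=> ru rv; have n0 : (0 < n)%N by move: ru; rewrite /real; lia.
rewrite /lel !ltl_value // /before => /orP[uv|/andP[]].
  by case: ifP => _ vx; case: ifP => _;
    rewrite ?(lt_le_trans uv vx) ?(ltW (lt_le_trans uv vx)) ?(lt_trans uv vx) ?(ltW
      (lt_trans uv vx)).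
rewrite -leNgt => uv le; case: ifP => hv; case: ifP => hu.
- exact: le_trans.
- by lia.
- by move=> vx; apply: ltW (le_lt_trans uv vx).
- exact: le_lt_trans.
Qed.

(** By before_down, the endpoints before x come first in the sort, so that the
    largest of their ranks determines them. *)
Lemma cellE x u : real n u -> (rk u <= cell x)%N = before x u.
Proof.
move=> ru; have [_ _ r3 r4] := rkP.
have un : (u < N + n)%N by move: ru; rewrite /real; lia.
apply/idP/idP => [le|bu]; last first.
  by apply: (@leq_bigmax_cond _ _ (fun i : 'I_(N + n) => rk i) (Ordinal un)); rewrite /=
    ru bu.
have : (0 < #|[pred u : 'I_(N + n) | real n u && before x u]|)%N.
  rewrite lt0n; apply/negP => /eqP/card0_eq e; move: le.
  rewrite /cell big_pred0; first by have := r3 u ru; lia.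
  by move=> i; have := e i; rewrite inE.
move/(eq_bigmax_cond (fun i : 'I_(N + n) => rk i)) => [w]; rewrite inE => /andP[rw bw] e.
have {e} e : cell x = rk w by exact: e.
move: le; rewrite e leq_eqVlt => /orP[/eqP uw|].
  by rewrite (ranked_inj rkP _ _ uw) //; move: rw; rewrite /real; lia.
by rewrite r4 // => /andP[uw _]; apply: before_down bw.
Qed.

Lemma covers_cell x (i : 'I_n) : covers I i x = cov (fun i => rk (N + i)) rk i (cell x).
Proof.
have [e1 e2] := nth_endpoints i; have ni := ltn_ord i.
rewrite /cov ltnNge !cellE /real ?ni ?ltn_add2l ?ni ?leq_addr ?orbT //.
rewrite /before /value /pos ni ifF; last by lia.
have -> : (N + i - N + (N + i - N) = i + i)%N by lia.
by rewrite ltn_add2l ni ifF ?e1 ?e2 -?ltNge; last by lia.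
Qed.

Lemma card_covers x t : (t <= n)%N ->
  #|[set i : 'I_n | (i < t)%N && covers I i x]| =
  count (cov (fun i => rk (N + i)) rk ^~ (cell x)) (iota 0 t).
Proof.
move=> tn; rewrite -sum1dep_card.
rewrite (eq_bigl (fun i : 'I_n => (i < t)%N && cov (fun i => rk (N + i)) rk i (cell
  x))); last first.
  by move=> i; rewrite covers_cell.
rewrite -(big_mkord (fun i => (i < t)%N && cov (fun i => rk (N + i)) rk i (cell x))
  (fun=> 1%N)).
rewrite sum1_count /index_iota subn0 -(subnKC tn) iotaD count_cat.
rewrite [X in (_ + X)%N](_ : _ = 0%N) ?addn0.
  by apply: eq_in_count => i; rewrite mem_iota => /andP[_ ->].
by apply/eqP; rewrite -leqn0 leqNgt -has_count; apply/hasPn => i; rewrite mem_iota; lia.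
Qed.

Lemma proper_quasi_online m k (col : nat -> nat) (chi : 'I_n -> 'I_k) :
  (forall i : 'I_n, chi i = col i.+1 :> nat) ->
  properly (fun i => rk (N + i)) rk m col N -> quasi_online_proper I m chi.
Proof.
move=> hchi pr t /andP[_ tn] x; rewrite card_covers // => cnt.
have [i [j [it jt ci cj ne]]] := pr t (cell x) (leqW tn) cnt.
have li := leq_trans it tn; have lj := leq_trans jt tn.
exists (Ordinal li), (Ordinal lj); split; rewrite // ?covers_cell //.
by rewrite -val_eqE /= !hchi.
Qed.

End Endpoints.

(** * Running on the machine *)

Definition machine c := compile 0 c.

(** The number of steps allowed is a function of n alone; as halted states are
    fixed, a run that stops earlier is still halted then. *)
Definition running_time c n := (csize c * (clock_bound n).+1)%N.

Lemma halted_stays cmp P s t t' : (t <= t')%N -> halted P (iter t (step cmp P) s) ->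
  iter t' (step cmp P) s = iter t (step cmp P) s.
Proof.
move=> /subnK <- hs; elim: (t' - t)%N => // d IH.
by rewrite addSn iterS IH /step hs.
Qed.

Lemma solves_run (R : realType) n (I : 'I_n -> R * R) k m c : wfc c ->
  solves n (endpoint_lt I) k m c ->
  exists chi : 'I_n -> 'I_k,
    outputs_within (machine c) I (running_time c n) chi /\ quasi_online_proper I m chi.
Proof.
move=> wf [s' e [rk [col [rkP co ck' pr cl]]]].
have cd : code_at (machine c) 0 (compile 0 c) by move=> j z lt; rewrite add0n.
have ag : agree n empty_store (reg (init n), memory (init n)).
  by split=> //= x; rewrite /rvar.
have [t [d [rn [_ _ _ ag'] le]]] := compile_ok e wf cd ag.
have hl : halted (machine c) (iter t (step (endpoint_lt I) (machine c)) (init n)).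
  by rewrite rn /halted /= /machine size_compile.
have tT : (t <= running_time c n)%N.
  by apply: leq_trans le _; rewrite leq_mul2l ltnS subn0 cl orbT.
exists (fun i => Ordinal (ck' i.+1)); split; last first.
  exact: (proper_quasi_online rkP _ pr).
rewrite /outputs_within /run (halted_stays tT hl); split=> // i.
by rewrite rn /= ag' // co.
Qed.

Lemma step2_wf : wfc (algorithm step2).
Proof. by []. Qed.

Lemma step3_wf : wfc (algorithm step3).
Proof. by []. Qed.

(** The constant is generous: each of the terms is at most a multiple of n *
    height n.+1, and 2 ^ height is linear in n by height_lt. *)
Lemma clock_bound_le n : (1 < n)%N ->
  (clock_bound n <= 200 * (n * height n.+1))%N.
Proof.
move=> n1; rewrite /clock_bound /weight.
have := @height_lt n.+1 isT; set h := height _; set M := (2 ^ h)%N.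
move=> hM; have h1 : (0 < h)%N by rewrite up_log_gt0; lia.
have : (n <= n * h)%N by rewrite leq_pmulr.
have : (h <= n * h)%N by rewrite leq_pmull //; lia.
have -> : ((4 * h + 4) * (n.+1 + n.+1).+1 = 8 * (n * h) + 8 * n + 12 * h + 12)%N by lia.
have -> : (n.+1 * ((4 * h + 4) * 4 + 1) = 16 * (n * h) + 17 * n + 16 * h + 17)%N by lia.
have -> : ((n + n) * h.+1 = 2 * (n * h) + 2 * n)%N by lia.
have -> : (n * (1 + 2 * h) = 2 * (n * h) + n)%N by lia.
lia.
Qed.

(** By height_lt, 2 ^ height (n + 1) <= 16 n <= n ^ 5. *)
Lemma height_le_log (R : realType) n : (1 < n)%N ->
  ((height n.+1)%:R * ln 2 <= 5 * ln n%:R :> R)%R.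
Proof.
move=> n1.
have n0 : (0 < n%:R :> R)%R by rewrite ltr0n; lia.
rewrite -[(5)%R]/(5%:R : R)%R !mulr_natl -!lnXn ?ltr0n ?(ltnW n1) //.
rewrite ler_ln ?posrE ?exprn_gt0 // -!natrX ler_nat.
apply: leq_trans (@height_lt n.+1 isT) _.
have h4 : (2 ^ 4 <= n ^ 4)%N by rewrite leq_exp2r.
by rewrite expnS; nia.
Qed.

Local Open Scope classical_set_scope.

Lemma running_time_bigO (R : realType) c :
  ((fun n => (running_time c n)%:R : R) =O_\oo (fun n => n%:R * ln n%:R : R))%R.
Proof.
apply/eqO_exP.
have l2 : (0 < ln 2 :> R)%R by rewrite ln_gt0 // ltr1n.
exists ((csize c * 201).+1%:R * (5 / ln 2))%R.
  by rewrite !mulr_gt0 ?invr_gt0 ?ltr0n.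
exists 2%N => // n /= n1.
rewrite !ger0_norm ?mulr_ge0 ?ln_ge0 ?ler0n ?ler1n ?(ltnW n1) //.
have hl := @height_le_log R n n1.
have cb : (running_time c n <= (csize c * 201).+1 * (n * height n.+1))%N.
  rewrite /running_time mulSn; apply: leq_trans (leq_addl _ _).
  rewrite -mulnA leq_mul2l; apply/orP; right.
  have := clock_bound_le n1; set X := (n * _)%N => hX.
  have : (0 < X)%N by rewrite muln_gt0 up_log_gt0; lia.
  lia.
apply: (@le_trans _ _ ((csize c * 201).+1%:R * (n%:R * (height n.+1)%:R))%R).
  by rewrite -!natrM ler_nat.
rewrite -!mulrA; apply: ler_wpM2l; first exact: ler0n.
rewrite [leRHS](_ : _ = n%:R * (5 * ln n%:R / ln 2))%R; last by ring.
by rewrite ler_wpM2l ?ler0n // ler_pdivlMr.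
Qed.

Theorem theorem15 (R : realType) :
  nlogn_quasi_online_algorithm R 3 2 /\ nlogn_quasi_online_algorithm R 2 3.
Proof.
split.
- exists (machine (algorithm step2)), (running_time (algorithm step2)).
  split=> [|n I]; first exact: running_time_bigO.
  apply: solves_run; first exact: step2_wf.
  by apply: algorithm2_ok; [exact: ltl_irr|exact: ltl_trans|exact: ltl_neg].
- exists (machine (algorithm step3)), (running_time (algorithm step3)).
  split=> [|n I]; first exact: running_time_bigO.
  apply: solves_run; first exact: step3_wf.
  by apply: algorithm3_ok; [exact: ltl_irr|exact: ltl_trans|exact: ltl_neg].
Qed.
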